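(* Let $\Phi,\Psi:\mathcal H\to\mathcal G$ be two Lie groupoid morphisms. If $\Phi$ and $\Psi$ are equivalent, then their deformation cohomologies $H^{*}_{def}(\Phi)$ and $H^{*}_{def}(\Psi)$ are isomorphic.
   Context: Let $\mathcal H\rightrightarrows N$, $\mathcal G\rightrightarrows M$ be Lie groupoids with source $s$ and target $t$. Two morphisms $\Phi,\Psi:\mathcal H\to\mathcal G$ with base maps $\phi,\psi$ are equivalent if they are smoothly naturally isomorphic as functors: there is a smooth map $\tau:N\to\mathcal G$ with $s\circ\tau=\phi$ and $\Psi(h)=\tau(t(h))\Phi(h)\tau(s(h))^{-1}$ for all $h\in\mathcal H$. Deformation complex of a morphism $(\Phi,\phi):\mathcal H\to\mathcal G$. Let $A_{\mathcal G}=\ker(ds)|_M$ be the Lie algebroid of $\mathcal G$, $i$ the inversion, $r_g,l_g$ the differentials of right and left translation by $g$, and $\bar m(g,h)=gh^{-1}$ the division map. $\mathcal H^{(k)}$ is the manifold of $k$-strings $(h_1,\dots,h_k)$ with $s(h_i)=t(h_{i+1})$. For $k\ge1$, $C^k_{def}(\Phi)$ is the space of smooth maps $c:\mathcal H^{(k)}\to T\mathcal G$ with $c(h_1,\dots,h_k)\in T_{\Phi(h_1)}\mathcal G$ and such that $ds\circ c(h_1,\dots,h_k)$ does not depend on $h_1$; the differential is $$(\delta_\Phi c)(h_1,\dots,h_{k+1})=-d\bar m\big(c(h_1h_2,h_3,\dots,h_{k+1}),c(h_2,\dots,h_{k+1})\big)+\sum_{i=2}^k(-1)^ic(h_1,\dots,h_ih_{i+1},\dots,h_{k+1})+(-1)^{k+1}c(h_1,\dots,h_k).$$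 For $k=0$, $C^0_{def}(\Phi)=\Gamma(\phi^*A_{\mathcal G})$ and $(\delta_\Phi\alpha)(h)=r_{\Phi(h)}(\alpha_{t(h)})+l_{\Phi(h)}(di(\alpha_{s(h)}))$. The cohomology is $H^*_{def}(\Phi)$. *)

(* Defs.v *)
(* MathComp-Analysis; the real numbers are an arbitrary R : realType. *)
From HB Require Import structures.
From mathcomp Require Import all_boot all_order all_algebra.
From mathcomp Require Import all_classical all_reals all_analysis.
Set Implicit Arguments.
Unset Strict Implicit.
Unset Printing Implicit Defensive.
Import Order.TTheory GRing.Theory Num.Theory.
Import numFieldNormedType.Exports.
Local Open Scope classical_set_scope.
Local Open Scope ring_scope.

(** * Smooth functions on R^n, and smooth spaces *)

Fixpoint Ck (R : realType) (n : nat) (k : nat) (U : set 'rV[R]_n)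
    (f : 'rV[R]_n -> R) : Prop :=
  (forall x, U x -> {for x, continuous f}) /\
  match k with
  | 0%N => True
  | k'.+1 => forall i : 'I_n,
      (forall x, U x -> derivable f x (delta_mx ord0 i)) /\
      Ck k' U (fun x => 'D_(delta_mx ord0 i) f x)
  end.

(* f is of class C^oo on some neighbourhood of x. *)
Definition smooth_near (R : realType) (n : nat) (x : 'rV[R]_n)
    (f : 'rV[R]_n -> R) : Prop :=
  exists U : set 'rV[R]_n, [/\ open U, U x & forall k, Ck k U f].

(* A topological space with a sheaf of real functions, given by its germs:
   [smooth_at x f] reads "f is smooth on a neighbourhood of x".  Functions are
   total; their values away from x are irrelevant.  The manifolds are
   singled out below; the same type also carries the (smooth structures of
   the) tangent bundles, fibres, fibred products and nerves of a groupoid. *)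
Record smoothSpace (R : realType) := SmoothSpace {
  space :> topologicalType;
  smooth_at : space -> (space -> R) -> Prop
}.

Section SmoothSpaces.
Variable R : realType.
Implicit Types X Y Z : smoothSpace R.

Definition smooth_on X (U : set X) (f : X -> R) : Prop :=
  forall x, U x -> smooth_at x f.

Definition smooth_map X Y (F : X -> Y) : Prop :=
  continuous F /\
  forall x (f : Y -> R), smooth_at (F x) f -> smooth_at x (f \o F).

(* Locally isomorphic to (R^n, C^oo): phi is a homeomorphism from the open set
   U onto an open set of R^n, with inverse psi, and it identifies the smooth
   functions. *)
Definition locally_euclidean X (n : nat) : Prop :=
  forall x : X, exists (U : set X) (phi : X -> 'rV[R]_n) (psi : 'rV[R]_n -> X),
    [/\ open U /\ U x,
        open (phi @` U),
        forall y, U y -> psi (phi y) = y,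
        (forall y, U y -> {for y, continuous phi}) /\
        (forall z, (phi @` U) z -> {for z, continuous psi}) &
        forall y (f : X -> R), U y ->
          (smooth_at y f <-> smooth_near (phi y) (f \o psi))].

(* The Hausdorff axiom is kept apart: it is required of the base of a Lie
   groupoid, not of its space of arrows. *)
Definition manifold X : Prop :=
  @second_countable X /\ exists n, locally_euclidean X n.

(** ** Initial smooth structures *)

(* Given a family F of functions u defined on subsets U of T, the coarsest
   topology making all the U open and all the u : U -> R continuous; the smooth
   functions are locally of the form Phi(u_1, ..., u_m) with Phi of class C^oo
   and u_j in F.  On an embedded submanifold of a product, with F the
   coordinates of the factors, these are the functions that locally extend to
   smooth functions on the product. *)
Definition subbase (T : Type) (F : set (set T * (T -> R))) : set (set T) :=
  [set A | exists p, F p /\ exists2 O : set R, open O & A = p.1 `&` p.2 @^-1` O].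

Definition initial_carrier (T : Type) (F : set (set T * (T -> R))) : Type := T.

HB.instance Definition _ T F :=
  gen_eqMixin (@initial_carrier T F).
HB.instance Definition _ T F :=
  gen_choiceMixin (@initial_carrier T F).
HB.instance Definition _ T F :=
  isSubBaseTopological.Build (@initial_carrier T F) (subbase F) id.

Definition initial_smooth (T : Type) (F : set (set T * (T -> R)))
    (x : initial_carrier F) (f : initial_carrier F -> R) : Prop :=
  exists (m : nat) (p : 'I_m -> set T * (T -> R)) (Phi : 'rV[R]_m -> R),
    [/\ forall i, F (p i) /\ (p i).1 x,
        smooth_near (\row_i (p i).2 x) Phi &
        \forall y \near x, f y = Phi (\row_i (p i).2 y)].

Definition initial_space (T : Type) (F : set (set T * (T -> R))) :
    smoothSpace R :=
  SmoothSpace (@initial_smooth T F).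

(* The local smooth functions of X, pulled back along F : T -> X. *)
Definition pullback (T : Type) X (F : T -> X) : set (set T * (T -> R)) :=
  [set p | exists (U : set X) (u : X -> R),
     [/\ open U, smooth_on U u & p = (F @^-1` U, u \o F)]].

(* The fibre F^-1(y) and the fibred product of F and G. *)
Definition fibre X Y (F : X -> Y) (y : Y) : smoothSpace R :=
  initial_space (pullback (fun x : {x : X | F x = y} => sval x)).

Definition fibprod X Y Z (F : X -> Z) (G : Y -> Z) : smoothSpace R :=
  initial_space
    (pullback (fun p : {p : X * Y | F p.1 = G p.2} => (sval p).1) `|`
     pullback (fun p : {p : X * Y | F p.1 = G p.2} => (sval p).2)).

(** ** Tangent vectors *)

(* Tangent vectors at x are derivations of the algebra of germs at x.  A
   derivation is extended by 0 to the functions that are not smooth at x, so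
   that equality of functionals is equality of derivations. *)
Definition vec X : Type := (X -> R) -> R.

Record tangent X (x : X) (v : vec X) : Prop := Tangent {
  tangent_out : forall f, ~ smooth_at x f -> v f = 0;
  tangent_germ : forall f g, smooth_at x f -> smooth_at x g ->
    (\forall y \near x, f y = g y) -> v f = v g;
  tangent_lin : forall (a : R) f g, smooth_at x f -> smooth_at x g ->
    v (fun y => a * f y + g y) = a * v f + v g;
  tangent_leibniz : forall f g, smooth_at x f -> smooth_at x g ->
    v (fun y => f y * g y) = f x * v g + g x * v f
}.

(* The differential of F at x. *)
Definition diff_at X Y (F : X -> Y) (x : X) (v : vec X) : vec Y :=
  fun f => if `[< smooth_at (F x) f >] then v (f \o F) else 0.

Definition submersion X Y (F : X -> Y) : Prop :=
  smooth_map F /\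
  forall x w, tangent (F x) w -> exists2 v, tangent x v & diff_at F x v = w.

(* The tangent bundle; its smooth structure is generated by the functions
   u \o pi and du, for u a smooth function on an open set U. *)
Definition tangent_bundle X : smoothSpace R :=
  let TX := {p : X * vec X | tangent p.1 p.2} in
  initial_space
    (pullback (fun p : TX => (sval p).1) `|`
     [set q | exists (U : set X) (u : X -> R), [/\ open U, smooth_on U u &
        q = ((fun p : TX => (sval p).1) @^-1` U,
             fun p : TX => (sval p).2 u)]]).

(* x |-> c x is a smooth vector field along b : X -> Y, that is, a smooth map
   X -> TY such that c x lies in T_(b x) Y. *)
Definition smooth_along X Y (b : X -> Y) (c : X -> vec Y) : Prop :=
  exists2 C : X -> tangent_bundle Y, smooth_map C &
    forall x, sval (C x) = (b x, c x).

(* For F the inclusion of a submanifold, the vector v seen as a tangent vector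
   to the submanifold (it exists and is unique when v is tangent to it). *)
Definition tangent_lift X Y (F : X -> Y) (x : X) (v : vec Y) : vec X :=
  xget 0 [set w | tangent x w /\ diff_at F x w = v].

(* The vector (v, w) tangent to a fibred product at p. *)
Definition tangent_pair X Y Z (F : X -> Z) (G : Y -> Z) (p : fibprod F G)
    (v : vec X) (w : vec Y) : vec (fibprod F G) :=
  xget 0 [set u | [/\ tangent p u,
    diff_at (fun q : fibprod F G => (sval q).1 : X) p u = v &
    diff_at (fun q : fibprod F G => (sval q).2 : Y) p u = w]].

End SmoothSpaces.

(** * Lie groupoids *)

(* [gmul g h] is the composite gh, meaningful when src g = tgt h. *)
Record lieGroupoid (R : realType) := LieGroupoid {
  obj : smoothSpace R;
  arr : smoothSpace R;
  src : arr -> obj;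
  tgt : arr -> obj;
  ident : obj -> arr;
  ginv : arr -> arr;
  gmul : arr -> arr -> arr;
  src_mul : forall g h, src g = tgt h -> src (gmul g h) = src h;
  tgt_mul : forall g h, src g = tgt h -> tgt (gmul g h) = tgt g;
  mul_assoc : forall g h k, src g = tgt h -> src h = tgt k ->
    gmul g (gmul h k) = gmul (gmul g h) k;
  src_unit : forall x, src (ident x) = x;
  tgt_unit : forall x, tgt (ident x) = x;
  mul_unitl : forall g, gmul (ident (tgt g)) g = g;
  mul_unitr : forall g, gmul g (ident (src g)) = g;
  src_inv : forall g, src (ginv g) = tgt g;
  tgt_inv : forall g, tgt (ginv g) = src g;
  mul_invl : forall g, gmul (ginv g) g = ident (src g);
  mul_invr : forall g, gmul g (ginv g) = ident (tgt g);
  obj_manifold : manifold obj;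
  obj_hausdorff : hausdorff_space obj;
  arr_manifold : manifold arr;
  src_submersion : submersion src;
  tgt_submersion : submersion tgt;
  unit_smooth : smooth_map ident;
  inv_smooth : smooth_map ginv;
  mul_smooth :
    smooth_map (fun p : fibprod src tgt => gmul (sval p).1 (sval p).2)
}.

Arguments src {R l} _.
Arguments tgt {R l} _.
Arguments ident {R l} _.
Arguments ginv {R l} _.
Arguments gmul {R l} _ _.

Record morphism (R : realType) (H G : lieGroupoid R) := Morphism {
  mor :> arr H -> arr G;
  mor_obj : obj H -> obj G;
  mor_smooth : smooth_map mor;
  mor_obj_smooth : smooth_map mor_obj;
  mor_src : forall h, src (mor h) = mor_obj (src h);
  mor_tgt : forall h, tgt (mor h) = mor_obj (tgt h);
  mor_mul : forall g h, src g = tgt h -> mor (gmul g h) = gmul (mor g) (mor h)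
}.

(* Taking h to be a unit, the last equation yields tgt \o tau = mor_obj Psi. *)
Definition equivalent (R : realType) (H G : lieGroupoid R)
    (Phi Psi : morphism H G) : Prop :=
  exists tau : obj H -> arr G,
    [/\ smooth_map tau,
        forall x, src (tau x) = mor_obj Phi x &
        forall h, Psi h = gmul (gmul (tau (tgt h)) (Phi h)) (ginv (tau (src h)))].

Section Translations.
Variables (R : realType) (G : lieGroupoid R).

(* r_g at the arrow a (where src a = tgt g): the differential of b |-> bg,
   defined on the source fibre of a. *)
Definition rtrans (g a : arr G) (v : vec (arr G)) : vec (arr G) :=
  let F : fibre (@src R G) (src a) -> arr G := fun b => gmul (sval b) g in
  let a' : fibre (@src R G) (src a) := exist _ a erefl in
  diff_at F a' (tangent_lift (fun b : fibre _ _ => sval b : arr G) a' v).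

(* l_g at the arrow a (where src g = tgt a): the differential of b |-> gb,
   defined on the target fibre of a. *)
Definition ltrans (g a : arr G) (v : vec (arr G)) : vec (arr G) :=
  let F : fibre (@tgt R G) (tgt a) -> arr G := fun b => gmul g (sval b) in
  let a' : fibre (@tgt R G) (tgt a) := exist _ a erefl in
  diff_at F a' (tangent_lift (fun b : fibre _ _ => sval b : arr G) a' v).

(* The division map (g, h) |-> gh^-1 and its differential. *)
Definition mbar (p : fibprod (@src R G) (@src R G)) : arr G :=
  gmul (sval p).1 (ginv (sval p).2).

Definition dmbar (p : fibprod (@src R G) (@src R G)) (v w : vec (arr G)) :
    vec (arr G) :=
  diff_at mbar p (tangent_pair p v w).

End Translations.

(** * The nerve *)

Section Nerve.
Variables (R : realType) (H : lieGroupoid R).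

(* h_1, ..., h_(n+1) are h ord0, ..., h ord_max. *)
Definition composable (n : nat) (h : 'I_n.+1 -> arr H) : Prop :=
  forall m, (m < n)%N -> src (h (inord m)) = tgt (h (inord m.+1)).

Definition string (n : nat) : Type := {h : 'I_n.+1 -> arr H | composable h}.

(* H^(k), with H^(0) the space of objects. *)
Definition nerve (k : nat) : smoothSpace R :=
  match k with
  | 0%N => obj H
  | n.+1 => initial_space
      (\bigcup_(i : 'I_n.+1) pullback (fun h : string n => sval h i))
  end.

(* From (h_1, ..., h_(n+2)): (h_2, ..., h_(n+2)) for i = 0,
   (..., h_i h_(i+1), ...) for 0 < i < n+2, (h_1, ..., h_(n+1)) for i = n+2. *)
Definition face_fun (n i : nat) (h : 'I_n.+2 -> arr H) : 'I_n.+1 -> arr H :=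
  fun j => if j.+1 == i then gmul (h (inord j)) (h (inord j.+1))
           else h (inord (bump i j)).

Lemma face_composable n i (h : 'I_n.+2 -> arr H) :
  composable h -> composable (face_fun i h).
Proof.
move=> ch m mn; rewrite /face_fun !inordK ?ltnS //; last exact: ltnW.
have c0 : src (h (inord m)) = tgt (h (inord m.+1)) by apply: ch; exact: ltnW.
have c1 : src (h (inord m.+1)) = tgt (h (inord m.+2)) by exact: ch.
case: (ltngtP m.+1 i) => [mi|im|<-].
- case: eqP => [<-|ne].
    by rewrite tgt_mul // /bump ltnNge leqnSn add0n.
  by rewrite /bump leqNgt ltnW // add0n leqNgt mi add0n.
- rewrite (_ : (m.+2 == i) = false); last by rewrite gtn_eqF // ltnW.
  by rewrite /bump -(ltnS i m) im leqW.
- by rewrite src_mul // gtn_eqF // /bump leqnn.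
Qed.

Definition face (n i : nat) (h : nerve n.+2) : nerve n.+1 :=
  exist _ (face_fun i (sval h)) (face_composable i (svalP h)).

(* (h_1, ..., h_k) |-> (h_2, ..., h_k), and h_1 |-> src h_1 when k = 1. *)
Definition ntail (k : nat) : nerve k.+1 -> nerve k :=
  match k with
  | 0%N => fun h => src (sval h ord0)
  | n.+1 => fun h => face 0 h
  end.

Lemma src_face01 n (h : nerve n.+2) :
  src (sval (face 1 h) ord0) = src (sval (face 0 h) ord0).
Proof.
by rewrite /= /face_fun /= src_mul //; exact: (svalP h 0%N).
Qed.

End Nerve.

(** * The deformation complex of a morphism *)

Section DeformationComplex.
Variables (R : realType) (H G : lieGroupoid R) (Phi : morphism H G).

(* The arrow at which the value of a cochain is tangent. *)
Definition cbase (k : nat) : nerve H k -> arr G :=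
  match k with
  | 0%N => fun x => ident (mor_obj Phi x)
  | n.+1 => fun h => Phi (sval h ord0)
  end.

(* Families of derivations with pointwise operations; the k-cochains form the
   subspace [cochain k]. *)
Definition precochain (k : nat) : Type := nerve H k -> vec (arr G).

(* For k > 0, ds(c(h_1, ..., h_k)) depends only on (h_2, ..., h_k), and only on
   s(h_1) if k = 1: in the latter case it always lies in T_(phi(s(h_1))). *)
Definition cochain (k : nat) : set (precochain k) :=
  match k with
  | 0%N => [set c | smooth_along (@cbase 0) c /\
      forall x, diff_at src (cbase (k := 0) x) (c x) = 0]
  | n.+1 => [set c | smooth_along (@cbase n.+1) c /\
      exists sc : nerve H n -> vec (obj G), forall h : nerve H n.+1,
        diff_at src (cbase h) (c h) = sc (ntail h)]
  end.

Lemma src_cbase01 n (h : nerve H n.+2) :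
  src (cbase (face 1 h)) = src (cbase (face 0 h)).
Proof. by rewrite /cbase !mor_src src_face01. Qed.

(* (Phi(h_1 h_2), Phi(h_2)) *)
Definition div_point n (h : nerve H n.+2) : fibprod (@src R G) (@src R G) :=
  exist _ (cbase (face 1 h), cbase (face 0 h)) (src_cbase01 h).

Definition delta (k : nat) : precochain k -> precochain k.+1 :=
  match k with
  | 0%N => fun c h1 =>
      let h := sval h1 ord0 in
      rtrans (Phi h) (ident (mor_obj Phi (tgt h))) (c (tgt h)) +
      ltrans (Phi h) (ident (mor_obj Phi (src h)))
        (diff_at ginv (ident (mor_obj Phi (src h))) (c (src h)))
  | n.+1 => fun c h =>
      - dmbar (div_point h) (c (face 1 h)) (c (face 0 h))
      + \sum_(2 <= i < n.+2) (-1) ^+ i *: c (face i h)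
      + (-1) ^+ n.+2 *: c (face n.+2 h)
  end.

Definition cocycle (k : nat) : set (precochain k) :=
  [set c | cochain c /\ delta c = 0].

Definition coboundary (k : nat) : set (precochain k) :=
  match k with
  | 0%N => [set 0]
  | n.+1 => [set delta b | b in @cochain n]
  end.

Definition coh_class (k : nat) (c : precochain k) : set (precochain k) :=
  [set c' | cocycle c' /\ coboundary (c' - c)].

(* H^k_def(Phi): the set of cohomology classes of k-cocycles. *)
Definition Hdef (k : nat) : set (set (precochain k)) :=
  [set coh_class c | c in @cocycle k].

End DeformationComplex.

(* F is a bijection between the cohomology spaces, linear for
   a [c] + [d] = [a c + d]. *)
Definition Hdef_isomorphic (R : realType) (H G : lieGroupoid R)
    (Phi Psi : morphism H G) (k : nat) : Prop :=
  exists F : set (precochain H G k) -> set (precochain H G k),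
    set_bij (@Hdef R H G Phi k) (@Hdef R H G Psi k) F /\
    forall (a : R) (c d c' d' : precochain H G k),
      cocycle Phi c -> cocycle Phi d -> cocycle Psi c' -> cocycle Psi d' ->
      F (coh_class Phi c) = coh_class Psi c' -> F (coh_class Phi d) = coh_class Psi d' ->
      F (coh_class Phi (a *: c + d)) = coh_class Psi (a *: c' + d').

(* Main.v *)
(* Let tau be a natural isomorphism from Phi to Psi.  Since the source map is a
   submersion, a partition of unity on the objects of H gives linear maps
   sigma_x from T_(phi x) M to T_(tau x) G with ds (sigma_x u) = u, smooth in x.
   In the tangent groupoid TG => TM, v |-> sigma(dt v) . v . sigma(ds v)^-1 then
   sends T_(Phi h) G to T_(Psi h) G; being compatible with division, it defines a
   chain map K from C_def(Phi) to C_def(Psi).  A lift sigma' for tau^-1 defines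
   in the same way K' in the other direction.  The product of sigma' and sigma
   is a unit vector plus a vector theta tangent to the source fibres, so
   K'K v = v + r(theta(dt v)) + l(di(theta(ds v))).  For a cocycle c the cocycle
   condition expresses dt c through ds c, and K'K c - c turns out to be, up to
   sign, the coboundary of the right translate of theta(ds c); it is 0 for k = 0.
   Differentials on fibres and fibred products are computed along curves, which
   can be lifted through submersions. *)
Require Import Defs.
From mathcomp Require Import finmap.
From mathcomp Require Import all_boot all_order all_algebra.
From mathcomp Require Import all_classical all_reals all_analysis.
From mathcomp Require Import ring lra.
Set Implicit Arguments.
Unset Strict Implicit.
Unset Printing Implicit Defensive.
Import Order.TTheory GRing.Theory Num.Theory.
Import numFieldNormedType.Exports.
Local Open Scope classical_set_scope.
Local Open Scope ring_scope.

(** * Functions of class C^k on R^n *)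

(** Conjugation by tau alone does not act on cochains. In the tangent groupoid the zero vector at
    [tau x] can be multiplied on the right only by vectors v with dt v = 0, and the differential of
    tau only meets vectors in the image of the differential of the base map, while the values of a
    cochain have unrestricted sources and targets. This forces the auxiliary lift sigma; being a
    choice, it makes the two transports inverse to each other only up to theta.

    Tangent vectors are derivations, and fibred products and fibres carry no charts here. An
    identity between tangent vectors is therefore obtained by differentiating at 0 the corresponding
    identity between arrows. This asks for curves that are composable for all small t and not just
    to first order, which is where the submersion axiom enters. Since derivatives at 0 suffice, a
    lifted curve may be found separately for each t by a contraction, with no implicit function
    theorem and no regularity away from 0. *)

Section CkTheory.
Variables (R : realType) (n : nat).
Implicit Types (U V : set 'rV[R]_n) (f g : 'rV[R]_n -> R).

Lemma Ck_cont k U f x : Ck k U f -> U x -> {for x, continuous f}.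
Proof. by case: k => [|k] [] cf _ Ux; exact: cf. Qed.

Lemma CkW k U f : Ck k.+1 U f -> Ck k U f.
Proof.
elim: k f => [|k IH] f [cf df]; first by split.
by split=> // i; split; [exact: (df i).1 | apply: IH; exact: (df i).2].
Qed.

Lemma Ck_sub k U V f : V `<=` U -> Ck k U f -> Ck k V f.
Proof.
move=> VU; elim: k f => [|k IH] f [cf df]; split => //.
- by move=> x /VU /cf.
- by move=> x /VU /cf.
- move=> i; split; last by apply: IH; exact: (df i).2.
  by move=> x /VU; exact: (df i).1.
Qed.

Lemma Ck_ext k U f g : open U -> {in U, f =1 g} -> Ck k U f -> Ck k U g.
Proof.
move=> oU; have near_fg h h' x : {in U, h =1 h'} -> U x -> {near x, h =1 h'}.
  move=> fg Ux; have := open_nbhs_nbhs (conj oU Ux).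
  by apply: filterS => y Uy; apply: fg; rewrite inE.
have cont_ext h h' x : {in U, h =1 h'} -> U x ->
    {for x, continuous (h : _ -> R)} -> {for x, continuous (h' : _ -> R)}.
  move=> hh' Ux ch; rewrite /prop_for /continuous_at -(hh' x) ?inE//.
  exact: cvg_trans (near_eq_cvg (near_fg _ _ _ _ hh' Ux)) ch.
elim: k f g => [|k IH] f g fg [cf df]; split => //.
- by move=> x Ux; apply: cont_ext fg Ux (cf _ Ux).
- by move=> x Ux; apply: cont_ext fg Ux (cf _ Ux).
- move=> i; split=> [x Ux|].
    by apply: near_eq_derivable ((df i).1 _ Ux); exact: near_fg.
  apply: IH (df i).2 => x; rewrite inE => Ux.
  by apply: near_eq_derive; exact: near_fg.
Qed.

Lemma Ck_eq k U f g : f =1 g -> Ck k U f -> Ck k U g.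
Proof. by move=> /funext ->. Qed.

Lemma Ck_cst k U (a : R) : Ck k U (fun=> a).
Proof.
elim: k a => [|k IH] a; split => //; [by move=> x _; exact: cst_continuous..|].
move=> i; split; first by move=> x _; exact: derivable_cst.
by apply: Ck_eq (IH 0) => x; rewrite derive_cst.
Qed.

Lemma derive_coord (x v : 'rV[R]_n) (j : 'I_n) :
  is_derive x v (fun y : 'rV[R]_n => y ord0 j) (v ord0 j).
Proof.
have H : (fun h : R => h^-1 *: ((h *: v + x) ord0 j - x ord0 j)) @ 0^' --> v ord0 j.
  apply: cvg_near_cst; near=> h.
  rewrite !mxE addrK /GRing.scale /= mulKf//; near: h; exact: nbhs_dnbhs_neq.
apply: DeriveDef; first by apply/cvg_ex; exists (v ord0 j).
exact/cvg_lim.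
Unshelve. all: by end_near. Qed.

Lemma Ck_coord k U (j : 'I_n) : Ck k U (fun y => y ord0 j).
Proof.
case: k => [|k]; split => //; [by move=> x _; exact: coord_continuous..|].
move=> i; split; first by move=> x _; case: (derive_coord x (delta_mx ord0 i) j).
apply: (@Ck_eq _ _ (fun=> (delta_mx ord0 i : 'rV[R]_n) ord0 j)); last exact: Ck_cst.
by move=> x; have [_ <-] := derive_coord x (delta_mx ord0 i) j.
Qed.

Lemma CkD k U f g : open U -> Ck k U f -> Ck k U g -> Ck k U (fun x => f x + g x).
Proof.
move=> oU; elim: k f g => [|k IH] f g [cf df] [cg dg]; split => //.
- by move=> x Ux; apply: continuousD; [exact: cf|exact: cg].
- by move=> x Ux; apply: continuousD; [exact: cf|exact: cg].
- move=> i; split=> [x Ux|].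
    by apply: derivableD; [exact: (df i).1|exact: (dg i).1].
  apply: Ck_ext (IH _ _ (df i).2 (dg i).2) => // x; rewrite inE => Ux.
  by rewrite /= -deriveD; [|exact: (df i).1|exact: (dg i).1].
Qed.

Lemma CkM k U f g : open U -> Ck k U f -> Ck k U g -> Ck k U (fun x => f x * g x).
Proof.
move=> oU; elim: k f g => [|k IH] f g Cf Cg.
  by split => // x Ux; apply: continuousM; [exact: Ck_cont Cf Ux|exact: Ck_cont Cg Ux].
have [cf df] := Cf; have [cg dg] := Cg; split => //.
  by move=> x Ux; apply: continuousM; [exact: cf|exact: cg].
move=> i; split=> [x Ux|].
  by apply: derivableM; [exact: (df i).1|exact: (dg i).1].
apply: (@Ck_ext _ _ (fun x => f x * 'D_(delta_mx ord0 i) g x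
                              + g x * 'D_(delta_mx ord0 i) f x)) => //.
  move=> x; rewrite inE => Ux.
  by rewrite -[LHS]deriveM; [|exact: (df i).1|exact: (dg i).1].
by apply: CkD => //; apply: IH; [exact: CkW|exact: (dg i).2|exact: CkW|exact: (df i).2].
Qed.

Lemma Ck_sum k U (I : Type) (s : seq I) (P : pred I) (F : I -> 'rV[R]_n -> R) :
  open U -> (forall i, P i -> Ck k U (F i)) ->
  Ck k U (fun x => \sum_(i <- s | P i) F i x).
Proof.
move=> oU CF; elim: s => [|i s IH].
  by apply: Ck_eq (Ck_cst _ _ 0) => x; rewrite big_nil.
have [Pi|nPi] := boolP (P i).
  by apply: Ck_eq (CkD oU (CF _ Pi) IH) => x; rewrite big_cons Pi.
by apply: Ck_eq IH => x; rewrite big_cons (negbTE nPi).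
Qed.

Lemma CkV k U f : open U -> (forall x, U x -> f x != 0) ->
  Ck k U f -> Ck k U (fun x => (f x)^-1).
Proof.
move=> oU f0; elim: k => [|k IH] Cf.
  by split => // x Ux; exact: (@cvgV _ _ (nbhs x) _ f _ (f0 _ Ux) (Ck_cont Cf Ux)).
have [cf df] := Cf; split.
  by move=> x Ux; exact: (@cvgV _ _ (nbhs x) _ f _ (f0 _ Ux) (cf _ Ux)).
move=> i; split=> [x Ux|].
  by apply: derivableV; [exact: f0|exact: (df i).1].
apply: (@Ck_ext _ _ (fun x => - 1 * ((f x)^-1 * (f x)^-1 * 'D_(delta_mx ord0 i) f x))) => //.
  move=> x; rewrite inE => Ux.
  rewrite [RHS]deriveV; [|exact: f0|exact: (df i).1].
  by rewrite /GRing.scale /= mulN1r mulNr expr2 invfM.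
apply: CkM => //; first exact: Ck_cst.
apply: CkM => //; last exact: (df i).2.
by apply: CkM => //; apply: IH; exact: CkW.
Qed.

(** Brings directional derivatives within reach of one-variable calculus: the mean value theorem in
    [mean_value_rV], where c is a coordinate increment, and differentiation under the integral sign
    in [segint_derive], where c is the position on the segment. *)
Lemma derive_line f (y v : 'rV[R]_n) (t c : R) :
  derivable f ((t * c) *: v + y) v ->
  is_derive t 1 (fun s : R => f ((s * c) *: v + y)) (c * 'D_v f ((t * c) *: v + y)).
Proof.
move=> df; set z := (t * c) *: v + y.
have H1 : is_derive (t * c) 1 (fun s : R => f (s *: v + y)) ('D_v f z).
  have /derivableP dz := df.
  have eqf h : f (h *: v + z) = f (((h + t * c) *: v) + y).
    by rewrite scalerDl addrA.
  have eqd h : h^-1 *: (f ((h *: 1 + t * c) *: v + y) - f z) =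
               h^-1 *: (f (h *: v + z) - f z).
    by rewrite eqf; congr (_ *: (f (_ *: _ + _) - _)); rewrite /GRing.scale /= mulr1.
  apply: DeriveDef.
    by rewrite /derivable; under eq_fun do rewrite /= eqd; exact: df.
  by rewrite /derive; under eq_fun do rewrite /= eqd.
have H2 : is_derive t 1 (fun s : R => s * c) c.
  have := @is_deriveM _ _ id (cst c) t 1 1 0 _ _.
  by rewrite scaler0 add0r /GRing.scale /= mulr1; apply.
by rewrite mulrC; exact: (@is_derive1_comp _ _ ( *%R^~ c) t _ _ H1 H2).
Qed.

Lemma ball_rV (x y : 'rV[R]_n) (r : R) :
  ball x r y <-> 0 < r /\ forall j, `|x ord0 j - y ord0 j| < r.
Proof.
split; first by case=> r0 H; split=> // j; exact: (H ord0 j).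
by case=> r0 H; split => // i j; rewrite ord1; exact: H.
Qed.

(* The increment of f is split along the n coordinates, with the mean value
   theorem applied to each of them. *)
Lemma mean_value_rV f (x : 'rV[R]_n) (r : R) (a b : 'rV[R]_n) :
  Ck 1 (ball x r) f -> ball x r a -> ball x r b ->
  exists2 xi : 'I_n -> 'rV[R]_n,
    (forall j rho, ball x rho a -> ball x rho b -> ball x rho (xi j)) &
    f a - f b = \sum_j 'D_(delta_mx ord0 j) f (xi j) * (a ord0 j - b ord0 j).
Proof.
move=> Cf bra brb.
(* Hybrid points from [p 0 = b] to [p n = a]; passing from [p j] to [p j.+1] changes the j-th
   coordinate only. *)
pose p k : 'rV[R]_n := \row_j (if (j < k)%N then a ord0 j else b ord0 j).
have step (j : 'I_n) : exists2 z,
    (forall rho, ball x rho a -> ball x rho b -> ball x rho z) & f (p j.+1) - f (p j) =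
    'D_(delta_mx ord0 j) f z * (a ord0 j - b ord0 j).
  set v := delta_mx ord0 j : 'rV[R]_n; set c := a ord0 j - b ord0 j.
  pose q (s : R) := (s * c) *: v + p j.
  have qj s : q s ord0 j = s * a ord0 j + (1 - s) * b ord0 j.
    by rewrite !mxE !eqxx ltnn /c /= mulr1; ring.
  have qi s i : i != j -> q s ord0 i = p j ord0 i.
    by move=> ij; rewrite !mxE eqxx (negbTE ij) mulr0 add0r.
  (* Balls of row vectors are cubes, so the segment from [p j] to [p j.+1] stays in every ball
     around x containing a and b. This later makes the intermediate points converge together with a
     and b. *)
  have bq (s rho : R) : 0 <= s -> s <= 1 -> ball x rho a -> ball x rho b ->
      ball x rho (q s).
    move=> s0 s1 /ball_rV[r0 ba] /ball_rV[_ bb]; apply/ball_rV; split => // i.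
    have [->|ij] := eqVneq i j; last first.
      by rewrite qi // mxE; case: ifP => _; [exact: ba|exact: bb].
    rewrite qj; have := ba j; have := bb j; rewrite !ltr_norml.
    have [->|sn0] := eqVneq s 0; first by rewrite mul0r add0r subr0 mul1r.
    have {sn0 s0}s0 : 0 < s by rewrite lt_neqAle eq_sym sn0.
    move=> /andP[h1 h2] /andP[h3 h4]; apply/andP; split.
      have : 0 < s * (x ord0 j - a ord0 j + rho) by rewrite mulr_gt0 //; lra.
      have : 0 <= (1 - s) * (x ord0 j - b ord0 j + rho) by rewrite mulr_ge0; lra.
      by lra.
    have : 0 < s * (rho - (x ord0 j - a ord0 j)) by rewrite mulr_gt0 //; lra.
    have : 0 <= (1 - s) * (rho - (x ord0 j - b ord0 j)) by rewrite mulr_ge0; lra.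
    by lra.
  have q0 : q 0 = p j by rewrite /q mul0r scale0r add0r.
  have q1 : q 1 = p j.+1.
    apply/rowP => i; have [->|ij] := eqVneq i j.
      by rewrite qj mxE leqnn mul1r subrr mul0r addr0.
    rewrite qi // !mxE ltnS [in RHS]leq_eqVlt.
    by rewrite (_ : _ == _ :> nat = false) //; exact/negbTE.
  have dq (s : R) : 0 <= s -> s <= 1 -> is_derive s (1 : R) (f \o q) (c * 'D_v f (q s)).
    by move=> s0 s1; apply: derive_line; exact: ((Cf.2 j).1 _ (bq _ _ s0 s1 bra brb)).
  have [|s||/= s] := @MVT_segment _ (f \o q) (fun s => c * 'D_v f (q s)) 0 1.
  - exact: ler01.
  - by rewrite in_itv /= => /andP[/ltW s0 /ltW s1]; exact: dq.
  - apply: derivable_within_continuous => s; rewrite in_itv /= => /andP[s0 s1].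
    by case: (dq _ s0 s1).
  rewrite in_itv /= => /andP[s0 s1]; rewrite q0 q1 subr0 mulr1 => E.
  by exists (q s) => [rho|]; [exact: bq|rewrite mulrC -E].
have [xi xiP] := choice (fun j => (exists2P _ _).1 (step j)).
exists xi => [j rho|]; first by have [+ _] := xiP j; apply.
have -> : a = p n by apply/rowP => j; rewrite mxE ltn_ord.
have -> : b = p 0%N by apply/rowP => j; rewrite mxE.
rewrite -(telescope_sumr (fun k => f (p k))) // big_mkord.
apply: eq_bigr => j _; have [_ ->] := xiP j.
by rewrite !mxE ltn_ord.
Qed.
End CkTheory.

(** * The chain rule and composition of functions of class C^k *)

Section ChainRule.
Variables (R : realType).

Lemma cvg_row (T : Type) (F : set_system T) (FF : Filter F) n
    (u : 'I_n -> T -> R) (l : 'I_n -> R) :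
  (forall i, u i @ F --> l i) -> (fun t => \row_i u i t) @ F --> \row_i l i.
Proof.
move=> ul; apply/cvg_ballP => e e0.
have : \forall t \near F, forall i, ball (l i) e (u i t).
  by apply: filter_forall => i; move/cvg_ballP: (ul i); apply.
apply: filterS => t H; apply/ball_rV; split => // j.
by rewrite !mxE; exact: H.
Qed.

Lemma cvg_sumr (T : Type) (F : set_system T) (FF : Filter F) (I : Type)
    (s : seq I) (u : I -> T -> R) (l : I -> R) :
  (forall i, u i @ F --> l i) ->
  (fun t => \sum_(i <- s) u i t) @ F --> \sum_(i <- s) l i.
Proof.
move=> ul; elim: s => [|i s IH].
  by rewrite big_nil; under eq_fun do rewrite big_nil; exact: cvg_cst.
by rewrite big_cons; under eq_fun do rewrite big_cons; exact: cvgD.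
Qed.

Lemma is_derive1P (f : R -> R) (t l : R) :
  is_derive t 1 f l <-> (fun h => h^-1 * (f (h + t) - f t)) @ 0^' --> l.
Proof.
have E : (fun h : R => h^-1 * (f (h + t) - f t)) =
         (fun h : R => h^-1 *: ((f \o shift t) (h *: 1) - f t)).
  by apply/funext => h; rewrite /= [h *: 1]mulr1.
rewrite E; split=> [[dv <-]|H]; first exact: dv.
by apply: DeriveDef; [apply/cvg_ex; exists l|exact/cvg_lim].
Qed.

Lemma is_derive1_cont (f : R -> R) (t l : R) :
  is_derive t 1 f l -> {for t, continuous f}.
Proof. by case=> /derivable1_diffP /differentiable_continuous. Qed.

Lemma derivable_line n (f : 'rV[R]_n -> R) (x v : 'rV[R]_n) l :
  is_derive x v f l <-> is_derive (0 : R) 1 (fun t : R => f (t *: v + x)) l.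
Proof.
rewrite is_derive1P.
have -> : (fun h : R => h^-1 * (f ((h + 0) *: v + x) - f (0 *: v + x))) =
  (fun h : R => h^-1 *: ((f \o shift x) (h *: v) - f x)).
  by apply/funext => h; rewrite scale0r add0r addr0.
split=> [[dv <-]|H]; first exact: dv.
by apply: DeriveDef; [apply/cvg_ex; exists l|exact/cvg_lim].
Qed.

(** The mean value theorem expresses the increment of [f \o g] through partial derivatives of f at
    points tending to [g t], where these derivatives are continuous. Hence g needs to be
    differentiable at t only, which is all that is known of lifted curves. *)
Lemma chain_rule_curve m (U : set 'rV[R]_m) (f : 'rV[R]_m -> R)
    (g : R -> 'rV[R]_m) (t : R) (g' : 'I_m -> R) :
  open U -> Ck 1 U f -> U (g t) ->
  (forall j, is_derive t 1 (fun s : R => g s ord0 j) (g' j)) ->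
  is_derive t 1 (f \o g) (\sum_j 'D_(delta_mx ord0 j) f (g t) * g' j).
Proof.
move=> oU Cf Ugt dg.
have [r /= r0 rU] : exists2 r : R, 0 < r & ball (g t) r `<=` U.
  have := open_nbhs_nbhs (conj oU Ugt); rewrite -nbhs_ballE => -[r /= r0 H].
  by exists r.
have gc : (fun h => g (h + t)) @ (0 : R)^' --> g t.
  have -> : g t = \row_j g t ord0 j by apply/rowP => j; rewrite mxE.
  have -> : (fun h => g (h + t)) = (fun h => \row_j g (h + t) ord0 j).
    by apply/funext => h; apply/rowP => j; rewrite mxE.
  apply: cvg_row => j.
  have gj := is_derive1_cont (dg j).
  have : (fun s => g s ord0 j) \o (fun h : R => h + t) @ (0 : R)^' --> g t ord0 j.
    apply: (@cvg_comp _ _ _ (fun h : R => h + t) (fun s => g s ord0 j) _ (nbhs t)) gj.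
    have -> : nbhs t = nbhs (0 + t) by rewrite add0r.
    by apply: (@cvgD R R^o); [exact: nbhs_dnbhs|exact: cvg_cst].
  by [].
have Cr : Ck 1 (ball (g t) r) f by exact: Ck_sub Cf.
have b0 : ball (g t) r (g t) by exact: ballxx.
have /choice[xi xiP] (h : R) : exists xi : 'I_m -> 'rV[R]_m,
    ball (g t) r (g (h + t)) ->
    (forall j rho, 0 < rho -> ball (g t) rho (g (h + t)) -> ball (g t) rho (xi j)) /\
    f (g (h + t)) - f (g t) =
      \sum_j 'D_(delta_mx ord0 j) f (xi j) * (g (h + t) ord0 j - g t ord0 j).
  have [bh|nbh] := pselect (ball (g t) r (g (h + t))); last by exists (fun=> 0).
  have [xi xi1 xi2] := mean_value_rV Cr bh b0.
  exists xi => _; split=> // j rho rho0 brho.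
  by apply: xi1 => //; exact: ballxx.
have nb (rho : R) : 0 < rho -> \forall h \near (0 : R)^', ball (g t) rho (g (h + t)).
  by move=> rho0; move/cvg_ballP: gc; exact.
apply/is_derive1P.
apply: (@cvg_trans _ ((fun h : R => \sum_j 'D_(delta_mx ord0 j) f (xi h j) *
      (h^-1 * (g (h + t) ord0 j - g t ord0 j))) @ (0 : R)^')).
  apply: near_eq_cvg; apply: filterS (nb _ r0) => h bh.
  rewrite /= (xiP h bh).2 mulr_sumr; apply: eq_bigr => j _.
  by rewrite mulrCA.
apply: cvg_sumr => j; apply: cvgM; last exact/is_derive1P.
have xic : (fun h => xi h j) @ (0 : R)^' --> g t.
  apply/cvg_ballP => rho rho0; near=> h.
  by apply: (xiP h _).1 => //; near: h; exact: nb.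
apply: (@cvg_comp _ _ _ (fun h => xi h j) ('D_(delta_mx ord0 j) f) _ (nbhs (g t))) => //.
exact: ((Cf.2 j).2.1 _ Ugt).
Unshelve. all: by end_near. Qed.

Lemma continuous_row (T : topologicalType) n (u : 'I_n -> T -> R) x :
  (forall i, {for x, continuous (u i)}) ->
  {for x, continuous (fun t => \row_i u i t)}.
Proof. by move=> cu; exact: cvg_row. Qed.

(** Induction on k through the chain rule along coordinate lines: the partial derivatives of f are
    composed with the same functions u and multiplied by the partial derivatives of u. *)
Lemma Ck_comp k n m (U : set 'rV[R]_n) (V : set 'rV[R]_m)
    (f : 'rV[R]_m -> R) (u : 'I_m -> 'rV[R]_n -> R) :
  open U -> open V -> (forall x, U x -> V (\row_i u i x)) ->
  Ck k V f -> (forall i, Ck k U (u i)) ->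
  Ck k U (fun x => f (\row_i u i x)).
Proof.
move=> oU oV UV.
have cont k' g : Ck k' V g -> (forall i, Ck k' U (u i)) ->
    forall x, U x -> {for x, continuous (fun x => g (\row_i u i x))}.
  move=> Cg Cu x Ux.
  apply: (@continuous_comp _ _ _ (fun x => \row_i u i x) g).
    by apply: continuous_row => i; exact: Ck_cont (Cu i) Ux.
  by apply: Ck_cont Cg _; exact: UV.
elim: k f => [|k IH] f Cf Cu; first by split=> //; exact: cont Cf Cu.
split; first exact: cont Cf Cu.
have C1 j g : Ck j.+1 V g -> Ck 1 V g.
  by elim: j => // j IHj /CkW.
have dcomp i x : U x -> is_derive x (delta_mx ord0 i : 'rV[R]_n)
    (fun x => f (\row_i u i x))
    (\sum_j 'D_(delta_mx ord0 j) f (\row_i u i x) * 'D_(delta_mx ord0 i) (u j) x).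
  move=> Ux; apply/derivable_line.
  have := @chain_rule_curve m V f (fun t : R => \row_j u j (t *: delta_mx ord0 i + x)) 0
    (fun j => 'D_(delta_mx ord0 i) (u j) x) oV (C1 _ _ Cf).
  rewrite scale0r add0r; apply; first exact: UV.
  move=> j; under eq_fun do rewrite mxE.
  apply/derivable_line; apply: derivableP; exact: ((Cu j).2 i).1.
move=> i; split=> [x Ux|]; first by case: (dcomp i x Ux).
apply: (@Ck_ext _ _ _ _ (fun x => \sum_j 'D_(delta_mx ord0 j) f (\row_i u i x) *
    'D_(delta_mx ord0 i) (u j) x)) => //.
  by move=> x; rewrite inE => Ux; case: (dcomp i x Ux).
apply: Ck_sum => // j _; apply: CkM => //; last exact: ((Cu j).2 i).2.
exact: (IH _ (Cf.2 j).2 (fun l => CkW (Cu l))).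
Qed.
End ChainRule.

(** * Hadamard's lemma *)

Lemma is_derive_affine (R : realType) (c d t : R) :
  is_derive t 1 (fun s : R => s * c + d) c.
Proof.
apply/is_derive1P; apply: cvg_near_cst; near=> h.
rewrite (_ : _ - _ = h * c); last by ring.
by rewrite mulKf //; near: h; exact: nbhs_dnbhs_neq.
Unshelve. all: by end_near. Qed.

Section Hadamard.
Variables (R : realType) (n : nat).
Variables (U : set 'rV[R]_n) (z0 : 'rV[R]_n) (r : R).
Hypotheses (r0 : 0 < r) (oU : open U) (rU : closed_ball z0 r `<=` U).
Let mu := @lebesgue_measure R.

Let ball_closed z : ball z0 r z -> closed_ball z0 r z.
Proof. exact: subset_closed_ball. Qed.

Let ballU z : ball z0 r z -> U z.
Proof. by move=> /ball_closed /rU. Qed.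

Lemma closed_ball_rV_compact : compact (closed_ball z0 r).
Proof.
apply: bounded_closed_compact; last exact: closed_ball_closed.
rewrite closed_ballE //; exists (`|z0| + r); split; first exact: num_real.
move=> M M1 z /= zr; apply: le_trans (ltW M1).
rewrite -[z in `|z|](subKr z0); apply: le_trans (ler_normB _ _) _.
by rewrite lerD2l.
Qed.

Lemma Ck_bounded k f : Ck k U f ->
  exists2 M : R, 0 <= M & forall z, closed_ball z0 r z -> `|f z| <= M.
Proof.
move=> Cf.
have : compact (f @` closed_ball z0 r).
  apply: continuous_compact closed_ball_rV_compact.
  apply: continuous_in_subspaceT => z; rewrite inE => /rU Uz.
  exact: Ck_cont Cf Uz.
move/compact_bounded => [M [_ HM]].
exists (`|M| + 1); first by rewrite addr_ge0.
move=> z zr; apply: (HM (`|M| + 1)); last by exists z.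
by rewrite (le_lt_trans (ler_norm M)) // ltrDl.
Qed.

Definition seg (z : 'rV[R]_n) (t : R) : 'rV[R]_n := t *: (z - z0) + z0.

Lemma seg_ball z (t : R) : ball z0 r z -> 0 <= t <= 1 -> ball z0 r (seg z t).
Proof.
move=> /ball_rV[_ bz] /andP[t0 t1]; apply/ball_rV; split=> // j.
rewrite !mxE opprD addrCA subrr addr0 normrN normrM ger0_norm // distrC.
by apply: le_lt_trans (bz j); rewrite ler_piMl.
Qed.

Lemma seg_cont z (t : R) : {for t, continuous (seg z)}.
Proof.
apply: cvgD; last exact: cvg_cst.
by apply: (@cvgZl _ _ _ (nbhs t)); exact: cvg_id.
Qed.

Let I01 : set R := `[0, 1]%classic.

Lemma integrable_seg k a f z : Ck k U f -> ball z0 r z ->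
  mu.-integrable I01 (EFin \o (fun t : R => t ^+ a * f (seg z t))).
Proof.
move=> Cf bz; apply: continuous_compact_integrable; first exact: segment_compact.
apply: continuous_in_subspaceT => t; rewrite inE /I01 /= in_itv /= => t01.
apply: (@continuousM _ _ (fun t : R => t ^+ a)); first exact: exprn_continuous.
apply: (@continuous_comp _ _ _ (seg z) f); first exact: seg_cont.
by apply: Ck_cont Cf _; apply: ballU; exact: seg_ball.
Qed.

(** Each partial derivative in z of [f (seg z t)] brings out a factor t. The weight t^a makes the
    family stable under differentiation, so that [segint_Ck] is an induction over all a and f. *)
Definition segint (a : nat) (f : 'rV[R]_n -> R) (z : 'rV[R]_n) : R :=
  \int[mu]_(t in I01) (t ^+ a * f (seg z t)).

Let mI : measurable I01.
Proof. exact: measurable_itv. Qed.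

Let muI : fine (mu I01) = 1.
Proof. by rewrite /mu /I01 lebesgue_measure_itv /= lte_fin ltr01 oppr0 adde0. Qed.

Lemma Rintegral_bound (f : R -> R) (C : R) :
  mu.-integrable I01 (EFin \o f) -> (forall t, 0 <= t <= 1 -> `|f t| <= C) ->
  `|\int[mu]_(t in I01) f t| <= C.
Proof.
move=> fi fC; apply: le_trans (le_normr_Rintegral _ fi) _ => //.
rewrite -[C]mulr1 -muI -(Rintegral_cst mu mI) le_Rintegral //.
- by have := integrable_abse fi; apply: eq_integrable.
- apply: continuous_compact_integrable; first exact: segment_compact.
  by apply: continuous_in_subspaceT => t _; exact: cst_continuous.
Qed.

Lemma Ck_lipschitz f : Ck 1 U f -> exists2 C : R, 0 <= C &
  forall a b, ball z0 r a -> ball z0 r b -> `|f a - f b| <= C * `|a - b|.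
Proof.
move=> Cf; have /choice[M MP] (j : 'I_n) : exists M : R, 0 <= M /\
    forall z, closed_ball z0 r z -> `|'D_(delta_mx ord0 j) f z| <= M.
  by have [M M0 HM] := @Ck_bounded 0 _ (Cf.2 j).2; exists M.
exists (\sum_j M j); first by apply: sumr_ge0 => j _; exact: (MP j).1.
move=> a b ba bb.
have [xi xi1 ->] := mean_value_rV (Ck_sub (fun z bz => ballU bz) Cf) ba bb.
apply: le_trans (ler_norm_sum _ _ _) _; rewrite mulr_suml; apply: ler_sum => j _.
rewrite normrM ler_pM //; first by apply: (MP j).2; apply: ball_closed; exact: xi1.
have -> : a ord0 j - b ord0 j = (a - b) ord0 j by rewrite !mxE.
rewrite [leRHS]/Num.norm /= mx_normrE.
by apply: (le_bigmax _ (fun ij : 'I_1 * 'I_n => `|(a - b) ij.1 ij.2|) (ord0, j)).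
Qed.

Lemma segint_cont a f z : (forall k, Ck k U f) -> ball z0 r z ->
  {for z, continuous (segint a f)}.
Proof.
move=> Cf bz; have [C C0 CP] := Ck_lipschitz (Cf 1%N).
apply/(@cvgrPdist_le _ _ _ (nbhs z) (nbhs_filter z)) => e e0.
have n1 : nbhs z (ball z0 r) by apply: open_nbhs_nbhs; split => //; exact: ball_open.
have d0 : 0 < e / (C + 1) by rewrite divr_gt0 // ltr_wpDl.
have n2 : nbhs z (ball z (e / (C + 1))) := nbhsx_ballx z _ d0.
apply: (filterS _ (filterI n1 n2)) => y [by_]; rewrite mx_norm_ball /ball_ /= => /ltW yz.
rewrite /segint -RintegralB //; try exact: (integrable_seg _ (Cf 0%N)).
apply: Rintegral_bound => [|t t01].
  have := @integrableB _ _ _ mu I01 mI _ _ (integrable_seg a (Cf 0%N) bz)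
    (integrable_seg a (Cf 0%N) by_).
  by apply: eq_integrable.
have /andP[t0 t1] := t01.
rewrite -mulrBr normrM ger0_norm ?exprn_ge0 //.
apply: (@le_trans _ _ (C * `|z - y|)).
  apply: (@le_trans _ _ (`|f (seg z t) - f (seg y t)|)).
    by rewrite ler_piMl // exprn_ile1.
  apply: le_trans (CP _ _ _ _) _; [exact: seg_ball..|].
  rewrite ler_wpM2l // /seg opprD addrACA subrr addr0 -scalerBr normrZ ger0_norm //.
  by rewrite opprB addrA subrK ler_piMl.
apply: le_trans (ler_wpM2l C0 yz) _.
by rewrite mulrCA ler_piMr ?(ltW e0) // ler_pdivrMr ?ltr_wpDl // mul1r lerDl.
Qed.

Lemma segint_derive a f z (i : 'I_n) : (forall k, Ck k U f) -> ball z0 r z ->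
  is_derive z (delta_mx ord0 i : 'rV[R]_n) (segint a f)
    (segint a.+1 (fun x => 'D_(delta_mx ord0 i) f x) z).
Proof.
move=> Cf bz; set v := delta_mx ord0 i : 'rV[R]_n.
have Cdf k : Ck k U ('D_v f) by exact: ((Cf k.+1).2 i).2.
have [d /= d0 dz] : exists2 d : R, 0 < d & forall h : R, -d < h < d -> ball z0 r (h *: v + z).
  have : nbhs z (ball z0 r) by apply: open_nbhs_nbhs; split => //; exact: ball_open.
  rewrite -nbhs_ballE => -[d /= d0 dz]; exists d => // h hd; apply: dz.
  apply/ball_rV; split => // j; rewrite !mxE opprD addrCA subrr addr0 normrN.
  rewrite normrM eqxx /=; apply: (@le_lt_trans _ _ `|h|); last by rewrite ltr_norml.
  by rewrite ler_piMr //; case: eqP => _; rewrite ?normr1 ?normr0.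
pose F (h t : R) := t ^+ a * f (seg (h *: v + z) t).
have segE (h t : R) : seg (h *: v + z) t = (h * t) *: v + seg z t.
  by rewrite /seg -addrA scalerDr scalerA [t * h]mulrC addrA.
have dF h t : -d < h < d -> 0 <= t <= 1 ->
    is_derive h 1 (F ^~ t) (t ^+ a.+1 * 'D_v f (seg (h *: v + z) t)).
  move=> hd t01; rewrite /F exprSr -mulrA.
  have bs : ball z0 r (seg (h *: v + z) t) by apply: seg_ball => //; exact: dz.
  have dd := @derive_line _ _ f (seg z t) v h t _.
  rewrite -segE in dd; have {}dd := dd (((Cf 1%N).2 i).1 _ (ballU bs)).
  under eq_fun do rewrite segE.
  exact: (@is_deriveZ _ _ _ _ (t ^+ a)).
(* The dominating function is the constant M: the weight t^(a+1) is at most 1 on [0, 1], and the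
   segments stay in the compact closed ball. *)
have [M M0 MP] := Ck_bounded (Cdf 0%N).
have I0 : `]-d, d[%classic (0 : R) by rewrite /= in_itv /= oppr_lt0 d0.
have intF x : `]-d, d[%classic x -> mu.-integrable I01 (EFin \o F x).
  by rewrite /= in_itv /= => xd; apply: (integrable_seg _ (Cf 0%N)); exact: dz.
have derF x y : `]-d, d[%classic x -> I01 y -> derivable (F ^~ y) x 1.
  by rewrite /I01 /= !in_itv /= => xd y01; case: (dF _ _ xd y01).
have intM : mu.-integrable I01 (EFin \o (fun=> M)).
  apply: continuous_compact_integrable; first exact: segment_compact.
  by apply: continuous_in_subspaceT => t _; exact: cst_continuous.
have bF x y : `]-d, d[%classic x -> I01 y -> `|partial1of2 F x y| <= M.
  rewrite /I01 /= !in_itv /= => xd y01; rewrite partial1of2E.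
  have [_ ->] := dF _ _ xd y01; have /andP[y0 y1] := y01.
  rewrite normrM ger0_norm ?exprn_ge0 //; apply: le_trans (_ : _ <= `|'D_v f (seg (x *: v + z) y)|) _.
    by rewrite ler_piMl // exprn_ile1.
  by apply: MP; apply: ball_closed; apply: seg_ball => //; exact: dz.
have dI := @derivable_under_integral R _ _ mu F I01 mI 0 (-d) d I0 intF derF
  (fun=> M) (fun=> M0) intM bF.
have eI := @differentiation_under_integral R _ _ mu F I01 mI 0 (-d) d I0 intF derF
  (fun=> M) (fun=> M0) intM bF.
apply/derivable_line; apply: DeriveDef => //.
rewrite -derive1E [LHS]eI; apply: eq_Rintegral => t; rewrite inE /I01 /= in_itv /= => t01.
rewrite partial1of2E.
have hd : - d < 0 < d by rewrite oppr_lt0 d0.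
by have [_ ->] := dF _ _ hd t01; rewrite scale0r add0r.
Qed.

Lemma segint_Ck k a f : (forall k, Ck k U f) -> Ck k (ball z0 r) (segint a f).
Proof.
elim: k a f => [|k IH] a f Cf; first by split => // z bz; exact: segint_cont.
split=> [z bz|i]; first exact: segint_cont.
split=> [z bz|]; first by case: (segint_derive a i Cf bz).
apply: (@Ck_ext _ _ _ _ (segint a.+1 (fun x => 'D_(delta_mx ord0 i) f x))).
- exact: ball_open.
- by move=> z; rewrite inE => bz; case: (segint_derive a i Cf bz).
- by apply: IH => l; exact: ((Cf l.+1).2 i).2.
Qed.

Lemma segint_center f : segint 0 f z0 = f z0.
Proof.
rewrite /segint (@eq_Rintegral _ _ _ _ _ (fun=> f z0)).
  by rewrite Rintegral_cst // muI mulr1.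
by move=> t _; rewrite expr0 mul1r /seg subrr scaler0 add0r.
Qed.

(** The fundamental theorem of calculus for [f \o seg z], whose derivative is the sum of the partial
    derivatives of f weighted by the coordinates of z - z0. *)
Lemma segint_formula f z : (forall k, Ck k U f) -> ball z0 r z ->
  f z - f z0 = \sum_(i < n) (z ord0 i - z0 ord0 i) *
    segint 0 (fun x => 'D_(delta_mx ord0 i) f x) z.
Proof.
move=> Cf bz.
pose D i x := 'D_(delta_mx ord0 i : 'rV[R]_n) f x.
have CD i k : Ck k U (D i) by exact: ((Cf k.+1).2 i).2.
pose c i := z ord0 i - z0 ord0 i.
have intD i : mu.-integrable I01 (EFin \o (fun t : R => t ^+ 0 * D i (seg z t))).
  exact: (integrable_seg 0 (CD i 0%N) bz).
have sumI (s : seq 'I_n) :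
    mu.-integrable I01 (EFin \o (fun t => \sum_(i <- s) c i * (t ^+ 0 * D i (seg z t)))) /\
    \int[mu]_(t in I01) (\sum_(i <- s) c i * (t ^+ 0 * D i (seg z t))) =
    \sum_(i <- s) c i * segint 0 (D i) z.
  elim: s => [|i s [IH1 IH2]].
    rewrite big_nil; under eq_fun do rewrite big_nil.
    split; last by rewrite Rintegral_cst // mul0r.
    apply: continuous_compact_integrable; first exact: segment_compact.
    by apply: continuous_in_subspaceT => t _; exact: cst_continuous.
  have i1 : mu.-integrable I01 (EFin \o (fun t => c i * (t ^+ 0 * D i (seg z t)))).
    have := @integrableZl _ _ _ mu I01 mI (c i) _ (intD i).
    by apply: eq_integrable.
  split.
    have := @integrableD _ _ _ mu I01 mI _ _ i1 IH1.
    by apply: eq_integrable => // t _; rewrite /= big_cons.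
  rewrite big_cons -IH2 /segint -RintegralZl //.
  rewrite -RintegralD //.
  by apply: eq_Rintegral => t _; rewrite big_cons.
have [int1 <-] := sumI (index_enum 'I_n).
have dseg (t : R) : 0 <= t <= 1 ->
    is_derive t 1 (f \o seg z) (\sum_i D i (seg z t) * c i).
  move=> t01; apply: (chain_rule_curve oU (Cf 1%N)).
    by apply: ballU; exact: seg_ball.
  move=> j; have -> : (fun s : R => seg z s ord0 j) = (fun s : R => s * c j + z0 ord0 j).
    by apply/funext => s; rewrite /seg /c !mxE.
  exact: is_derive_affine.
have contseg (t : R) : 0 <= t <= 1 -> {for t, continuous (f \o seg z)}.
  by move=> t01; exact: is_derive1_cont (dseg t t01).
have FE : f z - f z0 = (f \o seg z) 1 - (f \o seg z) 0.
  by rewrite /= /seg scale1r subrK scale0r add0r.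
rewrite FE /Rintegral.
have -> : (f \o seg z) 1 - (f \o seg z) 0 =
    fine (((f \o seg z) 1)%:E - ((f \o seg z) 0)%:E)%E by [].
rewrite -(@continuous_FTC2 _ (fun t => \sum_i c i * (t ^+ 0 * D i (seg z t)))) //.
- apply: continuous_in_subspaceT => t; rewrite inE /= in_itv /= => t01.
  apply: (@cvg_sumr _ _ (nbhs t)) => i; apply: cvgM; first exact: cvg_cst.
  apply: cvgM; first by apply: exprn_continuous.
  apply: (@continuous_comp _ _ _ (seg z) (D i)); first exact: seg_cont.
  by apply: Ck_cont (CD i 0%N) _; apply: ballU; exact: seg_ball.
- split.
  + move=> t; rewrite in_itv /= => /andP[t0 t1].
    by have [|] := dseg t; rewrite ?(ltW t0) ?(ltW t1).
  + apply: cvg_at_right_filter; apply: contseg; by rewrite lexx ler01.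
  + apply: cvg_at_left_filter; apply: contseg; by rewrite lexx ler01.
- move=> t; rewrite in_itv /= => /andP[t0 t1]; rewrite derive1E.
  have [|_ ->] := dseg t; first by rewrite (ltW t0) (ltW t1).
  by apply: eq_bigr => i _; rewrite expr0 mul1r mulrC.
Qed.
End Hadamard.

(** Opens up derivations, which are given only by linearity and the Leibniz rule: they kill the
    constant [f z0], and of each product they retain only [g i z0]. The g i must be smooth, because
    a tangent vector obeys these rules on smooth germs only. *)
Lemma hadamard (R : realType) n (z0 : 'rV[R]_n) f : smooth_near z0 f ->
  exists g : 'I_n -> 'rV[R]_n -> R,
    [/\ forall i, smooth_near z0 (g i),
        forall i, g i z0 = 'D_(delta_mx ord0 i) f z0 &
        \forall z \near z0, f z = f z0 + \sum_i (z ord0 i - z0 ord0 i) * g i z].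
Proof.
move=> [U [oU Uz Cf]].
have [r /= r0 rU] : exists2 r : R, 0 < r & closed_ball z0 r `<=` U.
  have := open_nbhs_nbhs (conj oU Uz); rewrite -nbhs_ballE => -[r /= r0 rU].
  exists (r / 2); first by rewrite divr_gt0.
  apply: subset_trans rU; apply: closed_ball_subset; first by rewrite divr_gt0.
  by rewrite ltr_pdivrMr // ltr_pMr // ltr1n.
exists (fun i => segint z0 0 (fun x => 'D_(delta_mx ord0 i) f x)); split.
- move=> i; exists (ball z0 r); split; [exact: ball_open|exact: ballxx|].
  by move=> k; apply: (segint_Ck r0 rU) => l; exact: ((Cf l.+1).2 i).2.
- by move=> i; rewrite segint_center.
- have nb : nbhs z0 (ball z0 r) by apply: open_nbhs_nbhs; split; [exact: ball_open|exact: ballxx].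
  by apply: (filterS _ nb) => z bz; rewrite -(segint_formula r0 oU rU Cf bz) addrC subrK.
Qed.

(** * Smooth spaces *)

Section Near.
Variable T : topologicalType.
Implicit Types (x : T) (P Q : set T).

Lemma near_forall x (I : finType) (P : I -> set T) :
  (forall i, nbhs x (P i)) -> nbhs x [set y | forall i, P i y].
Proof. exact: (@filter_forall T I P (nbhs x) (nbhs_filter x)). Qed.

Lemma near_impl x P Q : (forall y, P y -> Q y) -> nbhs x P -> nbhs x Q.
Proof. exact: (@filterS T (nbhs x) (nbhs_filter x)). Qed.

Lemma near_and x P Q : nbhs x P -> nbhs x Q -> nbhs x [set y | P y /\ Q y].
Proof. exact: (@filterI T (nbhs x) (nbhs_filter x)). Qed.

Lemma near_all x P : (forall y, P y) -> nbhs x P.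
Proof. by move=> H; apply: (@filterE T (nbhs x) (nbhs_filter x)). Qed.

Lemma near_comp (S : topologicalType) (h : S -> T) (x : S) P :
  {for x, continuous h} -> nbhs (h x) P -> nbhs x [set y | P (h y)].
Proof. by move=> ch; exact: ch. Qed.

Lemma cont_ext (S : topologicalType) (h h' : S -> T) (x : S) :
  (\forall y \near x, h y = h' y) -> {for x, continuous h} -> {for x, continuous h'}.
Proof.
move=> hh ch A; rewrite -(nbhs_singleton hh) => /(near_comp ch) nA.
by apply: (@filterS S (nbhs x) _ _ _ _ (@filterI S (nbhs x) _ _ _ hh nA)) => y [/= <-].
Qed.
End Near.

Section SmoothNear.
Variables (R : realType) (n : nat).
Implicit Types (x : 'rV[R]_n) (f g : 'rV[R]_n -> R).

Lemma smooth_near_germ x f g : (\forall y \near x, f y = g y) ->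
  smooth_near x f -> smooth_near x g.
Proof.
move=> fg [U [oU Ux Cf]]; pose W := U `&` [set y | f y = g y]°.
have oW : open W by apply: openI => //; exact: open_interior.
exists W; split => // k; apply: (@Ck_ext _ _ _ W f) => //.
  by move=> y; rewrite inE => -[_ /interior_subset].
by apply: Ck_sub (Cf k) => y [].
Qed.

Lemma smooth_near_open x f : smooth_near x f -> \forall y \near x, smooth_near y f.
Proof.
move=> [U [oU Ux Cf]]; apply: filterS (open_nbhs_nbhs (conj oU Ux)) => y Uy.
by exists U.
Qed.

Lemma smooth_near_cont x f : smooth_near x f -> {for x, continuous f}.
Proof. by move=> [U [oU Ux Cf]]; exact: Ck_cont (Cf 0%N) Ux. Qed.

Lemma smooth_near_common x m (u : 'I_m -> 'rV[R]_n -> R) :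
  (forall i, smooth_near x (u i)) ->
  exists U, [/\ open U, U x & forall i k, Ck k U (u i)].
Proof.
move=> /choice[V VP]; exists [set y | forall i, V i y]°; split.
- exact: open_interior.
- apply: (@filter_forall _ _ V (nbhs x) (nbhs_filter x)) => i.
  by have [oV Vx _] := VP i; exact: (open_nbhs_nbhs (conj oV Vx)).
- move=> i k; have [_ _ C] := VP i; apply: Ck_sub (C k) => y.
  by move=> /interior_subset; apply.
Qed.

Lemma smooth_near_comp x m (u : 'I_m -> 'rV[R]_n -> R) (f : 'rV[R]_m -> R) :
  (forall i, smooth_near x (u i)) -> smooth_near (\row_i u i x) f ->
  smooth_near x (fun y => f (\row_i u i y)).
Proof.
move=> /smooth_near_common[U [oU Ux Cu]] [V [oV Vx Cf]].
pose W := U `&` [set y | V (\row_i u i y)]°.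
have oW : open W by apply: openI => //; exact: open_interior.
exists W; split => //.
- split=> //=; have : {for x, continuous (fun y => \row_i u i y)}.
    by apply: continuous_row => i; exact: Ck_cont (Cu i 0%N) Ux.
  by apply; apply: open_nbhs_nbhs.
- move=> k; apply: (Ck_comp oW oV _ (Cf k)).
    by move=> y [_ /interior_subset].
  by move=> i; apply: Ck_sub (Cu i k) => y [].
Qed.

Lemma smooth_near_derive x f (i : 'I_n) : smooth_near x f ->
  smooth_near x (fun y => 'D_(delta_mx ord0 i) f y).
Proof.
by move=> [U [oU Ux Cf]]; exists U; split => // k; exact: ((Cf k.+1).2 i).2.
Qed.

Lemma smooth_near_coord x (i : 'I_n) : smooth_near x (fun y => y ord0 i).
Proof. by exists setT; split => //; [exact: openT | move=> k; exact: Ck_coord]. Qed.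

Lemma smooth_near_cst x (a : R) : smooth_near x (fun=> a).
Proof. by exists setT; split => //; [exact: openT | move=> k; exact: Ck_cst]. Qed.

Lemma smooth_near_inv x f : smooth_near x f -> f x != 0 ->
  smooth_near x (fun y => (f y)^-1).
Proof.
move=> [U [oU Ux Cf]] fx0.
pose W := U `&` [set y | f y != 0]°.
have oW : open W by apply: openI => //; exact: open_interior.
exists W; split => //.
- split=> //=.
  have n0 : nbhs (f x) [set r : R | r != 0].
    by apply: open_nbhs_nbhs; split => //; exact: open_neq.
  exact: (Ck_cont (Cf 0%N) Ux) _ n0.
- move=> k; apply: CkV => //; last by apply: Ck_sub (Cf k) => y [].
  by move=> y [Uy /interior_subset].
Qed.
End SmoothNear.

(* The smooth functions are stable under C^oo operations and depend only on
   germs; this holds for manifolds and for initial structures. *)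
Record cinfty (R : realType) (X : smoothSpace R) : Prop := Cinfty {
  cinfty_germ : forall (x : X) f g, (\forall y \near x, f y = g y) ->
    smooth_at x f -> smooth_at x g;
  cinfty_open : forall (x : X) f, smooth_at x f -> \forall y \near x, smooth_at y f;
  cinfty_cont : forall (x : X) f, smooth_at x f -> {for x, continuous f};
  cinfty_comp : forall (x : X) m (u : 'I_m -> X -> R) f,
    (forall i, smooth_at x (u i)) -> smooth_near (\row_i u i x) f ->
    smooth_at x (fun y => f (\row_i u i y))
}.

Section CinftyAlgebra.
Variables (R : realType) (X : smoothSpace R) (cX : cinfty X).
Implicit Types (x : X) (f g : X -> R).

Lemma smooth_ext x f g : f =1 g -> smooth_at x f -> smooth_at x g.
Proof. by move=> /funext ->. Qed.

Lemma smooth_cst x (a : R) : smooth_at x (fun=> a).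
Proof.
by apply: (@cinfty_comp _ _ cX x 0 (fun _ _ => 0) (fun=> a)) => [[]//|];
  exact: smooth_near_cst.
Qed.

Let pair_row f g : 'I_2 -> X -> R := fun i => if i == ord0 then f else g.

Lemma smooth_binop (h : R -> R -> R) x f g : smooth_at x f -> smooth_at x g ->
  smooth_near (\row_i pair_row f g i x) (fun z : 'rV[R]_2 => h (z ord0 ord0) (z ord0 ord_max)) ->
  smooth_at x (fun y => h (f y) (g y)).
Proof.
move=> sf sg sh; have H := @cinfty_comp _ _ cX x 2 (pair_row f g) _ _ sh.
apply: smooth_ext (H _) => [y|i]; first by rewrite !mxE.
by rewrite /pair_row; case: ifP.
Qed.

Lemma smoothD x f g : smooth_at x f -> smooth_at x g ->
  smooth_at x (fun y => f y + g y).
Proof.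
move=> sf sg; apply: smooth_binop => //; exists setT; split => //; first exact: openT.
by move=> k; apply: CkD; [exact: openT|exact: Ck_coord..].
Qed.

Lemma smoothM x f g : smooth_at x f -> smooth_at x g ->
  smooth_at x (fun y => f y * g y).
Proof.
move=> sf sg; apply: smooth_binop => //; exists setT; split => //; first exact: openT.
by move=> k; apply: CkM; [exact: openT|exact: Ck_coord..].
Qed.

Lemma smoothV x f : smooth_at x f -> f x != 0 -> smooth_at x (fun y => (f y)^-1).
Proof.
move=> sf fx0.
have H := @cinfty_comp _ _ cX x 1 (fun=> f) (fun z => (z ord0 ord0)^-1) (fun=> sf).
apply: smooth_ext (H _) => [y|]; first by rewrite mxE.
by apply: smooth_near_inv; [exact: smooth_near_coord|rewrite mxE].
Qed.

Lemma smooth_sum x (I : Type) (s : seq I) (P : pred I) (F : I -> X -> R) :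
  (forall i, P i -> smooth_at x (F i)) ->
  smooth_at x (fun y => \sum_(i <- s | P i) F i y).
Proof.
move=> sF; elim: s => [|i s IH].
  by apply: smooth_ext (smooth_cst x 0) => y; rewrite big_nil.
have [Pi|nPi] := boolP (P i).
  by apply: smooth_ext (smoothD (sF _ Pi) IH) => y; rewrite big_cons Pi.
by apply: smooth_ext IH => y; rewrite big_cons (negbTE nPi).
Qed.

Lemma smooth_prod x (I : Type) (s : seq I) (P : pred I) (F : I -> X -> R) :
  (forall i, P i -> smooth_at x (F i)) ->
  smooth_at x (fun y => \prod_(i <- s | P i) F i y).
Proof.
move=> sF; elim: s => [|i s IH].
  by apply: smooth_ext (smooth_cst x 1) => y; rewrite big_nil.
have [Pi|nPi] := boolP (P i).
  by apply: smooth_ext (smoothM (sF _ Pi) IH) => y; rewrite big_cons Pi.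
by apply: smooth_ext IH => y; rewrite big_cons (negbTE nPi).
Qed.
End CinftyAlgebra.

(** * Initial smooth structures *)

Section InitialSpace.
Variables (R : realType) (T : Type) (F : set (set T * (T -> R))).
Local Notation TF := (initial_space F).

Lemma cvg_initial (G : set_system T) (t : T) : Filter G ->
  (forall A, subbase F A -> A t -> G A) -> G --> (t : TF).
Proof.
move=> FG GA A; rewrite /= (@nbhsE TF).
move=> [_ [[B sB <-] [C BC Ct] sUBA]].
rewrite nbhs_filterE; apply: filterS sUBA _; apply: (@filterS _ _ _ C).
  by move=> ? ?; exists C.
have /sB [D sD IDeC] := BC; rewrite -IDeC; apply: filter_bigI => E DE.
by have /sD := DE; rewrite inE => sE; apply: GA => //; move: Ct; rewrite -IDeC => /(_ _ DE).
Qed.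

Lemma open_subbase A : subbase F A -> open (A : set TF).
Proof.
move=> sA; exists [set A]; last first.
  by rewrite predeqE => ?; split=> [[_ ->]|] //; exists A.
move=> _ ->; exists [fset A]%fset; first by move=> ?; rewrite inE inE => /eqP->.
by rewrite predeqE=> ?; split=> [|??]; [apply|]; rewrite /= inE // =>/eqP->.
Qed.

Lemma initial_nbhs p (x : TF) : F p -> p.1 x -> \forall y \near x, p.1 y.
Proof.
move=> Fp px; apply: open_nbhs_nbhs; split => //; apply: open_subbase.
exists p; split=> //; exists setT; first exact: openT.
by rewrite preimage_setT setIT.
Qed.

Lemma initial_cont p (x : TF) : F p -> p.1 x -> {for x, continuous (p.2 : TF -> R)}.
Proof.
move=> Fp px A; rewrite nbhsE => -[B [oB Bx] BA].
have : nbhs x (p.1 `&` p.2 @^-1` B).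
  apply: open_nbhs_nbhs; split => //.
  by apply: open_subbase; exists p; split => //; exists B.
by apply: filterS => y [_ /BA].
Qed.

Lemma initial_smooth_gen p (x : TF) : F p -> p.1 x -> smooth_at x (p.2 : TF -> R).
Proof.
move=> Fp px; exists 1%N, (fun=> p), (fun z => z ord0 ord0); split => //.
- exact: smooth_near_coord.
- by near=> y; rewrite mxE.
Unshelve. all: by end_near. Qed.

(** Universal property of the initial structure. As a generator lives on [p.1] only, G is also
    required to stay in [p.1] near x; together with the continuity of the pulled back generators
    this is continuity of G on the subbase. *)
Lemma smooth_initial (X : smoothSpace R) (G : X -> TF) : cinfty X ->
  (forall p x, F p -> p.1 (G x) ->
    (\forall y \near x, p.1 (G y)) /\ smooth_at x (p.2 \o G)) ->
  smooth_map G.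
Proof.
move=> cX HG.
have cG : continuous G.
  move=> x; apply: cvg_initial => _ [p [Fp [B oB ->]]] [px Bx].
  have [np sp] := HG _ _ Fp px.
  have nB : nbhs x ((p.2 \o G) @^-1` B).
    by apply: (cinfty_cont cX sp); exact: open_nbhs_nbhs.
  by apply: (filterS _ (filterI np nB)) => y [].
split=> // x f [m [p [Phi [Fp sPhi fE]]]].
apply: (@cinfty_germ _ _ cX _ (fun y => Phi (\row_i (p i).2 (G y)))).
  by apply: near_impl (near_comp (cG x) fE) => y /= ->.
by apply: (cinfty_comp cX) => // i; have [Fi pi] := Fp i; exact: (HG _ _ Fi pi).2.
Qed.

Lemma initial_cinfty : cinfty TF.
Proof.
split.
- move=> x f g fg [m [p [Phi [Fp sPhi fE]]]]; exists m, p, Phi; split=> //.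
  by apply: near_impl (near_and fg fE) => y [<-].
- move=> x f [m [p [Phi [Fp sPhi fE]]]].
  have cp : {for x, continuous (fun y : TF => \row_i (p i).2 y)}.
    by apply: continuous_row => i; have [Fi pi] := Fp i; exact: initial_cont.
  have n1 : \forall y \near x, forall i, (p i).1 y.
    by apply: near_forall => i; have [Fi pi] := Fp i; exact: initial_nbhs.
  have n2 := near_comp cp (smooth_near_open sPhi).
  have n3 : \forall y \near x, \forall z \near y, f z = Phi (\row_i (p i).2 z).
    exact: nbhs_interior fE.
  apply: near_impl (near_and n1 (near_and n2 n3)) => y [h1 [h2 h3]].
  by exists m, p, Phi; split=> // i; split => //; case: (Fp i).
- move=> x f [m [p [Phi [Fp sPhi fE]]]].
  have cp : {for x, continuous (fun y : TF => \row_i (p i).2 y)}.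
    by apply: continuous_row => i; have [Fi pi] := Fp i; exact: initial_cont.
  have c2 := @continuous_comp _ _ _ (fun y : TF => \row_i (p i).2 y) Phi x cp
     (smooth_near_cont sPhi).
  by apply: cont_ext c2; apply: near_impl fE => y ->.
- move=> x m u f su sf.
  have /choice[w wP] i : exists w : {M : nat & (('I_M -> set T * (T -> R)) * ('rV[R]_M -> R))%type},
      [/\ forall j, F ((tagged w).1 j) /\ ((tagged w).1 j).1 x,
          smooth_near (\row_j ((tagged w).1 j).2 x) (tagged w).2 &
          \forall y \near x, u i y = (tagged w).2 (\row_j ((tagged w).1 j).2 y)].
    by have [M [p [Phi P]]] := su i; exists (existT _ M (p, Phi)).
  pose M i := tag (w i); pose p i : 'I_(M i) -> _ := (tagged (w i)).1.
  pose Phi i : 'rV[R]_(M i) -> R := (tagged (w i)).2.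
  have uP i : [/\ forall j, F (p i j) /\ (p i j).1 x,
      smooth_near (\row_j (p i j).2 x) (Phi i) &
      \forall y \near x, u i y = Phi i (\row_j (p i j).2 y)] := wP i.
  (* Each u i has its own finite family of generators. J is the disjoint union of these families, q
     lists it, and [sel z i] extracts from a vector indexed by J the entries that belong to u i. *)
  pose J : finType := {i : 'I_m & 'I_(M i)}.
  pose k := #|J|.
  pose q (j : 'I_k) := p (tag (enum_val j)) (tagged (enum_val j)).
  pose sel (z : 'rV[R]_k) i := \row_(j < M i) z ord0 (enum_rank (Tagged (fun i => 'I_(M i)) j)).
  have selE y i : sel (\row_j (q j).2 y) i = \row_j (p i j).2 y.
    by apply/rowP => j; rewrite !mxE /q enum_rankK.
  exists k, q, (fun z => f (\row_i Phi i (sel z i))); split.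
  + by move=> j; case: (uP (tag (enum_val j))) => + _ _; apply.
  + apply: (@smooth_near_comp _ _ _ _ (fun i z => Phi i (sel z i))).
      move=> i; apply: (@smooth_near_comp _ _ _ _ (fun j z =>
        z ord0 (enum_rank (Tagged (fun i => 'I_(M i)) j)))).
        by move=> j; exact: smooth_near_coord.
      by rewrite -/(sel _ i) selE; case: (uP i).
    have -> : \row_i Phi i (sel (\row_i0 (q i0).2 x) i) = \row_i u i x.
      apply/rowP => i; rewrite !mxE selE.
      by have [_ _ /nbhs_singleton ->] := uP i.
    exact: sf.
  + have nu : \forall y \near x, forall i, u i y = Phi i (\row_j (p i j).2 y).
      by apply: near_forall => i; case: (uP i).
    apply: near_impl nu => y uy; congr f; apply/rowP => i.
    by rewrite !mxE selE uy.
Qed.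
End InitialSpace.

(** * Charts, tangent vectors and curves *)

Section Charts.
Variables (R : realType) (X : smoothSpace R) (n : nat).

(** The clauses of [locally_euclidean] that do not mention the centre, so that one chart serves all
    points of U. *)
Definition chart (U : set X) (phi : X -> 'rV[R]_n) (psi : 'rV[R]_n -> X) : Prop :=
  [/\ open U, open (phi @` U), forall y, U y -> psi (phi y) = y,
      (forall y, U y -> {for y, continuous phi}) /\
      (forall z, (phi @` U) z -> {for z, continuous psi}) &
      forall y (f : X -> R), U y ->
        (smooth_at y f <-> smooth_near (phi y) (f \o psi))].

Section OneChart.
Variables (U : set X) (phi : X -> 'rV[R]_n) (psi : 'rV[R]_n -> X).
Hypothesis cU : chart U phi psi.

Lemma chart_near y : U y -> nbhs y U.
Proof. by case: cU => oU _ _ _ _ Uy; exact: (open_nbhs_nbhs (conj oU Uy)). Qed.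

Lemma chart_near_inv y : U y -> nbhs (phi y) [set z | U (psi z) /\ phi (psi z) = z].
Proof.
case: cU => _ oV psiK _ _ Uy.
have V : (phi @` U) (phi y) by exists y.
apply: near_impl (open_nbhs_nbhs (conj oV V)) => z [y' Uy' <-].
by rewrite /= psiK.
Qed.

Lemma chart_psi_cont y : U y -> {for phi y, continuous psi}.
Proof. by case: cU => _ _ _ [_ cpsi] _ Uy; apply: cpsi; exists y. Qed.

Lemma chart_phi_cont y : U y -> {for y, continuous phi}.
Proof. by case: cU => _ _ _ [cphi _] _; exact: cphi. Qed.

Lemma chartK y : U y -> psi (phi y) = y.
Proof. by case: cU => _ _ + _ _; exact. Qed.

Lemma chart_smooth y f : U y -> (smooth_at y f <-> smooth_near (phi y) (f \o psi)).
Proof. by case: cU => _ _ _ _; exact. Qed.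

Lemma chart_coord_smooth y j : U y -> smooth_at y (fun y => phi y ord0 j).
Proof.
move=> Uy; apply/chart_smooth => //.
apply: (@smooth_near_germ _ _ _ (fun z => z ord0 j)); last exact: smooth_near_coord.
by apply: near_impl (chart_near_inv Uy) => z /= [_ ->].
Qed.
End OneChart.
End Charts.

Lemma manifold_chart (R : realType) (X : smoothSpace R) : manifold X ->
  exists n, forall x : X, exists U phi psi, @chart R X n U phi psi /\ U x.
Proof.
move=> [_ [n H]]; exists n => x.
have [U [phi [psi [[oU Ux] oV psiK c s]]]] := H x.
by exists U, phi, psi; split.
Qed.

Lemma manifold_cinfty (R : realType) (X : smoothSpace R) : manifold X -> cinfty X.
Proof.
move=> /manifold_chart[n H]; split.
- move=> x f g fg; have [U [phi [psi [cU Ux]]]] := H x.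
  move/(chart_smooth cU _ Ux) => sf; apply/(chart_smooth cU _ Ux).
  apply: smooth_near_germ sf.
  have := near_comp (chart_psi_cont cU Ux); rewrite (chartK cU Ux) => n1.
  by apply: near_impl (n1 _ fg) => y.
- move=> x f; have [U [phi [psi [cU Ux]]]] := H x.
  move/(chart_smooth cU _ Ux) => sf.
  have n1 := near_comp (chart_phi_cont cU Ux) (smooth_near_open sf).
  apply: near_impl (near_and (chart_near cU Ux) n1) => y [Uy sy].
  exact/(chart_smooth cU _ Uy).
- move=> x f; have [U [phi [psi [cU Ux]]]] := H x.
  move/(chart_smooth cU _ Ux) => /smooth_near_cont sf.
  apply: (@cont_ext _ _ ((f \o psi) \o phi)); last first.
    by apply: continuous_comp sf; exact: (chart_phi_cont cU Ux).
  by apply: near_impl (chart_near cU Ux) => y Uy; rewrite /= (chartK cU Uy).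
- move=> x m u f; have [U [phi [psi [cU Ux]]]] := H x.
  move=> su sf; apply/(chart_smooth cU _ Ux).
  apply: (@smooth_near_comp _ _ _ _ (fun i => u i \o psi)).
    by move=> i; apply/(chart_smooth cU _ Ux).
  by rewrite (_ : \row_i _ = \row_i u i x) //; apply/rowP => i; rewrite !mxE /= (chartK cU Ux).
Qed.

Lemma chart_smooth_pull (R : realType) (X : smoothSpace R) n U phi psi y (f : 'rV[R]_n -> R) :
  manifold X -> @chart R X n U phi psi -> U y -> smooth_near (phi y) f ->
  smooth_at y (f \o phi).
Proof.
move=> mX cU Uy sf; apply/(chart_smooth cU _ Uy).
apply: smooth_near_germ sf; apply: near_impl (chart_near_inv cU Uy) => z [_ E].
by rewrite /= E.
Qed.

Section TangentAlgebra.
Variables (R : realType) (X : smoothSpace R) (cX : cinfty X).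
Variables (x : X) (v : vec X) (tv : tangent x v).

Lemma tangentD f g : smooth_at x f -> smooth_at x g ->
  v (fun y => f y + g y) = v f + v g.
Proof.
move=> sf sg; have := tangent_lin tv 1 sf sg; rewrite mul1r => <-.
by congr v; apply/funext => y; rewrite mul1r.
Qed.

Lemma tangent_cst (a : R) : v (fun=> a) = 0.
Proof.
have s1 := smooth_cst cX x 1.
have v1 : v (fun=> 1) = 0.
  have := tangent_leibniz tv s1 s1; rewrite !mul1r => E.
  by move: E => /eqP; rewrite -subr_eq0 opprD addrA subrr sub0r oppr_eq0 => /eqP.
have s0 := smooth_cst cX x 0.
have v0 : v (fun=> 0) = 0.
  by have := tangent_leibniz tv s0 s0; rewrite !mul0r addr0.
have := tangent_lin tv a s1 s0; rewrite v1 v0 => E.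
by move: E; rewrite mulr1 mulr0 !addr0.
Qed.

Lemma tangent_sum (I : Type) (s : seq I) (F : I -> X -> R) :
  (forall i, smooth_at x (F i)) ->
  v (fun y => \sum_(i <- s) F i y) = \sum_(i <- s) v (F i).
Proof.
move=> sF; elim: s => [|i s IH].
  rewrite big_nil; apply: etrans (tangent_cst 0); congr v; apply/funext => y; exact: big_nil.
rewrite big_cons -IH -tangentD //; last exact: smooth_sum.
by congr v; apply/funext => y; rewrite big_cons.
Qed.

(** After Hadamard's expansion around the values at x, the factors [u i y - u i x] vanish at x, so
    the Leibniz rule leaves only the terms in which they are differentiated. *)
Lemma tangent_chain m (u : 'I_m -> X -> R) f :
  (forall i, smooth_at x (u i)) -> smooth_near (\row_i u i x) f ->
  v (fun y => f (\row_i u i y)) =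
    \sum_i 'D_(delta_mx ord0 i) f (\row_i u i x) * v (u i).
Proof.
move=> su sf; have [g [sg g0 fE]] := hadamard sf.
set z0 := \row_i u i x in sf sg g0 fE *.
pose G i y := g i (\row_j u j y).
have sG i : smooth_at x (G i) by exact: (cinfty_comp cX su (sg i)).
have cu : {for x, continuous (fun y => \row_i u i y)}.
  by apply: continuous_row => i; exact: (cinfty_cont cX (su i)).
have su' i : smooth_at x (fun y => u i y + - u i x).
  by apply: (smoothD cX) => //; exact: (smooth_cst cX).
have sT i : smooth_at x (fun y => (u i y + - u i x) * G i y).
  exact: (smoothM cX).
rewrite (tangent_germ tv (g := fun y => f z0 + \sum_i (u i y + - u i x) * G i y)).
- rewrite tangentD ?tangent_cst ?add0r; [|exact: (smooth_cst cX)|exact: (smooth_sum cX)].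
  rewrite tangent_sum //; apply: eq_bigr => i _.
  rewrite (tangent_leibniz tv) // subrr mul0r add0r /G g0; congr (_ * _).
  by rewrite tangentD ?tangent_cst ?addr0 //; exact: (smooth_cst cX).
- exact: (cinfty_comp cX).
- by apply: (smoothD cX); [exact: (smooth_cst cX)|exact: (smooth_sum cX)].
- apply: near_impl (near_comp cu fE) => y /= ->; congr (_ + _).
  by apply: eq_bigr => i _; rewrite /z0 !mxE.
Qed.
End TangentAlgebra.

Lemma tangent_smooth_eq (R : realType) (X : smoothSpace R) (x : X) v w :
  tangent x v -> tangent x w -> (forall f, smooth_at x f -> v f = w f) -> v = w.
Proof.
move=> tv tw vw; apply/funext => f.
have [sf|nf] := pselect (smooth_at x f); first exact: vw.
by rewrite (tangent_out tv) // (tangent_out tw).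
Qed.

Lemma chart_tangent (R : realType) (X : smoothSpace R) n U phi psi (x : X) v f :
  manifold X -> @chart R X n U phi psi -> U x -> tangent x v -> smooth_at x f ->
  v f = \sum_j 'D_(delta_mx ord0 j) (f \o psi) (phi x) * v (fun y => phi y ord0 j).
Proof.
move=> mX cU Ux tv sf; have cX := manifold_cinfty mX.
have rowE y : \row_j phi y ord0 j = phi y by apply/rowP => j; rewrite mxE.
have s1 : smooth_near (\row_j phi x ord0 j) (f \o psi).
  by rewrite rowE; apply/(chart_smooth cU _ Ux).
have sc j : smooth_at x (fun y => phi y ord0 j) by exact: (chart_coord_smooth cU).
have := tangent_chain cX tv sc s1; rewrite rowE => <-.
apply: (tangent_germ tv) => //; first exact: (cinfty_comp cX sc s1).
by apply: near_impl (chart_near cU Ux) => y Uy; rewrite rowE /= (chartK cU).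
Qed.

(** * Curves and their velocities *)

Section Curves.
Variables (R : realType).

(** Only the derivative at 0 is asked for: curves lifted through a submersion are chosen separately
    for each t. Continuity at 0 is a clause of its own because it carries statements about germs at
    x over to small t. *)
Definition curve_at (X : smoothSpace R) (x : X) (v : vec X) (c : R -> X) : Prop :=
  [/\ c 0 = x, {for 0, continuous c} &
      forall f, smooth_at x f -> is_derive (0 : R) 1 (f \o c) (v f)].

(** The device behind the identities of the tangent groupoid: both sides are velocities of curves
    that agree near 0 by an identity between arrows. *)
Lemma curve_unique (X : smoothSpace R) (x : X) v w (c d : R -> X) :
  tangent x v -> tangent x w -> curve_at x v c -> curve_at x w d ->
  (\forall t \near (0 : R), c t = d t) -> v = w.
Proof.
move=> tv tw [_ _ cv] [_ _ dw] cd; apply: (tangent_smooth_eq tv tw) => f sf.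
have [_ <-] := cv _ sf; have [_ <-] := dw _ sf.
by apply: near_eq_derive; apply: near_impl cd => t /= ->.
Qed.

Lemma curve_near (X : smoothSpace R) (x : X) v (c d : R -> X) :
  (\forall t \near (0 : R), c t = d t) -> curve_at x v c -> curve_at x v d.
Proof.
move=> cd [c0 cc dc]; split.
- by rewrite -(nbhs_singleton cd).
- exact: cont_ext cc.
- move=> f sf; apply: near_eq_is_derive (dc _ sf).
  by apply: near_impl cd => t /= ->.
Qed.

Lemma curve_push (X Y : smoothSpace R) (F : X -> Y) (x : X) v c :
  smooth_map F -> curve_at x v c -> curve_at (F x) (diff_at F x v) (F \o c).
Proof.
move=> [cF sF] [c0 cc dc]; split.
- by rewrite /= c0.
- by apply: continuous_comp => //; exact: cF.
- move=> f sf; rewrite /diff_at asboolT //.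
  by rewrite -compA; apply: dc; exact: sF.
Qed.

Lemma diff_at_tangent (X Y : smoothSpace R) (F : X -> Y) (x : X) v :
  cinfty Y -> smooth_map F -> tangent x v -> tangent (F x) (diff_at F x v).
Proof.
move=> cY [cF sF] tv; split.
- by move=> f nf; rewrite /diff_at asboolF.
- move=> f g sf sg fg; rewrite /diff_at !asboolT //.
  apply: (tangent_germ tv); [exact: sF..|].
  exact: near_comp (cF x) fg.
- move=> a f g sf sg; rewrite /diff_at !asboolT //.
    by rewrite -(tangent_lin tv a (sF _ _ sf) (sF _ _ sg)).
  apply: (smoothD cY) => //; apply: (smoothM cY) => //; exact: (smooth_cst cY).
- move=> f g sf sg; rewrite /diff_at !asboolT //.
    by rewrite -(tangent_leibniz tv (sF _ _ sf) (sF _ _ sg)).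
  exact: (smoothM cY).
Qed.

Lemma tangent_lincomb (X : smoothSpace R) (x : X) (a : R) (v w : vec X) :
  tangent x v -> tangent x w -> tangent x (a *: v + w).
Proof.
move=> tv tw; have E f : (a *: v + w) f = a * v f + w f by [].
split.
- by move=> f nf; rewrite E (tangent_out tv) // (tangent_out tw) // mulr0 addr0.
- by move=> f g sf sg fg; rewrite !E (tangent_germ tv sf sg fg) (tangent_germ tw sf sg fg).
- move=> b f g sf sg; rewrite !E (tangent_lin tv) // (tangent_lin tw) //; ring.
- move=> f g sf sg; rewrite !E (tangent_leibniz tv) // (tangent_leibniz tw) //; ring.
Qed.

Lemma tangent0 (X : smoothSpace R) (x : X) : tangent x 0.
Proof.
have E f : (0 : vec X) f = 0 by [].
by split=> *; rewrite !E ?mulr0 ?addr0.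
Qed.

Lemma diff_at_lincomb (X Y : smoothSpace R) (F : X -> Y) (x : X) (a : R) v w :
  diff_at F x (a *: v + w) = a *: diff_at F x v + diff_at F x w.
Proof.
apply/funext => f; rewrite /diff_at.
have -> : (a *: (fun f => if `[< smooth_at (F x) f >] then v (f \o F) else 0) +
  (fun f => if `[< smooth_at (F x) f >] then w (f \o F) else 0)) f =
  a * (if `[< smooth_at (F x) f >] then v (f \o F) else 0) +
  (if `[< smooth_at (F x) f >] then w (f \o F) else 0) by [].
by case: ifP => // _; rewrite mulr0 addr0.
Qed.

(** The value 0 on functions that are not smooth at x is the convention of [tangent_out]. *)
Definition velocity (X : smoothSpace R) (x : X) (c : R -> X) : vec X :=
  fun f => if `[< smooth_at x f >] then 'D_1 (f \o c) (0 : R) else 0.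

Lemma velocityP (X : smoothSpace R) (x : X) (c : R -> X) : cinfty X ->
  c 0 = x -> {for 0, continuous c} ->
  (forall f, smooth_at x f -> derivable (f \o c) (0 : R) 1) ->
  tangent x (velocity x c) /\ curve_at x (velocity x c) c.
Proof.
move=> cX c0 cc dc; split; last first.
  by split => // f sf; rewrite /velocity asboolT //; apply: DeriveDef => //; exact: dc.
split.
- by move=> f nf; rewrite /velocity asboolF.
- move=> f g sf sg fg; rewrite /velocity !asboolT //; apply: near_eq_derive.
  by have := near_comp cc; rewrite c0 => /(_ _ fg).
- move=> a f g sf sg; rewrite /velocity !asboolT //; last first.
    by apply: (smoothD cX) => //; apply: (smoothM cX) => //; exact: (smooth_cst cX).
  have -> : (fun y => a * f y + g y) \o c = a *: (f \o c) + (g \o c) by [].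
  by rewrite deriveD ?deriveZ //; [exact: dc|apply: derivableZ; exact: dc|exact: dc].
- move=> f g sf sg; rewrite /velocity !asboolT //; last exact: (smoothM cX).
  have -> : (fun y => f y * g y) \o c = (f \o c) * (g \o c) by [].
  by rewrite deriveM ?/= ?c0 //; exact: dc.
Qed.

Lemma chart_curve (X : smoothSpace R) n U phi psi (x : X) v (c : R -> 'rV[R]_n) :
  manifold X -> @chart R X n U phi psi -> U x -> tangent x v -> c 0 = phi x ->
  (forall j, is_derive (0 : R) 1 (fun t => c t ord0 j) (v (fun y => phi y ord0 j))) ->
  curve_at x v (psi \o c).
Proof.
move=> mX cU Ux tv c0 dc.
have cc : {for 0, continuous c}.
  apply: (@cont_ext _ _ (fun t => \row_j c t ord0 j)).
    by apply: near_all => t; apply/rowP => j; rewrite mxE.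
  by apply: continuous_row => j; exact: is_derive1_cont (dc j).
split.
- by rewrite /= c0 (chartK cU).
- apply: continuous_comp => //; rewrite c0; exact: (chart_psi_cont cU).
- move=> f sf; rewrite compA (chart_tangent mX cU Ux tv sf).
  have [V [oV Vx CV]] := (chart_smooth cU f Ux).1 sf.
  rewrite -c0 in Vx *; exact: (chain_rule_curve oV (CV 1%N) Vx dc).
Qed.

Lemma tangent_curve (X : smoothSpace R) (x : X) v : manifold X -> tangent x v ->
  exists c, curve_at x v c.
Proof.
move=> mX tv; have [n H] := manifold_chart mX.
have [U [phi [psi [cU Ux]]]] := H x.
pose a : 'rV[R]_n := \row_j v (fun y => phi y ord0 j).
exists (psi \o (fun t : R => t *: a + phi x)).
apply: (chart_curve mX cU Ux tv); first by rewrite scale0r add0r.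
move=> j; under eq_fun do rewrite !mxE.
exact: is_derive_affine.
Qed.
End Curves.

(** * Lifting curves along a submersion *)

Lemma rV_norm_leP (R : realType) n (y : 'rV[R]_n) (c : R) : 0 <= c ->
  reflect (forall j, `|y ord0 j| <= c) (`|y| <= c).
Proof.
move=> c0; rewrite /Num.norm /= mx_normrE; apply: (iffP (bigmax_leP _ _ _ _)).
  by move=> [_ H] j; exact: (H (ord0, j)).
by move=> H; split => // -[i j] _; rewrite ord1; exact: H.
Qed.

Lemma rV_norm_ge (R : realType) n (y : 'rV[R]_n) j : `|y ord0 j| <= `|y|.
Proof. exact: (rV_norm_leP _ (normr_ge0 _) _). Qed.

Section ChartVec.
Variables (R : realType) (X : smoothSpace R) (n : nat).
Variables (U : set X) (phi : X -> 'rV[R]_n) (psi : 'rV[R]_n -> X).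
Hypotheses (mX : manifold X) (cU : chart U phi psi).

(** The coordinate vector field of the chart, extended by 0 as [tangent_out] requires. *)
Definition chart_vec (y : X) (j : 'I_n) : vec X := fun f =>
  if `[< smooth_at y f >] then 'D_(delta_mx ord0 j) (f \o psi) (phi y) else 0.

Lemma chart_vecE y j f : smooth_at y f ->
  chart_vec y j f = 'D_(delta_mx ord0 j) (f \o psi) (phi y).
Proof. by move=> sf; rewrite /chart_vec asboolT. Qed.

Lemma chart_vec_tangent y j : U y -> tangent y (chart_vec y j).
Proof.
move=> Uy; pose c (t : R) := psi (t *: delta_mx ord0 j + phi y).
have dc f : smooth_at y f ->
    is_derive (0 : R) 1 (f \o c) ('D_(delta_mx ord0 j) (f \o psi) (phi y)).
  move=> sf; have [V [oV Vy CV]] := (chart_smooth cU f Uy).1 sf.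
  apply/(@derivable_line _ _ (f \o psi)); apply: derivableP.
  exact: ((CV 1%N).2 j).1.
have [] := @velocityP _ X y c (manifold_cinfty mX).
- by rewrite /c scale0r add0r (chartK cU).
- apply: continuous_comp; last first.
    by rewrite scale0r add0r; exact: (chart_psi_cont cU).
  apply: (@cont_ext _ _ (fun t : R => \row_i (t * (delta_mx ord0 j : 'rV[R]_n) ord0 i + phi y ord0 i))).
    by apply: near_all => t; apply/rowP => i; rewrite !mxE.
  by apply: continuous_row => i; apply: is_derive1_cont; exact: is_derive_affine.
- by move=> f sf; have [] := dc _ sf.
- rewrite (_ : velocity y c = chart_vec y j) //; apply/funext => f.
  rewrite /velocity /chart_vec; case: asboolP => // sf.
  by have [_ ->] := dc _ sf.
Qed.

Lemma chart_vec_coord y i j : U y ->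
  chart_vec y j (fun y => phi y ord0 i) = (j == i)%:R.
Proof.
move=> Uy; rewrite chart_vecE; last exact: (chart_coord_smooth cU).
rewrite (@near_eq_derive _ _ _ _ (fun z : 'rV[R]_n => z ord0 i)).
  by have [_ ->] := derive_coord (phi y) (delta_mx ord0 j) i; rewrite mxE eqxx eq_sym.
by apply: near_impl (chart_near_inv cU Uy) => z [_ /= ->].
Qed.

Lemma chart_vec_sum y (v : vec X) : U y -> tangent y v ->
  v = fun f => \sum_j v (fun y => phi y ord0 j) * chart_vec y j f.
Proof.
move=> Uy tv; apply/funext => f.
have [sf|nf] := pselect (smooth_at y f).
  rewrite (chart_tangent mX cU Uy tv sf); apply: eq_bigr => j _.
  by rewrite chart_vecE // mulrC.
rewrite (tangent_out tv) // big1 // => j _.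
by rewrite /chart_vec asboolF // mulr0.
Qed.
End ChartVec.

(* The function y |-> |T y - y| attains its minimum on K, which a contraction
   would halve unless it is 0. *)
Lemma contraction_fixpoint (R : realType) m (K : set 'rV[R]_m) (T : 'rV[R]_m -> 'rV[R]_m) :
  compact K -> K !=set0 -> (forall y, K y -> {for y, continuous T}) ->
  (forall y, K y -> K (T y)) ->
  (forall y z, K y -> K z -> `|T y - T z| <= `|y - z| / 2) ->
  exists2 y, K y & T y = y.
Proof.
move=> cK K0 cT KT lT.
have [|y] := @EVT_min_rV _ _ (fun y => `|T y - y|) K K0 cK.
  apply: continuous_in_subspaceT => y; rewrite inE => /cT cy.
  apply: (@continuous_comp _ _ _ (fun y => T y - y) (fun z => `|z|)).
    by apply: (@continuousB _ _ _ T id).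
  exact: norm_continuous.
rewrite inE => Ky ymin; exists y => //; apply/eqP; rewrite -subr_eq0 -normr_eq0.
have := ymin (T y); rewrite inE => /(_ (KT _ Ky)) h1.
have h2 := lT _ _ (KT _ Ky) Ky.
rewrite eq_le normr_ge0 andbT; lra.
Qed.

Section SubmersionLift.
Variables (R : realType) (X Z : smoothSpace R) (F : X -> Z).
Hypotheses (mX : manifold X) (mZ : manifold Z) (sF : submersion F).

(** In charts, the straight line in the direction v lies over zeta up to an error o(t). Near x the
    differential of F stays close to one with a right inverse, so a fixed point argument at each t
    corrects the line exactly, at a cost bounded by the error. The correction is thus o(t) and does
    not change the velocity. *)
Lemma submersion_lift (x : X) v (zeta : R -> Z) :
  tangent x v -> curve_at (F x) (diff_at F x v) zeta ->
  exists2 c, curve_at x v c & \forall t \near (0 : R), F (c t) = zeta t.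
Proof.
move=> tv [z0 cz dz].
have [n /(_ x)[U [phi [psi [cU Ux]]]]] := manifold_chart mX.
have [m /(_ (F x))[V [chi [om [cV Vx]]]]] := manifold_chart mZ.
have [[cF smF] subF] := sF.
pose x0 := phi x.
pose G i (z : 'rV[R]_n) := chi (F (psi z)) ord0 i.
have schi i : smooth_at (F x) (fun z => chi z ord0 i) by exact: (chart_coord_smooth cV).
have schiF i : smooth_at x (fun y => chi (F y) ord0 i) by exact: (smF _ _ (schi i)).
have sG i : smooth_near x0 (G i) := (chart_smooth cU _ Ux).1 (schiF i).
have [U0 [oU0 U0x CG]] := smooth_near_common sG.
have vchi i : v (fun y => chi (F y) ord0 i) =
    \sum_j 'D_(delta_mx ord0 j) (G i) x0 * v (fun y => phi y ord0 j).
  by rewrite (chart_tangent mX cU Ux tv (schiF i)).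
have /choice[w wP] i : exists w : vec X, tangent x w /\
    diff_at F x w = chart_vec chi om (F x) i.
  by have [w tw dw] := subF x _ (chart_vec_tangent mZ cV i Vx); exists w.
(* Row i holds the coordinates of a vector that F sends to the i-th coordinate vector, so that
   [y |-> y *m B] is a right inverse of the differential of F at x. *)
pose B : 'M[R]_(m, n) := \matrix_(i, j) w i (fun y => phi y ord0 j).
have BP i k : \sum_j 'D_(delta_mx ord0 j) (G k) x0 * B i j = (i == k)%:R.
  apply: etrans (chart_vec_coord cV k i Vx); rewrite -(wP i).2 /diff_at asboolT //.
  rewrite (chart_tangent mX cU Ux (wP i).1 (schiF k)).
  by apply: eq_bigr => j _; rewrite mxE.
pose a : 'rV[R]_n := \row_j v (fun y => phi y ord0 j).
pose C := \sum_i \sum_j `|B i j|.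
have C0 : 0 <= C by apply: sumr_ge0 => i _; apply: sumr_ge0 => j _.
have CP (y : 'rV[R]_m) j : `|(y *m B) ord0 j| <= C * `|y|.
  rewrite mxE; apply: le_trans (ler_norm_sum _ _ _) _; rewrite mulr_suml.
  apply: ler_sum => i _; rewrite normrM mulrC ler_pM //; last exact: rV_norm_ge.
  by rewrite (bigD1 j) //= lerDl sumr_ge0.
(* The contraction estimate sums n terms of size eps C, and this choice brings them to at most 1/2;
   adding 1 keeps the denominator positive. *)
pose eps := (2 * (n%:R * C + 1))^-1.
have eps0 : 0 < eps by rewrite invr_gt0 mulr_gt0 // ltr_wpDl // mulr_ge0.
have epsP : eps * (n%:R * C) <= 2^-1.
  have D0 : 0 <= n%:R * C by rewrite mulr_ge0.
  by rewrite /eps mulrC ler_pdivrMr; lra.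
have [r r0 rP] : exists2 r : R, 0 < r & forall z, ball x0 r z -> U0 z /\
    forall i j, `|'D_(delta_mx ord0 j) (G i) z - 'D_(delta_mx ord0 j) (G i) x0| <= eps.
  have n1 : nbhs x0 U0 by exact: open_nbhs_nbhs.
  have n2 : nbhs x0 [set z | forall i j,
      `|'D_(delta_mx ord0 j) (G i) z - 'D_(delta_mx ord0 j) (G i) x0| <= eps].
    apply: near_forall => i; apply: near_forall => j.
    have cD : {for x0, continuous ('D_(delta_mx ord0 j) (G i))}.
      exact: (((CG i 1%N).2 j).2.1 _ U0x).
    have := (@cvgrPdist_le _ _ _ (nbhs x0) (nbhs_filter x0) _ _).1 cD _ eps0.
    by apply: near_impl => z; rewrite distrC.
  have := near_and n1 n2; rewrite -nbhs_ballE => -[r /= r0 rP].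
  by exists r => // z /rP.
(* The lift is sought as the straight line plus a correction in the image of B; [h i] is the i-th
   coordinate of the error of the uncorrected line, and e its total size. *)
pose p (t : R) (y : 'rV[R]_m) := t *: a + x0 + y *m B.
pose zc t i := chi (zeta t) ord0 i.
pose h i t := G i (t *: a + x0) - zc t i.
pose e t := \sum_i `|h i t|.
have e_ge0 t : 0 <= e t by exact: sumr_ge0.
have dh i : is_derive (0 : R) 1 (h i) 0.
  have d1 : is_derive (0 : R) 1 (fun t => G i (t *: a + x0)) (v (fun y => chi (F y) ord0 i)).
    rewrite vchi.
    have := @chain_rule_curve R n U0 (G i) (fun t : R => t *: a + x0) 0
      (fun j => v (fun y => phi y ord0 j)) oU0 (CG i 1%N).
    rewrite scale0r add0r; apply => // j; under eq_fun do rewrite !mxE.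
    exact: is_derive_affine.
  have d2 := dz _ (schi i); rewrite {1}/diff_at asboolT // in d2.
  have := is_deriveB d1 d2; rewrite subrr; exact.
have h0 i : h i 0 = 0.
  by rewrite /h /zc z0 scale0r add0r /G (chartK cU) ?subrr.
have ce : {for 0, continuous e}.
  by apply: cvg_sumr => i; apply: cvg_norm; exact: is_derive1_cont (dh i).
have e0 : e 0 = 0 by rewrite /e big1 // => i _; rewrite h0 normr0.
have e_bound t i : `|h i t| <= e t by rewrite /e (bigD1 i) //= lerDl sumr_ge0.
pose small t := `|t| * `|a| + C * (2 * e t) < r.
have near_small : \forall t \near (0 : R), small t.
  have cs : {for 0, continuous (fun t : R => `|t| * `|a| + C * (2 * e t))}.
    apply: cvgD; first by apply: cvgM; [apply: cvg_norm; exact: cvg_id|exact: cvg_cst].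
    by apply: cvgM; [exact: cvg_cst|apply: cvgM; [exact: cvg_cst|exact: ce]].
  apply: (near_comp cs (P := [set s | s < r])); rewrite normr0 e0 mul0r !mulr0 addr0.
  by apply: open_nbhs_nbhs; split => //; exact: open_lt.
have pE (t : R) (y : 'rV[R]_m) j :
    p t y ord0 j = t * a ord0 j + x0 ord0 j + (y *m B) ord0 j.
  by rewrite /p [LHS]mxE [X in X + _]mxE [X in X + _ + _]mxE.
have small_ball (t : R) (y : 'rV[R]_m) : small t -> `|y| <= 2 * e t -> ball x0 r (p t y).
  move=> st ye; apply/ball_rV; split => // j; rewrite pE.
  rewrite (_ : _ - _ = - (t * a ord0 j + (y *m B) ord0 j)); last by ring.
  rewrite normrN; apply: le_lt_trans st; apply: le_trans (ler_normD _ _) _.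
  rewrite lerD //; first by rewrite normrM ler_wpM2l // rV_norm_ge.
  by apply: le_trans (CP y j) _; rewrite ler_wpM2l.
have /choice[y yP] (t : R) : exists y : 'rV[R]_m, small t ->
    `|y| <= 2 * e t /\ forall i, G i (p t y) = zc t i.
  have [st|] := pselect (small t); last by exists 0.
  (* A simplified Newton step that uses the inverse at x0 throughout. Its fixed points are the
     corrections y for which [p t y] lies over [zeta t]. *)
  pose T (y : 'rV[R]_m) : 'rV[R]_m := y - \row_i (G i (p t y) - zc t i).
  pose K := closed_ball_ (@Num.norm _ 'rV[R]_m) 0 (2 * e t).
  have KE y : K y <-> `|y| <= 2 * e t by rewrite /K /closed_ball_ /= sub0r normrN.
  have lT (y z : 'rV[R]_m) : K y -> K z -> `|T y - T z| <= `|y - z| / 2.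
    move=> /KE Ky /KE Kz.
    have by_ := small_ball _ _ st Ky; have bz := small_ball _ _ st Kz.
    apply/rV_norm_leP => [|i]; first by rewrite divr_ge0.
    have CGr : Ck 1 (ball x0 r) (G i) by apply: Ck_sub (CG i 1%N) => u /rP[].
    have [xi xiP EG] := mean_value_rV CGr by_ bz.
    have E : (T y - T z) ord0 i =
        - \sum_j ('D_(delta_mx ord0 j) (G i) (xi j) - 'D_(delta_mx ord0 j) (G i) x0) *
                 ((y - z) *m B) ord0 j.
      have dE : \sum_j 'D_(delta_mx ord0 j) (G i) x0 * ((y - z) *m B) ord0 j = (y - z) ord0 i.
        have S k : \sum_j 'D_(delta_mx ord0 j) (G i) x0 * ((y - z) ord0 k * B k j) =
            (y - z) ord0 k * (k == i)%:R.
          transitivity ((y - z) ord0 k * \sum_j 'D_(delta_mx ord0 j) (G i) x0 * B k j).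
            by rewrite mulr_sumr; apply: eq_bigr => j _; rewrite mulrCA.
          by congr (_ * _); exact: BP.
        under eq_bigr do rewrite mxE mulr_sumr.
        rewrite exchange_big /= (eq_bigr _ (fun k _ => S k)) (bigD1 i) //= eqxx mulr1.
        by rewrite big1 ?addr0 // => k /negbTE ->; rewrite mulr0.
      under eq_bigr do rewrite mulrBl.
      rewrite sumrB dE opprB.
      have -> : \sum_j 'D_(delta_mx ord0 j) (G i) (xi j) * ((y - z) *m B) ord0 j =
          G i (p t y) - G i (p t z).
        rewrite EG; apply: eq_bigr => j _; congr (_ * _).
        by rewrite !pE mulmxBl [LHS]mxE [X in _ + X = _]mxE; ring.
      by rewrite /T !mxE; ring.
    rewrite E normrN; apply: le_trans (ler_norm_sum _ _ _) _.
    apply: (@le_trans _ _ (\sum_(j < n) eps * (C * `|y - z|))).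
      apply: ler_sum => j _; rewrite normrM ler_pM //.
      by have [_] := rP (xi j) (xiP _ _ by_ bz); exact.
    rewrite sumr_const card_ord -[leLHS]mulr_natl [leRHS]mulrC.
    rewrite (_ : n%:R * _ = eps * (n%:R * C) * `|y - z|); last by ring.
    exact: ler_wpM2r.
  have T0 : `|T 0| <= e t.
    apply/rV_norm_leP => // i; rewrite /T !mxE sub0r normrN /p mul0mx addr0; exact: e_bound.
  have K00 : K 0 by apply/KE; rewrite normr0 mulr_ge0.
  (* The radius 2 e t is chosen for this: |T y| is at most |y| / 2 + |T 0|, and both terms are at
     most e t. *)
  have KT y : K y -> K (T y).
    move=> Ky; apply/KE; have := lT _ _ Ky K00; rewrite subr0 => h1.
    have : `|T y| <= `|T y - T 0| + `|T 0| by rewrite -{1}[T y](subrK (T 0)) ler_normD.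
    by move/KE: Ky; lra.
  have cT y : K y -> {for y, continuous T}.
    move=> /KE Ky; apply: (@continuousB _ _ _ id); first by move=> A.
    apply: continuous_row => i; apply: (@continuousB _ _ _ (fun y => G i (p t y)) (cst _)).
      2: exact: cst_continuous.
    apply: (@continuous_comp _ _ _ (p t) (G i)).
      apply: (@cont_ext _ _ (fun y : 'rV[R]_m => \row_j ((t *: a + x0) ord0 j + \sum_k y ord0 k * B k j))).
        by apply: near_all => u; apply/rowP => j; rewrite /p !mxE.
      apply: continuous_row => j; apply: (@Ck_cont _ _ 0 setT) => //.
      apply: CkD; [exact: openT|exact: Ck_cst|].
      apply: Ck_sum => [|k _]; first exact: openT.
      by apply: CkM; [exact: openT|exact: Ck_coord|exact: Ck_cst].
    by apply: (Ck_cont (CG i 0%N)); case: (rP _ (small_ball _ _ st Ky)).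
  have cK : compact K.
    apply: bounded_closed_compact; last exact: closed_closed_ball_.
    exists (2 * e t); split; first exact: num_real.
    by move=> M M1 y /KE Ky; exact: le_trans Ky (ltW M1).
  have [y Ky Ty] := contraction_fixpoint cK (ex_intro _ _ K00) cT KT lT.
  exists y => _; split; first exact/KE.
  move=> i; have := congr1 (fun z : 'rV_m => z ord0 i) Ty; rewrite /T !mxE.
  by move/eqP; rewrite -subr_eq0 addrAC subrr add0r oppr_eq0 subr_eq0 => /eqP.
have y0 : y 0 = 0.
  have [+ _] := yP 0 (nbhs_singleton near_small).
  by rewrite e0 mulr0 normr_le0 => /eqP.
(* The y t are unrelated for different t; their derivative at 0 exists and vanishes just because |y
   t| is at most 2 e t, and e t / t tends to 0. *)
have dy k : is_derive (0 : R) 1 (fun t => y t ord0 k) 0.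
  apply/is_derive1P; rewrite y0 mxE.
  have lim : (fun t => 2 * \sum_i `|t^-1 * (h i (t + 0) - h i 0)|) @ (0 : R)^' --> (0 : R).
    rewrite -[X in _ --> X](mulr0 2); apply: cvgM; first exact: cvg_cst.
    rewrite -[X in _ --> X](_ : \sum_(i < m) 0 = 0); last by rewrite big1.
    apply: cvg_sumr => i; rewrite -[X in _ --> X](@normr0 _ R).
    by apply: cvg_norm; exact/is_derive1P.
  apply: norm_cvg0.
  apply: (@squeeze_cvgr _ _ _ _ (cst 0) _ _ _ _ (@cvg_cst _ _ _ _ _) lim).
  have := nbhs_dnbhs near_small; apply: filterS => t st.
  rewrite normr_ge0 /= addr0 subr0 normrM.
  have [yt _] := yP t st.
  apply: le_trans (ler_wpM2l (normr_ge0 _) (le_trans (rV_norm_ge _ _) yt)) _.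
  rewrite mulrCA ler_wpM2l // /e mulr_sumr; apply: ler_sum => i _.
  by rewrite h0 subr0 normrM.
pose g t := psi (p t (y t)).
have cg : curve_at x v g.
  apply: (chart_curve mX cU Ux tv); first by rewrite /p y0 scale0r add0r mul0mx addr0.
  move=> j.
  have -> : (fun t => p t (y t) ord0 j) =
      (fun t : R => t * v (fun y => phi y ord0 j) + x0 ord0 j) +
      (fun t => \sum_k y t ord0 k * B k j).
    by apply/funext => t; rewrite /p !mxE.
  rewrite -[X in is_derive _ _ _ X]addr0; apply: is_deriveD; first exact: is_derive_affine.
  apply/is_derive1P; rewrite -[X in _ --> X](_ : \sum_(k < m) 0 * B k j = 0); last first.
    by rewrite big1 // => k _; rewrite mul0r.
  apply: (@cvg_trans _ ((fun t => \sum_k (t^-1 * (y (t + 0) ord0 k - y 0 ord0 k)) * B k j) @ (0 : R)^')).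
    apply: near_eq_cvg; near=> t; rewrite -sumrB mulr_sumr; apply: eq_bigr => k _.
    by ring.
  apply: cvg_sumr => k; apply: cvgM; last exact: cvg_cst.
  exact/is_derive1P.
exists g => //.
have [g0 cgc _] := cg.
have nV : nbhs (0 : R) [set t | V (F (g t))].
  have cFg : {for 0, continuous (F \o g)} by apply: continuous_comp => //; exact: cF.
  by apply: (near_comp cFg (P := V)); rewrite /= g0; exact: (chart_near cV).
have nV' : nbhs (0 : R) [set t | V (zeta t)].
  by apply: (near_comp cz (P := V)); rewrite z0; exact: (chart_near cV).
apply: near_impl (near_and near_small (near_and nV nV')) => t [st [Vt Vt']].
rewrite -(chartK cV Vt) -(chartK cV Vt'); congr om; apply/rowP => i.
by have [_ /(_ i)] := yP t st.
Unshelve. all: by end_near. Qed.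
End SubmersionLift.

(** * Vector fields along a map *)

Section SmoothMaps.
Variables (R : realType).
Implicit Types X Y Z W : smoothSpace R.

Lemma smooth_map_comp X Y Z (F : X -> Y) (G : Y -> Z) :
  smooth_map F -> smooth_map G -> smooth_map (G \o F).
Proof.
move=> [cF sF] [cG sG]; split.
  by move=> x; apply: continuous_comp; [exact: cF|exact: cG].
by move=> x f sf; rewrite compA; apply: sF; exact: sG.
Qed.

Lemma smooth_map_cst X Y (y : Y) : cinfty X -> smooth_map (fun _ : X => y).
Proof.
move=> cX; split; first by move=> x; exact: cst_continuous.
by move=> x f _; exact: (smooth_cst cX).
Qed.

Lemma smooth_interior X x f : cinfty X -> smooth_at x f ->
  exists U, [/\ open U, U x & smooth_on (X := X) U f].
Proof.
move=> cX sf; exists [set y | smooth_at y f]°; split.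
- exact: open_interior.
- exact: (cinfty_open cX).
- by move=> y /interior_subset.
Qed.

Lemma pullback_smooth (T : Type) X (pr : T -> X) F : cinfty X ->
  pullback pr `<=` F -> smooth_map (pr : initial_space F -> X).
Proof.
move=> cX prF.
have sub U u : open U -> smooth_on (X := X) U u -> F (pr @^-1` U, u \o pr).
  by move=> oU su; apply: prF; exists U, u.
split=> [x A|x f sf].
  move=> nA; have oA : open A° by exact: open_interior.
  have FA : F (pr @^-1` A°, cst 0 \o pr).
    by apply: sub => // y _; exact: (smooth_cst cX).
  have := @initial_nbhs R T F _ x FA nA; apply: near_impl => y.
  exact: interior_subset.
have [U [oU Ux sU]] := smooth_interior cX sf.
exact: (@initial_smooth_gen R T F _ x (sub _ _ oU sU) Ux).
Qed.

Lemma pullback_into (T : Type) X W (pr : T -> X) (G : W -> T) p x :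
  smooth_map (pr \o G) -> pullback pr p -> p.1 (G x) ->
  (\forall y \near x, p.1 (G y)) /\ smooth_at x (p.2 \o G).
Proof.
move=> [cG sG] [U [u [oU su ->]]] /= Ux; split.
  exact: (near_comp (cG x) (open_nbhs_nbhs (conj oU Ux))).
by rewrite -compA; apply: (sG x); exact: su.
Qed.
End SmoothMaps.

Section InitialTangent.
Variables (R : realType) (T : Type) (F : set (set T * (T -> R))).
Local Notation TF := (initial_space F).

Lemma initial_tangent_chain (x : TF) v m (p : 'I_m -> set T * (T -> R)) Phi f :
  tangent x v -> (forall i, F (p i) /\ (p i).1 x) ->
  smooth_near (\row_i (p i).2 x) Phi ->
  (\forall y \near x, f y = Phi (\row_i (p i).2 y)) ->
  v f = \sum_i 'D_(delta_mx ord0 i) Phi (\row_i (p i).2 x) * v (p i).2.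
Proof.
move=> tv Fp sPhi fE; have cT := initial_cinfty F.
have sp i : smooth_at x ((p i).2 : TF -> R).
  by have [Fi pi] := Fp i; exact: initial_smooth_gen.
rewrite -(tangent_chain cT tv sp sPhi); apply: (tangent_germ tv) => //.
- by exists m, p, Phi.
- exact: (cinfty_comp cT).
Qed.

(** By the chain rule a derivation is determined by its values on generators. This is the uniqueness
    behind the [xget] of [tangent_pair] and [tangent_lift]. *)
Lemma initial_tangent_unique (x : TF) v w : tangent x v -> tangent x w ->
  (forall p, F p -> p.1 x -> v p.2 = w p.2) -> v = w.
Proof.
move=> tv tw vw; apply: (tangent_smooth_eq tv tw) => f [m [p [Phi [Fp sPhi fE]]]].
rewrite (initial_tangent_chain tv Fp sPhi fE) (initial_tangent_chain tw Fp sPhi fE).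
by apply: eq_bigr => i _; have [Fi pi] := Fp i; rewrite (vw _ Fi pi).
Qed.

(** The source of tangent vectors on initial spaces, where no charts are at hand: a curve along
    which the generators are differentiable has a velocity. *)
Lemma initial_curve (x : TF) (c : R -> TF) : c 0 = x ->
  (forall p, F p -> p.1 x -> (\forall t \near (0 : R), p.1 (c t)) /\
                             derivable (p.2 \o c) (0 : R) 1) ->
  tangent x (velocity x c) /\ curve_at x (velocity x c) c.
Proof.
move=> c0 Hc.
have cc : {for 0, continuous c}.
  rewrite /prop_for /continuous_at c0; apply: cvg_initial => _ [p [Fp [B oB ->]]] [px Bx].
  have [np dp] := Hc _ Fp px.
  have cp : {for 0, continuous (p.2 \o c)}.
    by move/derivable1_diffP/differentiable_continuous: dp.
  have nB : nbhs (0 : R) [set t | B (p.2 (c t))].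
    by apply: (near_comp cp); apply: open_nbhs_nbhs; rewrite /= c0.
  by apply: near_impl (near_and np nB) => t.
apply: velocityP => //; first exact: initial_cinfty.
move=> f [m [p [Phi [Fp [U [oU Ux CU]] fE]]]].
have dp i : derivable ((p i).2 \o c) (0 : R) 1.
  by have [Fi pi] := Fp i; have [] := Hc _ Fi pi.
have := @chain_rule_curve R m U Phi (fun t => \row_i (p i).2 (c t)) 0
  (fun i => 'D_1 ((p i).2 \o c) 0) oU (CU 1%N).
rewrite c0 => /(_ Ux)[|d _].
  by move=> j; under eq_fun do rewrite mxE; apply: derivableP; exact: dp.
apply: near_eq_derivable d; rewrite -c0 in fE.
by apply: near_impl (near_comp cc fE) => t /= ->.
Qed.
End InitialTangent.

Section FieldAlong.
Variables (R : realType).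
Implicit Types X Y Z W : smoothSpace R.

(** The working form of [smooth_along]: smoothness is tested on functions of the target, and the
    tangent bundle as a space disappears. *)
Record field_along X Y (b : X -> Y) (c : X -> vec Y) : Prop := FieldAlong {
  field_base : smooth_map b;
  field_tangent : forall x, tangent (b x) (c x);
  field_smooth : forall x f, smooth_at (b x) f -> smooth_at x (fun x' => c x' f)
}.

Lemma field_alongP X Y (b : X -> Y) (c : X -> vec Y) : cinfty X -> cinfty Y ->
  smooth_along b c <-> field_along b c.
Proof.
move=> cX cY; split.
- move=> [C sC CE].
  have tC x : tangent (b x) (c x) by have := svalP (C x); rewrite CE.
  have bE : b = (fun p : tangent_bundle Y => (sval p).1) \o C.
    by apply/funext => x; rewrite /= CE.
  have sb : smooth_map b.
    rewrite bE; apply: smooth_map_comp sC _; exact: pullback_smooth.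
  split => // x f sf.
  have [U [oU Ux sU]] := smooth_interior cY sf.
  pose q := ((fun p : {p : Y * vec Y | tangent p.1 p.2} => (sval p).1) @^-1` U,
             fun p : {p : Y * vec Y | tangent p.1 p.2} => (sval p).2 f).
  have sq : smooth_at (C x) (q.2 : tangent_bundle Y -> R).
    apply: (@initial_smooth_gen R _ _ q (C x)); last by rewrite /q /= CE.
    by right; exists U, f.
  apply: smooth_ext (sC.2 _ _ sq) => x'.
  by rewrite /= CE.
- move=> [sb tc sc]; pose C x : tangent_bundle Y := exist _ (b x, c x) (tc x).
  exists C => //; apply: (smooth_initial cX) => p x [pb|].
    exact: (@pullback_into R _ Y X (fun p => (sval p).1) C p x sb).
  move=> [U [u [oU su ->]]] /= Ux; split; last exact: (sc _ _ (su _ Ux)).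
  exact: (near_comp (sb.1 x) (open_nbhs_nbhs (conj oU Ux))).
Qed.

Lemma field_comp X X' Y (a : X' -> X) (b : X -> Y) c :
  smooth_map a -> field_along b c -> field_along (b \o a) (c \o a).
Proof.
move=> sa [sb tc sc]; split.
- exact: smooth_map_comp.
- by move=> x; exact: tc.
- by move=> x f sf; exact: (sa.2 _ _ (sc _ _ sf)).
Qed.

Lemma field_push X Y Z (F : Y -> Z) (b : X -> Y) c : cinfty X -> cinfty Z ->
  smooth_map F -> field_along b c ->
  field_along (F \o b) (fun x => diff_at F (b x) (c x)).
Proof.
move=> cX cZ sF [sb tc sc]; split.
- exact: smooth_map_comp.
- by move=> x; exact: (diff_at_tangent cZ sF (tc x)).
- move=> x f sf; apply: (cinfty_germ cX) (sc _ _ (sF.2 _ _ sf)).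
  have sFb := smooth_map_comp sb sF.
  apply: near_impl (near_comp (sFb.1 x) (cinfty_open cZ sf)) => y sy.
  by rewrite /diff_at asboolT.
Qed.

Lemma field_lincomb X Y (b : X -> Y) (a : X -> R) c d : cinfty X ->
  (forall x, smooth_at x a) -> field_along b c -> field_along b d ->
  field_along b (fun x => a x *: c x + d x).
Proof.
move=> cX sa [sb tc sc] [_ td sd]; split => //.
- by move=> x; exact: tangent_lincomb.
- move=> x f sf; apply: (smoothD cX (smoothM cX (sa x) (sc _ _ sf)) (sd _ _ sf)).
Qed.

Lemma field0 X Y (b : X -> Y) : cinfty X -> smooth_map b ->
  field_along b (fun=> 0).
Proof.
move=> cX sb; split => //; first by move=> x; exact: tangent0.
by move=> x f _; exact: (smooth_cst cX).
Qed.

(** Near x the value of the field on f is a combination of its values on the generators, with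
    coefficients the partial derivatives of Phi along b. These are smooth, so testing on generators
    is enough. *)
Lemma field_initial (T : Type) (F : set (set T * (T -> R))) X
    (b : X -> initial_space F) c : cinfty X -> smooth_map b ->
  (forall x, tangent (b x) (c x)) ->
  (forall x p, F p -> p.1 (b x) -> smooth_at x (fun x' => c x' p.2)) ->
  field_along b c.
Proof.
move=> cX sb tc sc; split => // x f [m [p [Phi [Fp sPhi fE]]]].
have spb i : smooth_at x ((p i).2 \o b).
  by have [Fi pi] := Fp i; apply: (sb.2 x); exact: initial_smooth_gen.
apply: (cinfty_germ cX (f := fun x' => \sum_i
    'D_(delta_mx ord0 i) Phi (\row_i (p i).2 (b x')) * c x' (p i).2)); last first.
  apply: (smooth_sum cX) => i _; apply: (smoothM cX); last first.
    by have [Fi pi] := Fp i; exact: sc.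
  apply: (cinfty_comp cX (f := fun z => 'D_(delta_mx ord0 i) Phi z)) => //.
  exact: smooth_near_derive.
have n1 : nbhs x [set y | forall i, (p i).1 (b y)].
  apply: near_forall => i; have [Fi pi] := Fp i.
  exact: (near_comp (sb.1 x) (initial_nbhs Fi pi)).
have crow : {for x, continuous (fun y => \row_i (p i).2 (b y))}.
  by apply: continuous_row => i; exact: (cinfty_cont cX (spb i)).
have n2 := near_comp crow (smooth_near_open sPhi).
have n3 := near_comp (sb.1 x) (nbhs_interior fE).
apply: near_impl (near_and n1 (near_and n2 n3)) => y [h1 [h2 h3]].
rewrite (initial_tangent_chain (tc y) (p := p) (Phi := Phi)) // => i.
by split; [case: (Fp i)|exact: h1].
Qed.
End FieldAlong.

Lemma pullback_diff (R : realType) (T : Type) (E : set (set T * (T -> R)))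
    (V : smoothSpace R) (pr : T -> V) (x : initial_space E) p :
  pullback pr p -> p.1 x ->
  exists2 f, smooth_at (pr x) f &
    forall u, u p.2 = diff_at (pr : initial_space E -> V) x u f.
Proof.
move=> [U [f [oU sf ->]]] /= Ux; exists f; first exact: sf.
by move=> u; rewrite /diff_at asboolT //; exact: sf.
Qed.

(** * Tangent vectors to fibred products and to fibres *)

Section FibredProduct.
Variables (R : realType) (X Y Z : smoothSpace R) (F : X -> Z) (G : Y -> Z).
Hypotheses (cX : cinfty X) (cY : cinfty Y).

Definition fst_fib (q : fibprod F G) : X := (sval q).1.
Definition snd_fib (q : fibprod F G) : Y := (sval q).2.

Lemma fst_fib_smooth : smooth_map fst_fib.
Proof. by apply: (pullback_smooth cX) => p; left. Qed.

Lemma snd_fib_smooth : smooth_map snd_fib.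
Proof. by apply: (pullback_smooth cY) => p; right. Qed.

Lemma smooth_fibprod (W : smoothSpace R) (P : W -> fibprod F G) : cinfty W ->
  smooth_map (fst_fib \o P) -> smooth_map (snd_fib \o P) -> smooth_map P.
Proof.
move=> cW s1 s2; apply: (smooth_initial cW) => p x [Fp|Fp].
- exact: (@pullback_into R _ X W fst_fib P p x s1 Fp).
- exact: (@pullback_into R _ Y W snd_fib P p x s2 Fp).
Qed.

Lemma fibprod_tangent_unique (p : fibprod F G) u u' : tangent p u -> tangent p u' ->
  diff_at fst_fib p u = diff_at fst_fib p u' ->
  diff_at snd_fib p u = diff_at snd_fib p u' -> u = u'.
Proof.
move=> tu tu' E1 E2; apply: (initial_tangent_unique tu tu') => q [Fq|Fq] qp.
- have [f sf H] := pullback_diff Fq qp; rewrite !H.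
  exact: (congr1 (fun v => v f) E1).
- have [f sf H] := pullback_diff Fq qp; rewrite !H.
  exact: (congr1 (fun v => v f) E2).
Qed.

(** A single curve with the prescribed component velocities settles the choice made by [xget]: its
    velocity has the right projections, and a tangent vector is determined by its projections. *)
Lemma fibprod_curve (p : fibprod F G) v w (P : R -> fibprod F G) :
  P 0 = p -> tangent (fst_fib p) v -> tangent (snd_fib p) w ->
  curve_at (fst_fib p) v (fst_fib \o P) -> curve_at (snd_fib p) w (snd_fib \o P) ->
  [/\ tangent p (tangent_pair p v w), curve_at p (tangent_pair p v w) P,
      diff_at fst_fib p (tangent_pair p v w) = v &
      diff_at snd_fib p (tangent_pair p v w) = w].
Proof.
move=> P0 tv tw c1 c2.
have [|tu cu] := @initial_curve R _ _ p P P0.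
  move=> q [|] [U [g [oU sg ->]]] /= Ug.
  - have [e1 cc dc] := c1; split.
      apply: (near_comp cc (P := U)); rewrite e1; exact: (open_nbhs_nbhs (conj oU Ug)).
    by have [] := dc _ (sg _ Ug).
  - have [e1 cc dc] := c2; split.
      apply: (near_comp cc (P := U)); rewrite e1; exact: (open_nbhs_nbhs (conj oU Ug)).
    by have [] := dc _ (sg _ Ug).
have d1 : diff_at fst_fib p (velocity p P) = v.
  apply: curve_unique (curve_push fst_fib_smooth cu) c1 _ => //.
    exact: (diff_at_tangent cX fst_fib_smooth).
  exact: near_all.
have d2 : diff_at snd_fib p (velocity p P) = w.
  apply: curve_unique (curve_push snd_fib_smooth cu) c2 _ => //.
    exact: (diff_at_tangent cY snd_fib_smooth).
  exact: near_all.
have -> : tangent_pair p v w = velocity p P; last by split.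
apply: xget_unique => // u [tu' e1 e2].
exact: (fibprod_tangent_unique tu' tu (etrans e1 (esym d1)) (etrans e2 (esym d2))).
Qed.

Lemma field_fibprod (W : smoothSpace R) (b : W -> fibprod F G) c c1 c2 : cinfty W ->
  smooth_map b -> (forall x, tangent (b x) (c x)) ->
  field_along (fst_fib \o b) c1 -> field_along (snd_fib \o b) c2 ->
  (forall x, diff_at fst_fib (b x) (c x) = c1 x) ->
  (forall x, diff_at snd_fib (b x) (c x) = c2 x) ->
  field_along b c.
Proof.
move=> cW sb tc f1 f2 E1 E2; apply: field_initial => // x q [|] [U [g [oU sg ->]]] /= Ug.
- apply: (cinfty_germ cW) (field_smooth f1 (sg _ Ug)).
  have n := near_comp ((field_base f1).1 x) (open_nbhs_nbhs (conj oU Ug)).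
  by apply: near_impl n => y Uy; rewrite -E1 /diff_at asboolT //; exact: sg.
- apply: (cinfty_germ cW) (field_smooth f2 (sg _ Ug)).
  have n := near_comp ((field_base f2).1 x) (open_nbhs_nbhs (conj oU Ug)).
  by apply: near_impl n => y Uy; rewrite -E2 /diff_at asboolT //; exact: sg.
Qed.
End FibredProduct.

Section Fibre.
Variables (R : realType) (X Y : smoothSpace R) (F : X -> Y) (y : Y).
Hypothesis cX : cinfty X.

Definition fibre_incl (b : fibre F y) : X := sval b.

Lemma fibre_incl_smooth : smooth_map fibre_incl.
Proof. by apply: (pullback_smooth cX). Qed.

Lemma fibre_curve (a : fibre F y) v (P : R -> fibre F y) : P 0 = a ->
  tangent (fibre_incl a) v -> curve_at (fibre_incl a) v (fibre_incl \o P) ->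
  tangent a (tangent_lift fibre_incl a v) /\
  curve_at a (tangent_lift fibre_incl a v) P.
Proof.
move=> P0 tv c1.
have [|tu cu] := @initial_curve R _ _ a P P0.
  move=> q [U [g [oU sg ->]]] /= Ug; have [e1 cc dc] := c1; split.
    apply: (near_comp cc (P := U)); rewrite e1; exact: (open_nbhs_nbhs (conj oU Ug)).
  by have [] := dc _ (sg _ Ug).
have d1 : diff_at fibre_incl a (velocity a P) = v.
  apply: curve_unique (curve_push fibre_incl_smooth cu) c1 _ => //.
    exact: (diff_at_tangent cX fibre_incl_smooth).
  exact: near_all.
have -> : tangent_lift fibre_incl a v = velocity a P; last by split.
apply: xget_unique => // u [tu' e1].
apply: (initial_tangent_unique tu' tu) => q Fq qa.
have [f sf H] := pullback_diff Fq qa; rewrite !H.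
exact: (congr1 (fun v => v f) (etrans e1 (esym d1))).
Qed.
End Fibre.

(** * The tangent groupoid *)

Lemma sig_ext (T : Type) (Q : T -> Prop) (a b : {x | Q x}) : sval a = sval b -> a = b.
Proof. by case: a b => a pa [b pb] /= ab; exact: eq_exist. Qed.

Lemma diff_at0 (R : realType) (X Y : smoothSpace R) (F : X -> Y) x :
  diff_at F x 0 = 0.
Proof. by apply/funext => f; rewrite /diff_at; case: asboolP. Qed.

Section PathInFibredProduct.
Variables (R : realType) (X Y Z : smoothSpace R) (F : X -> Z) (G : Y -> Z).
Hypotheses (cX : cinfty X) (cY : cinfty Y).

Lemma tangent_pair_curve (p : fibprod F G) v w (c : R -> X) (d : R -> Y) :
  tangent (sval p).1 v -> tangent (sval p).2 w ->
  curve_at (sval p).1 v c -> curve_at (sval p).2 w d ->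
  (\forall t \near (0 : R), F (c t) = G (d t)) ->
  exists P, [/\ \forall t \near (0 : R), sval (P t) = (c t, d t),
    curve_at p (tangent_pair p v w) P, tangent p (tangent_pair p v w),
    diff_at (@fst_fib R X Y Z F G) p (tangent_pair p v w) = v &
    diff_at (@snd_fib R X Y Z F G) p (tangent_pair p v w) = w].
Proof.
move=> tv tw cv dw Fcd.
(* Where the two curves fail to match, P takes the default value p; this happens only away from 0
   and leaves the velocity unaffected. *)
pose P t : fibprod F G := match pselect (F (c t) = G (d t)) with
  | left e => exist _ (c t, d t) e | right _ => p end.
have PE : \forall t \near (0 : R), sval (P t) = (c t, d t).
  by apply: near_impl Fcd => t e; rewrite /P; case: pselect.
have P0 : P 0 = p.
  apply: sig_ext; rewrite (nbhs_singleton PE).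
  by case: cv dw => -> _ _ [-> _ _]; case: (sval p).
have [||tp cp e1 e2] := fibprod_curve cX cY P0 tv tw.
- by apply: curve_near cv; apply: near_impl PE => t; rewrite /= /fst_fib => ->.
- by apply: curve_near dw; apply: near_impl PE => t; rewrite /= /snd_fib => ->.
- by exists P.
Qed.

(** Curves are needed for the two given pairs only. The combination of the resulting vectors is
    tangent and has the right projections, so it is the pair of the combinations. *)
Lemma tangent_pair_lin (p : fibprod F G) a v w v' w' :
  (exists c d, [/\ curve_at (sval p).1 v c, curve_at (sval p).2 w d &
                   \forall t \near (0 : R), F (c t) = G (d t)]) ->
  (exists c d, [/\ curve_at (sval p).1 v' c, curve_at (sval p).2 w' d &
                   \forall t \near (0 : R), F (c t) = G (d t)]) ->
  tangent (sval p).1 v -> tangent (sval p).2 w ->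
  tangent (sval p).1 v' -> tangent (sval p).2 w' ->
  tangent_pair p (a *: v + v') (a *: w + w') =
    a *: tangent_pair p v w + tangent_pair p v' w'.
Proof.
move=> [c [d [cv dw Fcd]]] [c' [d' [cv' dw' Fcd']]] tv tw tv' tw'.
have [_ [_ _ t1 e1 f1]] := tangent_pair_curve tv tw cv dw Fcd.
have [_ [_ _ t2 e2 f2]] := tangent_pair_curve tv' tw' cv' dw' Fcd'.
apply: xget_unique => [|u [tu eu fu]].
  split; first exact: tangent_lincomb.
  - by rewrite diff_at_lincomb; congr (_ *: _ + _).
  - by rewrite diff_at_lincomb; congr (_ *: _ + _).
apply: (fibprod_tangent_unique tu); first exact: tangent_lincomb.
- by rewrite diff_at_lincomb e1 e2 -eu.
- by rewrite diff_at_lincomb f1 f2 -fu.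
Qed.
End PathInFibredProduct.

Section GroupoidAlgebra.
Variables (R : realType) (G : lieGroupoid R).
Implicit Types g h k : arr G.

Lemma mulgKV g h : src g = src h -> gmul (gmul g (ginv h)) h = g.
Proof.
by move=> e; rewrite -mul_assoc ?tgt_inv ?src_inv // mul_invl -e mul_unitr.
Qed.

Lemma mulVKg g h : tgt g = tgt h -> gmul g (gmul (ginv g) h) = h.
Proof.
by move=> e; rewrite mul_assoc ?tgt_inv ?src_inv // mul_invr e mul_unitl.
Qed.

Lemma mulKg g h : src g = tgt h -> gmul (ginv g) (gmul g h) = h.
Proof. by move=> e; rewrite mul_assoc ?src_inv // mul_invl e mul_unitl. Qed.

Lemma mulgK g h : src g = tgt h -> gmul (gmul g h) (ginv h) = g.
Proof. by move=> e; rewrite -mul_assoc ?tgt_inv // mul_invr -e mul_unitr. Qed.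

Lemma ginv_unique g h : src g = tgt h -> gmul g h = ident (tgt g) -> h = ginv g.
Proof.
move=> e E; rewrite -[LHS](mulKg e) E.
by have := mul_unitr (ginv g); rewrite src_inv.
Qed.

Lemma ginvK g : ginv (ginv g) = g.
Proof. by apply/esym/ginv_unique; rewrite ?src_inv // mul_invl tgt_inv. Qed.

Lemma ginv_ident (x : obj G) : ginv (ident x) = ident x.
Proof.
apply/esym/ginv_unique; rewrite ?src_unit ?tgt_unit //.
by have := mul_unitl (ident x); rewrite tgt_unit.
Qed.

Lemma ginvM g h : src g = tgt h -> ginv (gmul g h) = gmul (ginv h) (ginv g).
Proof.
move=> e; have e' : src (ginv h) = tgt (ginv g) by rewrite src_inv tgt_inv.
apply/esym/ginv_unique; first by rewrite src_mul // tgt_mul // tgt_inv.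
rewrite -mul_assoc ?tgt_mul ?tgt_inv //.
by rewrite mulVKg ?tgt_inv // mul_invr.
by rewrite src_inv.
Qed.

Lemma arr_cinfty : cinfty (arr G).
Proof. exact: manifold_cinfty (arr_manifold G). Qed.

Lemma obj_cinfty : cinfty (obj G).
Proof. exact: manifold_cinfty (obj_manifold G). Qed.

Lemma src_smooth : smooth_map (@src R G).
Proof. by case: (src_submersion G). Qed.

Lemma tgt_smooth : smooth_map (@tgt R G).
Proof. by case: (tgt_submersion G). Qed.
End GroupoidAlgebra.

Section TangentGroupoid.
Variables (R : realType) (G : lieGroupoid R).
Implicit Types (g h : arr G) (v w : vec (arr G)).
Let cA := arr_cinfty G.
Let cO := obj_cinfty G.

Lemma dsrc_tangent g v : tangent g v -> tangent (src g) (diff_at src g v).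
Proof. exact: (diff_at_tangent cO (src_smooth G)). Qed.

Lemma dtgt_tangent g v : tangent g v -> tangent (tgt g) (diff_at tgt g v).
Proof. exact: (diff_at_tangent cO (tgt_smooth G)). Qed.

Lemma dinv_tangent g v : tangent g v -> tangent (ginv g) (diff_at ginv g v).
Proof. exact: (diff_at_tangent cA (inv_smooth G)). Qed.

Lemma dident_tangent (x : obj G) (u : vec (obj G)) :
  tangent x u -> tangent (ident x) (diff_at ident x u).
Proof. exact: (diff_at_tangent cA (unit_smooth G)). Qed.

Lemma arr_curve g v : tangent g v -> exists c, curve_at g v c.
Proof. exact: tangent_curve (arr_manifold G). Qed.

Lemma src_lift g v z : tangent g v -> curve_at (src g) (diff_at src g v) z ->
  exists2 c, curve_at g v c & \forall t \near (0 : R), src (c t) = z t.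
Proof. exact: (submersion_lift (arr_manifold G) (obj_manifold G) (src_submersion G)). Qed.

Lemma curve_cst (X : smoothSpace R) (x : X) : curve_at x 0 (fun _ : R => x).
Proof.
split => //; first exact: cst_continuous.
by move=> f _; apply: is_derive_cst.
Qed.

(** Multiplication in the tangent groupoid. A point of the fibred product contains a proof of
    composability, hence the case distinction and the default value 0. *)
Definition dmul g h v w : vec (arr G) :=
  match pselect (src g = tgt h) with
  | left e =>
      let p : fibprod (@src R G) (@tgt R G) := exist _ (g, h) e in
      diff_at (fun p : fibprod (@src R G) (@tgt R G) => gmul (sval p).1 (sval p).2) p
        (tangent_pair p v w)
  | right _ => 0
  end.

Lemma dmul_curve g h v w (c d : R -> arr G) : tangent g v -> tangent h w ->
  curve_at g v c -> curve_at h w d ->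
  (\forall t \near (0 : R), src (c t) = tgt (d t)) ->
  tangent (gmul g h) (dmul g h v w) /\
  curve_at (gmul g h) (dmul g h v w) (fun t => gmul (c t) (d t)).
Proof.
move=> tv tw cv dw cd; rewrite /dmul; case: pselect => [e|]; last first.
  by have := nbhs_singleton cd; case: cv dw => -> _ _ [-> _ _].
set p : fibprod _ _ := exist _ (g, h) e.
have [P [PE cP tP _ _]] := @tangent_pair_curve _ _ _ _ _ _ cA cA p _ _ _ _ tv tw cv dw cd.
split; first exact: (diff_at_tangent cA (mul_smooth G) tP).
apply: curve_near (curve_push (mul_smooth G) cP).
by apply: near_impl PE => t /= ->.
Qed.

(** Any curve d with velocity w will do: [tgt \o d] has velocity ds v and lifts through the
    submersion src to a curve with velocity v. *)
Lemma dmul_paths g h v w : src g = tgt h -> tangent g v -> tangent h w ->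
  diff_at src g v = diff_at tgt h w ->
  exists c d, [/\ curve_at g v c, curve_at h w d &
                  \forall t \near (0 : R), src (c t) = tgt (d t)].
Proof.
move=> e tv tw E; have [d dw] := arr_curve tw.
have := curve_push (tgt_smooth G) dw; rewrite -E -e => dt.
by have [c cv sc] := src_lift tv dt; exists c, d.
Qed.

Lemma dmul_tangent g h v w : src g = tgt h -> tangent g v -> tangent h w ->
  diff_at src g v = diff_at tgt h w -> tangent (gmul g h) (dmul g h v w).
Proof.
move=> e tv tw E; have [c [d [cv dw cd]]] := dmul_paths e tv tw E.
by have [] := dmul_curve tv tw cv dw cd.
Qed.

Lemma dsrc_mul g h v w : src g = tgt h -> tangent g v -> tangent h w ->
  diff_at src g v = diff_at tgt h w ->
  diff_at src (gmul g h) (dmul g h v w) = diff_at src h w.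
Proof.
move=> e tv tw E; have [c [d [cv dw cd]]] := dmul_paths e tv tw E.
have [tm cm] := dmul_curve tv tw cv dw cd.
have := curve_push (src_smooth G) cm; have := dsrc_tangent tm; rewrite src_mul //.
move=> t1 c1; apply: curve_unique t1 (dsrc_tangent tw) c1 (curve_push (src_smooth G) dw) _.
by apply: near_impl cd => t et /=; rewrite src_mul.
Qed.

Lemma dtgt_mul g h v w : src g = tgt h -> tangent g v -> tangent h w ->
  diff_at src g v = diff_at tgt h w ->
  diff_at tgt (gmul g h) (dmul g h v w) = diff_at tgt g v.
Proof.
move=> e tv tw E; have [c [d [cv dw cd]]] := dmul_paths e tv tw E.
have [tm cm] := dmul_curve tv tw cv dw cd.
have := curve_push (tgt_smooth G) cm; have := dtgt_tangent tm; rewrite tgt_mul //.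
move=> t1 c1; apply: curve_unique t1 (dtgt_tangent tv) c1 (curve_push (tgt_smooth G) cv) _.
by apply: near_impl cd => t et /=; rewrite tgt_mul.
Qed.

Lemma dsrc_inv g v : tangent g v ->
  diff_at src (ginv g) (diff_at ginv g v) = diff_at tgt g v.
Proof.
move=> tv; have [c cv] := arr_curve tv.
have ci := curve_push (src_smooth G) (curve_push (inv_smooth G) cv).
have ti := dsrc_tangent (dinv_tangent tv); rewrite src_inv in ci ti.
apply: curve_unique ti (dtgt_tangent tv) ci (curve_push (tgt_smooth G) cv) _.
by apply: near_all => t /=; rewrite src_inv.
Qed.

Lemma dtgt_inv g v : tangent g v ->
  diff_at tgt (ginv g) (diff_at ginv g v) = diff_at src g v.
Proof.
move=> tv; have [c cv] := arr_curve tv.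
have ci := curve_push (tgt_smooth G) (curve_push (inv_smooth G) cv).
have ti := dtgt_tangent (dinv_tangent tv); rewrite tgt_inv in ci ti.
apply: curve_unique ti (dsrc_tangent tv) ci (curve_push (src_smooth G) cv) _.
by apply: near_all => t /=; rewrite tgt_inv.
Qed.

Lemma dsrc_ident (x : obj G) u : tangent x u ->
  diff_at src (ident x) (diff_at ident x u) = u.
Proof.
move=> tu; have [c cu] := tangent_curve (obj_manifold G) tu.
have ci := curve_push (src_smooth G) (curve_push (unit_smooth G) cu).
have ti := dsrc_tangent (dident_tangent tu); rewrite src_unit in ci ti.
apply: (curve_unique ti tu ci cu).
by apply: near_all => t /=; rewrite src_unit.
Qed.

Lemma dtgt_ident (x : obj G) u : tangent x u ->
  diff_at tgt (ident x) (diff_at ident x u) = u.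
Proof.
move=> tu; have [c cu] := tangent_curve (obj_manifold G) tu.
have ci := curve_push (tgt_smooth G) (curve_push (unit_smooth G) cu).
have ti := dtgt_tangent (dident_tangent tu); rewrite tgt_unit in ci ti.
apply: (curve_unique ti tu ci cu).
by apply: near_all => t /=; rewrite tgt_unit.
Qed.

Lemma dinv_ident (x : obj G) u : tangent x u ->
  diff_at ginv (ident x) (diff_at ident x u) = diff_at ident x u.
Proof.
move=> tu; have [c cu] := tangent_curve (obj_manifold G) tu.
have c1 := curve_push (unit_smooth G) cu.
have ci := curve_push (inv_smooth G) c1.
have ti := dinv_tangent (dident_tangent tu); rewrite ginv_ident in ci ti.
apply: (curve_unique ti (dident_tangent tu) ci c1).
by apply: near_all => t /=; rewrite ginv_ident.
Qed.

Lemma dmul_identl g v : tangent g v ->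
  dmul (ident (tgt g)) g (diff_at ident (tgt g) (diff_at tgt g v)) v = v.
Proof.
move=> tv; have [c cv] := arr_curve tv.
have ct := curve_push (unit_smooth G) (curve_push (tgt_smooth G) cv).
have tt := dident_tangent (dtgt_tangent tv).
have [|tm cm] := dmul_curve tt tv ct cv; first by apply: near_all => t /=; rewrite src_unit.
rewrite mul_unitl in tm cm; apply: (curve_unique tm tv cm cv).
by apply: near_all => t /=; rewrite mul_unitl.
Qed.

Lemma dmul_identr g v : tangent g v ->
  dmul g (ident (src g)) v (diff_at ident (src g) (diff_at src g v)) = v.
Proof.
move=> tv; have [c cv] := arr_curve tv.
have ct := curve_push (unit_smooth G) (curve_push (src_smooth G) cv).
have tt := dident_tangent (dsrc_tangent tv).
have [|tm cm] := dmul_curve tv tt cv ct; first by apply: near_all => t /=; rewrite tgt_unit.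
rewrite mul_unitr in tm cm; apply: (curve_unique tm tv cm cv).
by apply: near_all => t /=; rewrite mul_unitr.
Qed.

Lemma dmul_lin g h a v w v' w' : src g = tgt h ->
  tangent g v -> tangent h w -> tangent g v' -> tangent h w' ->
  diff_at src g v = diff_at tgt h w -> diff_at src g v' = diff_at tgt h w' ->
  dmul g h (a *: v + v') (a *: w + w') = a *: dmul g h v w + dmul g h v' w'.
Proof.
move=> e tv tw tv' tw' E E'; rewrite /dmul; case: pselect => // e'.
rewrite -diff_at_lincomb; congr diff_at.
by apply: (tangent_pair_lin cA cA a (p := exist _ (g, h) e')) => //=; exact: dmul_paths.
Qed.

Let sFib := fibprod (@src R G) (@src R G).

Lemma mbar_smooth : smooth_map (@mbar R G).
Proof.
have e (q : sFib) : src (sval q).1 = tgt (ginv (sval q).2).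
  by rewrite tgt_inv; exact: (svalP q).
pose J (q : sFib) : fibprod (@src R G) (@tgt R G) := exist _ ((sval q).1, ginv (sval q).2) (e q).
have sJ : smooth_map J.
  apply: smooth_fibprod; first exact: initial_cinfty.
    exact: (@fst_fib_smooth R _ _ _ (@src R G) (@src R G) cA).
  exact: (smooth_map_comp (@snd_fib_smooth R _ _ _ (@src R G) (@src R G) cA) (inv_smooth G)).
exact: (smooth_map_comp sJ (mul_smooth G)).
Qed.

Lemma dmbar_curve (p : sFib) v w (c d : R -> arr G) :
  tangent (sval p).1 v -> tangent (sval p).2 w ->
  curve_at (sval p).1 v c -> curve_at (sval p).2 w d ->
  (\forall t \near (0 : R), src (c t) = src (d t)) ->
  tangent (mbar p) (dmbar p v w) /\
  curve_at (mbar p) (dmbar p v w) (fun t => gmul (c t) (ginv (d t))).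
Proof.
move=> tv tw cv dw cd.
have [P [PE cP tP _ _]] := @tangent_pair_curve _ _ _ _ _ _ cA cA p _ _ _ _ tv tw cv dw cd.
split; first exact: (diff_at_tangent cA mbar_smooth tP).
apply: curve_near (curve_push mbar_smooth cP).
by apply: near_impl PE => t /= E; rewrite /mbar E.
Qed.

Lemma dmbar_paths (p : sFib) v w : tangent (sval p).1 v -> tangent (sval p).2 w ->
  diff_at src (sval p).1 v = diff_at src (sval p).2 w ->
  exists c d, [/\ curve_at (sval p).1 v c, curve_at (sval p).2 w d &
                  \forall t \near (0 : R), src (c t) = src (d t)].
Proof.
move=> tv tw E; have [d dw] := arr_curve tw.
have := curve_push (src_smooth G) dw; rewrite -E -(svalP p) => dt.
by have [c cv sc] := src_lift tv dt; exists c, d.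
Qed.

(** Places the leading term of the differential of the deformation complex inside the tangent
    groupoid, where sources and targets of products are known. *)
Lemma dmbarE (p : sFib) v w : tangent (sval p).1 v -> tangent (sval p).2 w ->
  diff_at src (sval p).1 v = diff_at src (sval p).2 w ->
  dmbar p v w = dmul (sval p).1 (ginv (sval p).2) v (diff_at ginv (sval p).2 w).
Proof.
move=> tv tw E; have [c [d [cv dw cd]]] := dmbar_paths tv tw E.
have [t1 c1] := dmbar_curve tv tw cv dw cd.
have [|t2 c2] := dmul_curve tv (dinv_tangent tw) cv (curve_push (inv_smooth G) dw).
  by apply: near_impl cd => t /=; rewrite tgt_inv.
by apply: (curve_unique t1 t2 c1 c2); exact: near_all.
Qed.

(* The right translate r_g(a) of a vector a tangent to the source fibre. *)
Definition rvec g v := dmul (ident (tgt g)) g v 0.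

(* r_g(a) + l_g(di(b)). *)
Definition bivec g v w := dmul g (ident (src g)) (rvec g v) (diff_at ginv (ident (src g)) w).

(** A vector with zero source is the velocity of a curve inside the source fibre, obtained by
    lifting the constant curve. On the fibres the translations [rtrans] and [ltrans] make sense. *)
Lemma vertical_curve (x : obj G) v : tangent (ident x) v -> diff_at src (ident x) v = 0 ->
  exists2 a, curve_at (ident x) v a & \forall t \near (0 : R), src (a t) = x.
Proof.
move=> tv sv; apply: src_lift => //.
by rewrite sv src_unit; exact: curve_cst.
Qed.

Lemma rvec_curve g v a : tangent (ident (tgt g)) v ->
  curve_at (ident (tgt g)) v a -> (\forall t \near (0 : R), src (a t) = tgt g) ->
  tangent g (rvec g v) /\ curve_at g (rvec g v) (fun t => gmul (a t) g).
Proof.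
move=> tv ca sa.
have := dmul_curve tv (tangent0 g) ca (curve_cst g) sa.
by rewrite mul_unitl.
Qed.

Lemma bivec_curve g v w a b : tangent (ident (tgt g)) v -> tangent (ident (src g)) w ->
  curve_at (ident (tgt g)) v a -> curve_at (ident (src g)) w b ->
  (\forall t \near (0 : R), src (a t) = tgt g) ->
  (\forall t \near (0 : R), src (b t) = src g) ->
  tangent g (bivec g v w) /\ curve_at g (bivec g v w) (fun t => gmul (gmul (a t) g) (ginv (b t))).
Proof.
move=> tv tw ca cb sa sb; have [tr cr] := rvec_curve tv ca sa.
have ti := dinv_tangent tw; have ci := curve_push (inv_smooth G) cb.
rewrite ginv_ident in ti ci.
have := dmul_curve tr ti cr ci; rewrite mul_unitr; apply.
by apply: near_impl (near_and sa sb) => t [et es] /=; rewrite src_mul // tgt_inv.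
Qed.

Lemma rvec_lin g a v w : tangent (ident (tgt g)) v -> tangent (ident (tgt g)) w ->
  diff_at src (ident (tgt g)) v = 0 -> diff_at src (ident (tgt g)) w = 0 ->
  rvec g (a *: v + w) = a *: rvec g v + rvec g w.
Proof.
move=> tv tw sv sw; rewrite /rvec -dmul_lin ?src_unit ?diff_at0 //; try exact: tangent0.
by rewrite scaler0 addr0.
Qed.

Lemma dsrc_rvec g v : tangent (ident (tgt g)) v -> diff_at src (ident (tgt g)) v = 0 ->
  diff_at src g (rvec g v) = 0.
Proof.
move=> tv sv; rewrite /rvec -{1}(mul_unitl g) dsrc_mul ?src_unit ?diff_at0 //.
exact: tangent0.
Qed.

(** Both sides are velocities of [a t] times g for a curve a in the source fibre, on the left
    through the fibre, on the right through the fibred product with the constant curve g. *)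
Lemma rtransE g x v : x = tgt g -> tangent (ident x) v -> diff_at src (ident x) v = 0 ->
  rtrans g (ident x) v = rvec g v.
Proof.
move=> -> tv sv; have [a ca sa] := vertical_curve tv sv.
set x0 := tgt g in tv sv ca sa *.
have sa' : \forall t \near (0 : R), src (a t) = src (ident x0).
  by apply: near_impl sa => t; rewrite src_unit.
pose a' : fibre (@src R G) (src (ident x0)) := exist _ (ident x0) erefl.
pose P t : fibre (@src R G) (src (ident x0)) :=
  match pselect (src (a t) = src (ident x0)) with
  | left e => exist _ (a t) e | right _ => a' end.
have PE : \forall t \near (0 : R), sval (P t) = a t.
  by apply: near_impl sa' => t e; rewrite /P; case: pselect.
have P0 : P 0 = a'.
  by apply: sig_ext; rewrite (nbhs_singleton PE); case: ca.
have [|tl cl] := fibre_curve cA P0 tv.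
  by apply: curve_near ca; apply: near_impl PE => t /=; rewrite /fibre_incl => ->.
pose F (b : fibre (@src R G) (src (ident x0))) : arr G := gmul (sval b) g.
have sF : smooth_map F.
  have e (b : fibre (@src R G) (src (ident x0))) : src (sval b) = tgt g.
    by rewrite (svalP b) src_unit.
  pose J (b : fibre (@src R G) (src (ident x0))) : fibprod (@src R G) (@tgt R G) := exist _ (sval b, g) (e b).
  have sJ : smooth_map J.
    apply: smooth_fibprod; first exact: initial_cinfty.
      exact: (@fibre_incl_smooth R _ _ (@src R G) (src (ident x0)) cA).
    apply: smooth_map_cst; exact: initial_cinfty.
  exact: (smooth_map_comp sJ (mul_smooth G)).
have [tr cr] := rvec_curve tv ca sa.
have tF := diff_at_tangent cA sF tl; have cF := curve_push sF cl.
have Fa' : F a' = g by rewrite /F /a' /= mul_unitl.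
rewrite Fa' in tF cF.
apply: (curve_unique tF tr cF cr).
by apply: near_impl PE => t /= E; rewrite /F E.
Qed.

Lemma bivecE g y v w : tangent (ident (tgt g)) v -> y = src g -> tangent (ident y) w ->
  diff_at src (ident (tgt g)) v = 0 -> diff_at src (ident y) w = 0 ->
  rvec g v + ltrans g (ident y) (diff_at ginv (ident y) w) = bivec g v w.
Proof.
move=> tv -> tw sv sw; have [b cb sb] := vertical_curve tw sw.
set y0 := src g in tw sw cb sb *.
have tiw := dinv_tangent tw; have ciw := curve_push (inv_smooth G) cb.
rewrite ginv_ident in tiw ciw; set w' := diff_at ginv (ident y0) w in tiw ciw *.
have sa' : \forall t \near (0 : R), tgt (ginv (b t)) = tgt (ident y0).
  by apply: near_impl sb => t; rewrite tgt_unit tgt_inv.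
pose a' : fibre (@tgt R G) (tgt (ident y0)) := exist _ (ident y0) erefl.
pose P t : fibre (@tgt R G) (tgt (ident y0)) :=
  match pselect (tgt (ginv (b t)) = tgt (ident y0)) with
  | left e => exist _ (ginv (b t)) e | right _ => a' end.
have PE : \forall t \near (0 : R), sval (P t) = ginv (b t).
  by apply: near_impl sa' => t e; rewrite /P; case: pselect.
have P0 : P 0 = a'.
  by apply: sig_ext; rewrite (nbhs_singleton PE); case: ciw.
have [|tl cl] := fibre_curve cA P0 tiw.
  by apply: curve_near ciw; apply: near_impl PE => t /=; rewrite /fibre_incl => ->.
pose F (b : fibre (@tgt R G) (tgt (ident y0))) : arr G := gmul g (sval b).
have sF : smooth_map F.
  have e (q : fibre (@tgt R G) (tgt (ident y0))) : src g = tgt (sval q).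
    by rewrite (svalP q) tgt_unit.
  pose J (q : fibre (@tgt R G) (tgt (ident y0))) : fibprod (@src R G) (@tgt R G) := exist _ (g, sval q) (e q).
  have sJ : smooth_map J.
    apply: smooth_fibprod; first exact: initial_cinfty.
      apply: smooth_map_cst; exact: initial_cinfty.
    exact: (@fibre_incl_smooth R _ _ (@tgt R G) (tgt (ident y0)) cA).
  exact: (smooth_map_comp sJ (mul_smooth G)).
have tF := diff_at_tangent cA sF tl; have cF := curve_push sF cl.
have Fa' : F a' = g by rewrite /F /a' /= mul_unitr.
rewrite Fa' in tF cF.
have e0 : src g = tgt (ident y0) by rewrite tgt_unit.
have [|tm cm] := dmul_curve (tangent0 g) tiw (curve_cst g) ciw.
  by apply: near_impl sa' => t /= ->.
rewrite mul_unitr in tm cm.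
(* Left translation, too, is multiplication by a zero vector in the tangent groupoid. *)
have -> : ltrans g (ident y0) w' = dmul g (ident y0) 0 w'.
  apply: (curve_unique tF tm cF cm).
  by apply: near_impl PE => t /= E; rewrite /F E.
have [a ca sa] := vertical_curve tv sv.
have [tr _] := rvec_curve tv ca sa.
have sr := dsrc_rvec tv sv.
have tw0 : diff_at tgt (ident y0) w' = 0.
  by have := dtgt_inv tw; rewrite ginv_ident -/w' => ->.
have t0 x := tangent0 (x : arr G).
(* The pairs (r_g v, 0) and (0, w') are composable separately, since ds (r_g v) and dt w' both
   vanish; by linearity their products add up to the product of r_g v and w'. *)
have := @dmul_lin g (ident y0) 1 (rvec g v) 0 0 w' e0 tr (t0 _) (t0 _) tiw.
rewrite sr tw0 !diff_at0 !scale1r addr0 add0r => /(_ erefl erefl) E.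
rewrite /bivec -/y0 -/w' E; congr (_ + _).
by have := dmul_identr tr; rewrite sr diff_at0.
Qed.
End TangentGroupoid.

(** * Conjugation by a natural isomorphism *)

Lemma field_eq (R : realType) (X Y : smoothSpace R) (b b' : X -> Y) c c' :
  b =1 b' -> c =1 c' -> field_along b c -> field_along b' c'.
Proof. by move=> /funext -> /funext ->. Qed.

(** Smoothness is checked in the fibred product, where the two components decide, and then pushed
    forward along the multiplication. *)
Lemma field_dmul (R : realType) (G : lieGroupoid R) (W : smoothSpace R)
    (b1 b2 : W -> arr G) c1 c2 : cinfty W ->
  field_along b1 c1 -> field_along b2 c2 ->
  (forall x, src (b1 x) = tgt (b2 x)) ->
  (forall x, diff_at src (b1 x) (c1 x) = diff_at tgt (b2 x) (c2 x)) ->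
  field_along (fun x => gmul (b1 x) (b2 x)) (fun x => dmul (b1 x) (b2 x) (c1 x) (c2 x)).
Proof.
move=> cW f1 f2 e E; have cA := arr_cinfty G.
pose B x : fibprod (@src R G) (@tgt R G) := exist _ (b1 x, b2 x) (e x).
have H x : [/\ tangent (B x) (tangent_pair (B x) (c1 x) (c2 x)),
    diff_at (@fst_fib R _ _ _ (@src R G) (@tgt R G)) (B x)
      (tangent_pair (B x) (c1 x) (c2 x)) = c1 x &
    diff_at (@snd_fib R _ _ _ (@src R G) (@tgt R G)) (B x)
      (tangent_pair (B x) (c1 x) (c2 x)) = c2 x].
  have t1 := field_tangent f1 x; have t2 := field_tangent f2 x.
  have [c [d [cv dw cd]]] := dmul_paths (e x) t1 t2 (E x).
  have [P [_ _ tp e1 e2]] :=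
    @tangent_pair_curve _ _ _ _ _ _ cA cA (B x) _ _ _ _ t1 t2 cv dw cd.
  by split.
have sB : smooth_map B.
  by apply: smooth_fibprod => //; [exact: field_base f1|exact: field_base f2].
have fB : field_along B (fun x => tangent_pair (B x) (c1 x) (c2 x)).
  apply: (field_fibprod cW sB _ f1 f2) => x; by have [] := H x.
apply: field_eq (field_push cW cA (mul_smooth G) fB) => // x.
by rewrite /dmul; case: pselect => // e'; rewrite (Prop_irrelevance e' (e x)).
Qed.

Section Morphisms.
Variables (R : realType) (H G : lieGroupoid R) (Phi : morphism H G).

Lemma mor_ident (x : obj H) : Phi (ident x) = ident (mor_obj Phi x).
Proof.
have e : src (Phi (ident x)) = tgt (Phi (ident x)).
  by rewrite mor_src mor_tgt src_unit tgt_unit.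
have E : gmul (Phi (ident x)) (Phi (ident x)) = Phi (ident x).
  rewrite -mor_mul ?src_unit ?tgt_unit //; congr (Phi _).
  by have := mul_unitl (ident x); rewrite tgt_unit.
by rewrite -(mulKg e) E mul_invl mor_src src_unit.
Qed.
End Morphisms.

(* sigma lifts the vectors tangent to the base at phi x, linearly, to vectors
   tangent to G at tau x with the same source. *)
Record lift_along (R : realType) (N : smoothSpace R) (G : lieGroupoid R)
    (phi : N -> obj G) (tau : N -> arr G) (sigma : N -> vec (obj G) -> vec (arr G)) :
    Prop := LiftAlong {
  lift_src : forall x, src (tau x) = phi x;
  lift_tangent : forall x u, tangent (phi x) u -> tangent (tau x) (sigma x u);
  lift_lin : forall x a u w, tangent (phi x) u -> tangent (phi x) w ->
    sigma x (a *: u + w) = a *: sigma x u + sigma x w;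
  lift_dsrc : forall x u, tangent (phi x) u -> diff_at src (tau x) (sigma x u) = u;
  lift_field : forall (X : smoothSpace R) (a : X -> N) c, cinfty X -> smooth_map a ->
    field_along (phi \o a) c -> field_along (tau \o a) (fun x => sigma (a x) (c x))
}.

Section Conjugation.
Variables (R : realType) (H G : lieGroupoid R) (Phi Psi : morphism H G).
Variables (tau : obj H -> arr G) (sigma : obj H -> vec (obj G) -> vec (arr G)).
Hypothesis lf : lift_along (mor_obj Phi) tau sigma.
Hypothesis PsiE : forall h, Psi h = gmul (gmul (tau (tgt h)) (Phi h)) (ginv (tau (src h))).
Implicit Types h : arr H.

Lemma tau_src_tgt h : src (tau (tgt h)) = tgt (Phi h).
Proof. by rewrite (lift_src lf) mor_tgt. Qed.

Lemma tau_src_src h : src (gmul (tau (tgt h)) (Phi h)) = tgt (ginv (tau (src h))).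
Proof. by rewrite src_mul ?tau_src_tgt // tgt_inv (lift_src lf) mor_src. Qed.

Lemma tau_tgt x : tgt (tau x) = mor_obj Psi x.
Proof.
rewrite -[in RHS](tgt_unit x) -mor_tgt PsiE tgt_mul ?tgt_mul ?tgt_unit //.
  by have := tau_src_tgt (ident x); rewrite tgt_unit.
by have := tau_src_src (ident x); rewrite tgt_unit.
Qed.

(** The map that conjugation induces on the base of the tangent groupoid, from the tangent space at
    phi x to the one at psi x, as [dtgt_conj] and [dsrc_conj] show. *)
Definition anchor_lift (x : obj H) (u : vec (obj G)) : vec (obj G) :=
  diff_at tgt (tau x) (sigma x u).

(* Conjugation by sigma in the tangent groupoid:
   v |-> sigma(dt v) . v . sigma(ds v)^-1. *)
Definition conj_vec h (v : vec (arr G)) : vec (arr G) :=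
  dmul (gmul (tau (tgt h)) (Phi h)) (ginv (tau (src h)))
    (dmul (tau (tgt h)) (Phi h) (sigma (tgt h) (diff_at tgt (Phi h) v)) v)
    (diff_at ginv (tau (src h)) (sigma (src h) (diff_at src (Phi h) v))).

Lemma sigma_tgt h v : tangent (Phi h) v ->
  tangent (tau (tgt h)) (sigma (tgt h) (diff_at tgt (Phi h) v)) /\
  diff_at src (tau (tgt h)) (sigma (tgt h) (diff_at tgt (Phi h) v)) = diff_at tgt (Phi h) v.
Proof.
move=> tv; have := dtgt_tangent tv; rewrite mor_tgt => t1.
by split; [exact: (lift_tangent lf)|exact: (lift_dsrc lf)].
Qed.

Lemma sigma_src h v : tangent (Phi h) v ->
  tangent (tau (src h)) (sigma (src h) (diff_at src (Phi h) v)) /\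
  diff_at src (tau (src h)) (sigma (src h) (diff_at src (Phi h) v)) = diff_at src (Phi h) v.
Proof.
move=> tv; have := dsrc_tangent tv; rewrite mor_src => t1.
by split; [exact: (lift_tangent lf)|exact: (lift_dsrc lf)].
Qed.

Lemma sigma_curve x u z : tangent (mor_obj Phi x) u -> curve_at (mor_obj Phi x) u z ->
  exists2 al, curve_at (tau x) (sigma x u) al & \forall t \near (0 : R), src (al t) = z t.
Proof.
move=> tu cu; apply: src_lift; first exact: (lift_tangent lf).
by rewrite (lift_dsrc lf) // (lift_src lf).
Qed.

Lemma sigma_tgt_curve h v c : tangent (Phi h) v -> curve_at (Phi h) v c ->
  exists2 al, curve_at (tau (tgt h)) (sigma (tgt h) (diff_at tgt (Phi h) v)) al &
    \forall t \near (0 : R), src (al t) = tgt (c t).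
Proof.
move=> tv cv; have := curve_push (tgt_smooth G) cv; have := dtgt_tangent tv.
by rewrite mor_tgt; exact: sigma_curve.
Qed.

Lemma sigma_src_curve h v c : tangent (Phi h) v -> curve_at (Phi h) v c ->
  exists2 be, curve_at (tau (src h)) (sigma (src h) (diff_at src (Phi h) v)) be &
    \forall t \near (0 : R), src (be t) = src (c t).
Proof.
move=> tv cv; have := curve_push (src_smooth G) cv; have := dsrc_tangent tv.
by rewrite mor_src; exact: sigma_curve.
Qed.

Lemma conj_curve h v c al be : tangent (Phi h) v -> curve_at (Phi h) v c ->
  curve_at (tau (tgt h)) (sigma (tgt h) (diff_at tgt (Phi h) v)) al ->
  curve_at (tau (src h)) (sigma (src h) (diff_at src (Phi h) v)) be ->
  (\forall t \near (0 : R), src (al t) = tgt (c t)) ->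
  (\forall t \near (0 : R), src (be t) = src (c t)) ->
  tangent (Psi h) (conj_vec h v) /\
  curve_at (Psi h) (conj_vec h v) (fun t => gmul (gmul (al t) (c t)) (ginv (be t))).
Proof.
move=> tv cv cal cbe nal nbe; have [ta _] := sigma_tgt tv; have [tb _] := sigma_src tv.
have [t1 c1] := dmul_curve ta tv cal cv nal.
have := dmul_curve t1 (dinv_tangent tb) c1 (curve_push (inv_smooth G) cbe).
rewrite -PsiE; apply.
by apply: near_impl (near_and nal nbe) => t [e1 e2] /=; rewrite src_mul // tgt_inv.
Qed.

Lemma conj_path h v : tangent (Phi h) v -> exists c al be,
  [/\ curve_at (Phi h) v c,
      curve_at (tau (tgt h)) (sigma (tgt h) (diff_at tgt (Phi h) v)) al /\
      curve_at (tau (src h)) (sigma (src h) (diff_at src (Phi h) v)) be,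
      \forall t \near (0 : R), src (al t) = tgt (c t) &
      \forall t \near (0 : R), src (be t) = src (c t)].
Proof.
move=> tv; have [c cv] := arr_curve tv.
have [al ca na] := sigma_tgt_curve tv cv; have [be cb nb] := sigma_src_curve tv cv.
by exists c, al, be.
Qed.

Lemma dtgt_conj h v : tangent (Phi h) v ->
  diff_at tgt (Psi h) (conj_vec h v) = anchor_lift (tgt h) (diff_at tgt (Phi h) v).
Proof.
move=> tv; have [ta ea] := sigma_tgt tv; have [tb eb] := sigma_src tv.
have tm := dmul_tangent (tau_src_tgt h) ta tv ea.
rewrite PsiE /conj_vec dtgt_mul ?tau_src_src //; last 2 first.
- exact: dinv_tangent.
- by rewrite dsrc_mul ?tau_src_tgt // dtgt_inv.
by rewrite dtgt_mul ?tau_src_tgt.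
Qed.

Lemma dsrc_conj h v : tangent (Phi h) v ->
  diff_at src (Psi h) (conj_vec h v) = anchor_lift (src h) (diff_at src (Phi h) v).
Proof.
move=> tv; have [ta ea] := sigma_tgt tv; have [tb eb] := sigma_src tv.
have tm := dmul_tangent (tau_src_tgt h) ta tv ea.
rewrite PsiE /conj_vec dsrc_mul ?tau_src_src //; last 2 first.
- exact: dinv_tangent.
- by rewrite dsrc_mul ?tau_src_tgt // dtgt_inv.
by rewrite dsrc_inv.
Qed.

Lemma conj_lin h a v w : tangent (Phi h) v -> tangent (Phi h) w ->
  conj_vec h (a *: v + w) = a *: conj_vec h v + conj_vec h w.
Proof.
move=> tv tw; have [ta ea] := sigma_tgt tv; have [tb eb] := sigma_src tv.
have [ta' ea'] := sigma_tgt tw; have [tb' eb'] := sigma_src tw.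
have := dtgt_tangent tv; have := dtgt_tangent tw; rewrite mor_tgt => tt' tt.
have := dsrc_tangent tv; have := dsrc_tangent tw; rewrite mor_src => ts' ts.
rewrite /conj_vec !diff_at_lincomb !(lift_lin lf) // !diff_at_lincomb.
rewrite dmul_lin ?tau_src_tgt // dmul_lin ?tau_src_src //.
- exact: dmul_tangent (tau_src_tgt h) _ _ _.
- exact: dinv_tangent.
- exact: dmul_tangent (tau_src_tgt h) _ _ _.
- exact: dinv_tangent.
- by rewrite dsrc_mul ?tau_src_tgt // dtgt_inv.
- by rewrite dsrc_mul ?tau_src_tgt // dtgt_inv.
Qed.

Lemma anchor_lift_lin x a u w : tangent (mor_obj Phi x) u -> tangent (mor_obj Phi x) w ->
  anchor_lift x (a *: u + w) = a *: anchor_lift x u + anchor_lift x w.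
Proof. by move=> tu tw; rewrite /anchor_lift (lift_lin lf) // diff_at_lincomb. Qed.

Lemma anchor_lift_tangent x u : tangent (mor_obj Phi x) u ->
  tangent (mor_obj Psi x) (anchor_lift x u).
Proof. by move=> tu; rewrite -tau_tgt; apply: dtgt_tangent; exact: (lift_tangent lf). Qed.

Lemma field_conj (W : smoothSpace R) (a : W -> arr H) c : cinfty W -> smooth_map a ->
  field_along (Phi \o a) c -> field_along (Psi \o a) (fun x => conj_vec (a x) (c x)).
Proof.
move=> cW sa fc; have cO := obj_cinfty G; have cA := arr_cinfty G.
have ft : field_along (tau \o (tgt \o a)) (fun x => sigma (tgt (a x)) (diff_at tgt (Phi (a x)) (c x))).
  apply: (lift_field lf cW (smooth_map_comp sa (tgt_smooth H))).
  by apply: field_eq (field_push cW cO (tgt_smooth G) fc) => // x; rewrite /= mor_tgt.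
have fs : field_along (tau \o (src \o a)) (fun x => sigma (src (a x)) (diff_at src (Phi (a x)) (c x))).
  apply: (lift_field lf cW (smooth_map_comp sa (src_smooth H))).
  by apply: field_eq (field_push cW cO (src_smooth G) fc) => // x; rewrite /= mor_src.
have tc x : tangent (Phi (a x)) (c x) := field_tangent fc x.
have f1 := field_dmul cW ft fc (fun x => tau_src_tgt (a x)) (fun x => (sigma_tgt (tc x)).2).
have := field_dmul cW f1 (field_push cW cA (inv_smooth G) fs).
move=> /(_ (fun x => tau_src_src (a x)))[x| s1 s2 s3].
  have [ta ea] := sigma_tgt (tc x); have [tb eb] := sigma_src (tc x).
  by rewrite /= dsrc_mul ?tau_src_tgt // dtgt_inv.
by apply: field_eq (FieldAlong s1 s2 s3) => // x; rewrite /= PsiE.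
Qed.

(** Along curves, (al c be^-1) (om d be^-1)^-1 = al (c d^-1) om^-1: the right-hand conjugating
    factor cancels, and the two left-hand ones conjugate the quotient. *)
Lemma conj_dmbar g h v w (p q : fibprod (@src R G) (@src R G)) : src g = tgt h ->
  sval p = (Phi (gmul g h), Phi h) -> sval q = (Psi (gmul g h), Psi h) ->
  tangent (Phi (gmul g h)) v -> tangent (Phi h) w ->
  diff_at src (Phi (gmul g h)) v = diff_at src (Phi h) w ->
  conj_vec g (dmbar p v w) = dmbar q (conj_vec (gmul g h) v) (conj_vec h w).
Proof.
move=> e pE qE tv tw E.
have mp : mbar p = Phi g.
  by rewrite /mbar pE /= mor_mul // mulgK // mor_src mor_tgt e.
have mq : mbar q = Psi g.
  by rewrite /mbar qE /= mor_mul // mulgK // mor_src mor_tgt e.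
have := @dmbar_paths _ _ p v w; rewrite pE /= => /(_ tv tw E)[c [d [cv dw cd]]].
have [al ca na] := sigma_tgt_curve tv cv; have [be cb nb] := sigma_src_curve tv cv.
have [om co no] := sigma_tgt_curve tw dw.
(* The same be serves for v and w, because gh and h have the same source and ds v = ds w; otherwise
   nothing would cancel. *)
have cb' : curve_at (tau (src h)) (sigma (src h) (diff_at src (Phi h) w)) be.
  by move: cb; rewrite src_mul // E.
have nb' : \forall t \near (0 : R), src (be t) = src (d t).
  by apply: near_impl (near_and nb cd) => t [-> ->].
have [t1 c1] := conj_curve tv cv ca cb na nb.
have [t2 c2] := conj_curve tw dw co cb' no nb'.
have := @dmbar_curve _ _ q (conj_vec (gmul g h) v) (conj_vec h w)
  (fun t => gmul (gmul (al t) (c t)) (ginv (be t)))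
  (fun t => gmul (gmul (om t) (d t)) (ginv (be t))).
rewrite qE /= => /(_ t1 t2 c1 c2)[|t3 c3].
  apply: near_impl (near_and na (near_and nb (near_and nb' no))) => t [h1 [h2 [h3 h4]]].
  by rewrite !src_mul ?tgt_inv // src_mul.
rewrite mq in t3 c3.
have := @dmbar_curve _ _ p v w c d; rewrite pE /= => /(_ tv tw cv dw cd)[t4 c4].
rewrite mp in t4 c4.
have dt4 : diff_at tgt (Phi g) (dmbar p v w) = diff_at tgt (Phi (gmul g h)) v.
  have k1 := curve_push (tgt_smooth G) c4; have k2 := curve_push (tgt_smooth G) cv.
  have j1 := dtgt_tangent t4; have j2 := dtgt_tangent tv.
  rewrite !mor_tgt tgt_mul // in k1 k2 j1 j2 *.
  apply: (curve_unique j1 j2 k1 k2); apply: near_impl cd => t e' /=.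
  by rewrite tgt_mul // tgt_inv.
have ds4 : diff_at src (Phi g) (dmbar p v w) = diff_at tgt (Phi h) w.
  have k1 := curve_push (src_smooth G) c4; have k2 := curve_push (tgt_smooth G) dw.
  have j1 := dsrc_tangent t4; have j2 := dtgt_tangent tw.
  rewrite mor_tgt mor_src e in k1 k2 j1 j2 *.
  apply: (curve_unique j1 j2 k1 k2); apply: near_impl cd => t e' /=.
  by rewrite src_mul ?src_inv // tgt_inv.
have [||||t5 c5] := @conj_curve g _ _ al om t4 c4.
- by rewrite dt4; move: ca; rewrite tgt_mul.
- by rewrite ds4 e.
- by apply: near_impl (near_and na cd) => t [e1 e2]; rewrite tgt_mul // tgt_inv.
- by apply: near_impl (near_and no cd) => t [e1 e2]; rewrite src_mul ?src_inv // tgt_inv.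
apply: (curve_unique t5 t3 c5 c3).
apply: near_impl (near_and (near_and na nb) (near_and no (near_and nb' cd))).
move=> t [[h1 h2] [h3 [h4 h5]]].
have k1 : src (c t) = tgt (ginv (be t)) by rewrite tgt_inv.
have k2 : src (d t) = tgt (ginv (be t)) by rewrite tgt_inv.
rewrite [ginv (gmul (gmul (om t) _) _)]ginvM ?src_mul // ginvK ginvM //.
rewrite -[RHS]mul_assoc ?src_mul ?tgt_mul ?src_inv ?tgt_inv //.
rewrite mulKg ?tgt_mul ?tgt_inv //.
by rewrite !mul_assoc ?src_mul ?tgt_mul ?src_inv ?tgt_inv.
by rewrite src_inv h3.
Qed.
End Conjugation.

Section Bivec.
Variables (R : realType) (G : lieGroupoid R).
Implicit Types g h : arr G.

(* Writing A = 1_{dt v} + A0 and B = 1_{ds v} + B0 with A0, B0 tangent to the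
   source fibres, bilinearity gives A v B^-1 = v + r(A0) + l(di B0). *)
Lemma conj_near_ident g v A B : tangent g v ->
  tangent (ident (tgt g)) A -> diff_at src (ident (tgt g)) A = diff_at tgt g v ->
  tangent (ident (src g)) B -> diff_at src (ident (src g)) B = diff_at src g v ->
  dmul g (ident (src g)) (dmul (ident (tgt g)) g A v) (diff_at ginv (ident (src g)) B) =
  v + bivec g (-1 *: diff_at ident (tgt g) (diff_at tgt g v) + A)
              (-1 *: diff_at ident (src g) (diff_at src g v) + B).
Proof.
move=> tv tA sA tB sB; set u := diff_at tgt g v; set w := diff_at src g v.
have tu : tangent (tgt g) u by exact: dtgt_tangent.
have tw : tangent (src g) w by exact: dsrc_tangent.
have tU := dident_tangent tu; have tW := dident_tangent tw.
set A0 := _ + A; set B0 := _ + B.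
have tA0 : tangent (ident (tgt g)) A0 by exact: tangent_lincomb.
have tB0 : tangent (ident (src g)) B0 by exact: tangent_lincomb.
have sA0 : diff_at src (ident (tgt g)) A0 = 0.
  by rewrite diff_at_lincomb dsrc_ident // sA scaleN1r addNr.
have sB0 : diff_at src (ident (src g)) B0 = 0.
  by rewrite diff_at_lincomb dsrc_ident // sB scaleN1r addNr.
have AE : A = 1 *: diff_at ident (tgt g) u + A0.
  by rewrite /A0 scale1r scaleN1r addrA subrr add0r.
have BE : B = 1 *: diff_at ident (src g) w + B0.
  by rewrite /B0 scale1r scaleN1r addrA subrr add0r.
have e1 : src (ident (tgt g)) = tgt g by rewrite src_unit.
have e2 : src g = tgt (ident (src g)) by rewrite tgt_unit.
have E1 : dmul (ident (tgt g)) g A v = 1 *: v + rvec g A0.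
  have := @dmul_lin _ _ _ g 1 _ v A0 0 e1 tU tv tA0 (tangent0 _).
  rewrite -AE scale1r addr0 dsrc_ident // sA0 diff_at0 => /(_ erefl erefl) ->.
  by rewrite dmul_identl // scale1r.
have tr : tangent g (rvec g A0).
  have [a ca sa] := vertical_curve tA0 sA0.
  by have [] := rvec_curve tA0 ca sa.
have tiB : tangent (ident (src g)) (diff_at ginv (ident (src g)) B0).
  by have := dinv_tangent tB0; rewrite ginv_ident.
have dtB0 : diff_at tgt (ident (src g)) (diff_at ginv (ident (src g)) B0) = 0.
  by have := dtgt_inv tB0; rewrite ginv_ident => ->.
rewrite E1 BE diff_at_lincomb dinv_ident // dmul_lin // ?dtgt_ident //.
- by rewrite dmul_identr // scale1r.
- by rewrite dsrc_rvec.
Qed.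

(** Along curves in the source fibres, (a g h) (b h)^-1 = a g b^-1. This turns the leading term of
    the coboundary of a right-translated family into r(A) + l(di(B)). *)
Lemma dmbar_rvec g h A B (p : fibprod (@src R G) (@src R G)) : src g = tgt h ->
  sval p = (gmul g h, h) ->
  tangent (ident (tgt g)) A -> diff_at src (ident (tgt g)) A = 0 ->
  tangent (ident (src g)) B -> diff_at src (ident (src g)) B = 0 ->
  dmbar p (rvec (gmul g h) A) (rvec h B) = bivec g A B.
Proof.
move=> e pE tA sA tB sB.
have [a ca na] := vertical_curve tA sA; have [b cb nb] := vertical_curve tB sB.
have [t1 c1] := bivec_curve tA tB ca cb na nb.
have tg : tgt (gmul g h) = tgt g by rewrite tgt_mul.
have := @rvec_curve _ _ (gmul g h) A a; rewrite tg => /(_ tA ca na)[t2 c2].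
have := @rvec_curve _ _ h B b; rewrite -e => /(_ tB cb nb)[t3 c3].
have := @dmbar_curve _ _ p _ _ _ _; rewrite pE /= => H.
have [|t4 c4] := H _ _ _ _ t2 t3 c2 c3.
  apply: near_impl (near_and na nb) => t [h1 h2].
  by rewrite !src_mul // ?tg // h2 e.
have mp : mbar p = g by rewrite /mbar pE /= mulgK.
rewrite mp in t4 c4; apply: (curve_unique t4 t1 c4 c1).
apply: near_impl (near_and na nb) => t [h1 h2].
have k1 : src (b t) = tgt h by rewrite h2.
have k3 : src h = tgt (ginv h) by rewrite tgt_inv.
have k4 : src (ginv h) = tgt (ginv (b t)) by rewrite src_inv tgt_inv k1.
have k6 : src (gmul (a t) g) = tgt h by rewrite src_mul.
rewrite ginvM // [gmul (a t) (gmul g h)]mul_assoc // [LHS]mul_assoc //.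
  by rewrite mulgK.
by rewrite src_mul.
Qed.
End Bivec.

(** * Conjugation there and back *)

Section RoundTrip.
Variables (R : realType) (H G : lieGroupoid R) (Phi Psi : morphism H G).
Variables (tau : obj H -> arr G) (sigma sigma' : obj H -> vec (obj G) -> vec (arr G)).
Hypothesis lf : lift_along (mor_obj Phi) tau sigma.
Hypothesis PsiE : forall h, Psi h = gmul (gmul (tau (tgt h)) (Phi h)) (ginv (tau (src h))).
Hypothesis lf' : lift_along (mor_obj Psi) (ginv \o tau) sigma'.
Hypothesis PhiE : forall h,
  Phi h = gmul (gmul (ginv (tau (tgt h))) (Psi h)) (ginv (ginv (tau (src h)))).
Implicit Types (h : arr H) (x : obj H).
Let kap := anchor_lift tau sigma.

Lemma tau_invl x : gmul (ginv (tau x)) (tau x) = ident (mor_obj Phi x).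
Proof. by rewrite mul_invl (lift_src lf). Qed.

Definition roundtrip x (u : vec (obj G)) : vec (arr G) :=
  dmul (ginv (tau x)) (tau x) (sigma' x (kap x u)) (sigma x u).

Definition theta x (u : vec (obj G)) : vec (arr G) :=
  -1 *: diff_at ident (mor_obj Phi x) u + roundtrip x u.

Lemma roundtrip_facts x u : tangent (mor_obj Phi x) u ->
  [/\ tangent (ginv (tau x)) (sigma' x (kap x u)), tangent (tau x) (sigma x u) &
      diff_at src (ginv (tau x)) (sigma' x (kap x u)) = diff_at tgt (tau x) (sigma x u)].
Proof.
move=> tu; have tk := anchor_lift_tangent lf PsiE tu.
split; [exact: (lift_tangent lf')|exact: (lift_tangent lf)|].
exact: (lift_dsrc lf').
Qed.

Lemma roundtrip_tangent x u : tangent (mor_obj Phi x) u ->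
  tangent (ident (mor_obj Phi x)) (roundtrip x u).
Proof.
move=> tu; have [t1 t2 E] := roundtrip_facts tu.
by rewrite -tau_invl; apply: dmul_tangent => //; rewrite src_inv.
Qed.

Lemma dsrc_roundtrip x u : tangent (mor_obj Phi x) u ->
  diff_at src (ident (mor_obj Phi x)) (roundtrip x u) = u.
Proof.
move=> tu; have [t1 t2 E] := roundtrip_facts tu.
by rewrite -tau_invl dsrc_mul ?src_inv // (lift_dsrc lf).
Qed.

Lemma roundtrip_lin x a u w : tangent (mor_obj Phi x) u -> tangent (mor_obj Phi x) w ->
  roundtrip x (a *: u + w) = a *: roundtrip x u + roundtrip x w.
Proof.
move=> tu tw; have [t1 t2 E] := roundtrip_facts tu; have [t1' t2' E'] := roundtrip_facts tw.
have ku := anchor_lift_tangent lf PsiE tu; have kw := anchor_lift_tangent lf PsiE tw.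
rewrite /roundtrip /kap (anchor_lift_lin lf) // (lift_lin lf) // (lift_lin lf') //.
by rewrite dmul_lin ?src_inv.
Qed.

Lemma theta_tangent x u : tangent (mor_obj Phi x) u ->
  tangent (ident (mor_obj Phi x)) (theta x u).
Proof.
move=> tu; apply: tangent_lincomb; last exact: roundtrip_tangent.
exact: dident_tangent.
Qed.

Lemma dsrc_theta x u : tangent (mor_obj Phi x) u ->
  diff_at src (ident (mor_obj Phi x)) (theta x u) = 0.
Proof.
move=> tu; rewrite diff_at_lincomb dsrc_roundtrip // dsrc_ident //.
by rewrite scaleN1r addNr.
Qed.

Lemma theta_lin x a u w : tangent (mor_obj Phi x) u -> tangent (mor_obj Phi x) w ->
  theta x (a *: u + w) = a *: theta x u + theta x w.
Proof.
move=> tu tw; rewrite /theta roundtrip_lin // diff_at_lincomb !scalerDr !scalerA.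
by rewrite [-1 * a]mulrC -!addrA; congr (_ + _); rewrite addrCA.
Qed.

Lemma theta0 x : theta x 0 = 0.
Proof.
have t0 := tangent0 (mor_obj Phi x).
have := theta_lin (-1) t0 t0; rewrite scaler0 addr0 => E.
by rewrite E scaleN1r addNr.
Qed.

Lemma field_theta (W : smoothSpace R) (a : W -> obj H) c : cinfty W -> smooth_map a ->
  field_along (mor_obj Phi \o a) c ->
  field_along (ident \o (mor_obj Phi \o a)) (fun y => theta (a y) (c y)).
Proof.
move=> cW sa fc; have cA := arr_cinfty G; have cO := obj_cinfty G.
have tc y : tangent (mor_obj Phi (a y)) (c y) := field_tangent fc y.
have fs := lift_field lf cW sa fc.
have fk : field_along (mor_obj Psi \o a) (fun y => kap (a y) (c y)).
  apply: field_eq (field_push cW cO (tgt_smooth G) fs) => // y.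
  by rewrite /= (tau_tgt lf PsiE).
have fs' := lift_field lf' cW sa fk.
apply: (field_lincomb cW (a := fun=> -1)) => [y||].
- exact: (smooth_cst cW).
- exact: (field_push cW cA (unit_smooth G) fc).
have := field_dmul cW fs' fs; move=> /(_ (fun y => src_inv _)).
move=> /(_ (fun y => let: And3 _ _ E := roundtrip_facts (tc y) in E)).
by apply: field_eq => // y; rewrite /= tau_invl.
Qed.

(** Along curves, al' (al c be^-1) be'^-1 = (al' al) c (be' be)^-1. The products [al' al] and
    [be' be] start at units with the round trip vectors as velocities, so [conj_near_ident]
    applies. *)
Lemma conj_roundtrip h v : tangent (Phi h) v ->
  conj_vec Psi (ginv \o tau) sigma' h (conj_vec Phi tau sigma h v) =
  v + bivec (Phi h) (theta (tgt h) (diff_at tgt (Phi h) v))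
                    (theta (src h) (diff_at src (Phi h) v)).
Proof.
move=> tv; have tt := dtgt_tangent tv; have ts := dsrc_tangent tv.
rewrite mor_tgt in tt; rewrite mor_src in ts.
have [c [al [be [cv [ca cb] na nb]]]] := conj_path lf tv.
have [t1 c1] := conj_curve lf PsiE tv cv ca cb na nb.
have tk := anchor_lift_tangent lf PsiE tt; have tk' := anchor_lift_tangent lf PsiE ts.
have [taa _] := sigma_tgt lf tv; have [tbb _] := sigma_src lf tv.
have ck := curve_push (tgt_smooth G) ca; have ck' := curve_push (tgt_smooth G) cb.
rewrite (tau_tgt lf PsiE) in ck; rewrite (tau_tgt lf PsiE) in ck'.
have [al' ca' na'] := sigma_curve lf' tk ck.
have [be' cb' nb'] := sigma_curve lf' tk' ck'.
have [||||t2 c2] := @conj_curve _ _ _ _ _ _ _ lf' PhiE h _ _ al' be' t1 c1.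
- by rewrite (dtgt_conj lf PsiE).
- by rewrite (dsrc_conj lf PsiE).
- apply: near_impl (near_and na' (near_and na nb)) => t [h1 [h2 h3]].
  by rewrite h1 /= !tgt_mul ?src_mul ?tgt_inv.
- apply: near_impl (near_and nb' (near_and na nb)) => t [h1 [h2 h3]].
  by rewrite h1 /= src_mul ?src_mul ?src_inv ?tgt_inv.
have [ta' ta1 Ea] := roundtrip_facts tt; have [tb' tb1 Eb] := roundtrip_facts ts.
have [_ ce] := dmul_curve ta' ta1 ca' ca na'; rewrite tau_invl -mor_tgt in ce.
have [_ cf] := dmul_curve tb' tb1 cb' cb nb'; rewrite tau_invl -mor_src in cf.
have tre := roundtrip_tangent tt; have trf := roundtrip_tangent ts.
have sre := dsrc_roundtrip tt; have srf := dsrc_roundtrip ts.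
rewrite -mor_tgt in tre sre; rewrite -mor_src in trf srf.
rewrite /theta -mor_tgt -mor_src -conj_near_ident //.
have [|t3 c3] := dmul_curve tre tv ce cv.
  by apply: near_impl (near_and na' na) => t [h1 h2] /=; rewrite src_mul.
rewrite mul_unitl in t3 c3.
have tiv := dinv_tangent trf; have civ := curve_push (inv_smooth G) cf.
rewrite ginv_ident in tiv civ.
have [|t4 c4] := dmul_curve t3 tiv c3 civ.
  apply: near_impl (near_and (near_and na' na) (near_and nb' nb)) => t [[h1 h2] [h3 h4]] /=.
  by rewrite tgt_inv !src_mul // src_mul.
rewrite mul_unitr in t4 c4; apply: (curve_unique t2 t4 c2 c4).
apply: near_impl (near_and (near_and na' na) (near_and nb' nb)) => t [[h1 h2] [h3 h4]] /=.
have k1 : src (c t) = tgt (ginv (be t)) by rewrite tgt_inv.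
have k2 : src (ginv (be t)) = tgt (ginv (be' t)) by rewrite src_inv tgt_inv.
rewrite [ginv (gmul (be' t) _)]ginvM //.
rewrite !mul_assoc ?src_mul ?tgt_mul //.
Qed.
End RoundTrip.

Section ConjBivec.
Variables (R : realType) (H G : lieGroupoid R) (Phi Psi : morphism H G).
Variables (tau : obj H -> arr G) (sigma : obj H -> vec (obj G) -> vec (arr G)).
Hypothesis lf : lift_along (mor_obj Phi) tau sigma.
Hypothesis PsiE : forall h, Psi h = gmul (gmul (tau (tgt h)) (Phi h)) (ginv (tau (src h))).

Lemma sigma0 x : sigma x 0 = 0.
Proof.
have t0 := tangent0 (mor_obj Phi x).
have := lift_lin lf (-1) t0 t0; rewrite scaler0 addr0 => E.
by rewrite E scaleN1r addNr.
Qed.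

(** As ds A = 0 and [sigma x 0 = 0], the constant curve at [tau x] can serve as the right
    conjugating factor. *)
Lemma conj_vertical_curve x A a : tangent (ident (mor_obj Phi x)) A ->
  diff_at src (ident (mor_obj Phi x)) A = 0 ->
  curve_at (ident (mor_obj Phi x)) A a ->
  (\forall t \near (0 : R), src (a t) = mor_obj Phi x) ->
  forall al, curve_at (tau x) (sigma x (diff_at tgt (ident (mor_obj Phi x)) A)) al ->
  (\forall t \near (0 : R), src (al t) = tgt (a t)) ->
  tangent (ident (mor_obj Psi x)) (conj_vec Phi tau sigma (ident x) A) /\
  curve_at (ident (mor_obj Psi x)) (conj_vec Phi tau sigma (ident x) A)
    (fun t => gmul (gmul (al t) (a t)) (ginv (tau x))).
Proof.
move=> tA sA ca na al cal nal.
rewrite -(mor_ident Phi) in tA sA ca cal.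
have := @conj_curve _ _ _ _ _ _ _ lf PsiE (ident x) A a al (fun=> tau x) tA ca.
rewrite (mor_ident Psi); apply => //.
- by rewrite tgt_unit.
- by rewrite sA sigma0 src_unit; exact: curve_cst.
- by apply: near_impl na => t; rewrite (lift_src lf).
Qed.

(** The degree 0 case of the compatibility of transport with the differential. Along curves the
    inner factors tau cancel: (al a tau^-1) (tau Phi(h) tau^-1) (om b tau^-1)^-1 = al (a Phi(h)
    b^-1) om^-1. *)
Lemma conj_bivec (h : arr H) A B :
  tangent (ident (mor_obj Phi (tgt h))) A -> diff_at src (ident (mor_obj Phi (tgt h))) A = 0 ->
  tangent (ident (mor_obj Phi (src h))) B -> diff_at src (ident (mor_obj Phi (src h))) B = 0 ->
  conj_vec Phi tau sigma h (bivec (Phi h) A B) =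
  bivec (Psi h) (conj_vec Phi tau sigma (ident (tgt h)) A)
                (conj_vec Phi tau sigma (ident (src h)) B).
Proof.
move=> tA sA tB sB.
have [a ca na] := vertical_curve tA sA; have [b cb nb] := vertical_curve tB sB.
have dtA := dtgt_tangent tA; have dcA := curve_push (tgt_smooth G) ca.
have dtB := dtgt_tangent tB; have dcB := curve_push (tgt_smooth G) cb.
rewrite tgt_unit in dtA dcA; rewrite tgt_unit in dtB dcB.
have [al cal nal] := sigma_curve lf dtA dcA.
have [om com nom] := sigma_curve lf dtB dcB.
have [tKA cKA] := conj_vertical_curve tA sA ca na cal nal.
have [tKB cKB] := conj_vertical_curve tB sB cb nb com nom.
have := @bivec_curve _ _ (Psi h) _ _ _ _; rewrite mor_tgt mor_src => /(_ _ _ _ _ tKA tKB cKA cKB).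
move=> [||t2 c2].
- apply: near_impl (near_and na nal) => t [h1 h2].
  by rewrite src_mul ?src_inv ?(tau_tgt lf PsiE) // src_mul // tgt_inv (lift_src lf).
- apply: near_impl (near_and nb nom) => t [h1 h2].
  by rewrite src_mul ?src_inv ?(tau_tgt lf PsiE) // src_mul // tgt_inv (lift_src lf).
have := @bivec_curve _ _ (Phi h) A B a b; rewrite mor_tgt mor_src.
move=> /(_ tA tB ca cb na nb)[t1 c1].
have E1 : diff_at tgt (Phi h) (bivec (Phi h) A B) = diff_at tgt (ident (mor_obj Phi (tgt h))) A.
  have k1 := dtgt_tangent t1; have k2 := curve_push (tgt_smooth G) c1.
  rewrite mor_tgt in k1 k2; apply: (curve_unique k1 dtA k2 dcA).
  apply: near_impl (near_and na nb) => t [h1 h2] /=.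
  by rewrite !tgt_mul ?src_mul ?tgt_inv ?mor_tgt ?mor_src.
have E2 : diff_at src (Phi h) (bivec (Phi h) A B) = diff_at tgt (ident (mor_obj Phi (src h))) B.
  have k1 := dsrc_tangent t1; have k2 := curve_push (src_smooth G) c1.
  rewrite mor_src in k1 k2; apply: (curve_unique k1 dtB k2 dcB).
  apply: near_impl (near_and na nb) => t [h1 h2] /=.
  by rewrite !src_mul ?src_inv ?tgt_inv ?mor_tgt ?mor_src.
have [||||t3 c3] := @conj_curve _ _ _ _ _ _ _ lf PsiE h _ _ al om t1 c1.
- by rewrite E1.
- by rewrite E2.
- apply: near_impl (near_and (near_and na nal) nb) => t [[h1 h2] h3].
  by rewrite h2 /= !tgt_mul ?src_mul ?tgt_inv ?mor_tgt ?mor_src.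
- apply: near_impl (near_and (near_and na nom) nb) => t [[h1 h2] h3].
  by rewrite h2 /= !src_mul ?src_inv ?tgt_inv ?mor_tgt ?mor_src.
apply: (curve_unique t3 t2 c3 c2).
apply: near_impl (near_and (near_and na nal) (near_and nb nom)) => t [[h1 h2] [h3 h4]] /=.
rewrite /= in h2 h4.
have st := lift_src lf.
have e1 : src (a t) = tgt (Phi h) by rewrite mor_tgt.
have e2 : src (Phi h) = tgt (ginv (b t)) by rewrite tgt_inv mor_src h3.
have e3 : src (b t) = tgt (ginv (tau (src h))) by rewrite tgt_inv st.
have e4 : src (ginv (b t)) = tgt (ginv (om t)) by rewrite src_inv tgt_inv.
have e5 : src (tau (tgt h)) = tgt (Phi h) by rewrite st mor_tgt.
have e6 : src (Phi h) = tgt (ginv (tau (src h))) by rewrite tgt_inv st mor_src.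
have e7 : src (gmul (al t) (a t)) = tgt (ginv (tau (tgt h))) by rewrite src_mul // tgt_inv st.
rewrite [ginv (gmul (gmul (om t) _) _)]ginvM; last by rewrite src_mul.
rewrite ginvK ginvM // PsiE.
have -> : gmul (gmul (gmul (al t) (a t)) (ginv (tau (tgt h))))
    (gmul (gmul (tau (tgt h)) (Phi h)) (ginv (tau (src h)))) =
    gmul (gmul (al t) (a t)) (gmul (Phi h) (ginv (tau (src h)))).
  rewrite -[gmul (gmul (tau _) _) _]mul_assoc // -mul_assoc ?src_inv ?tgt_mul //.
  by rewrite mulKg // tgt_mul.
have -> : gmul (gmul (gmul (al t) (a t)) (gmul (Phi h) (ginv (tau (src h)))))
    (gmul (tau (src h)) (gmul (ginv (b t)) (ginv (om t)))) =
    gmul (gmul (gmul (al t) (a t)) (Phi h)) (gmul (ginv (b t)) (ginv (om t))).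
  rewrite [gmul (gmul (al t) (a t)) (gmul _ _)]mul_assoc ?src_mul //.
  rewrite -mul_assoc ?src_mul ?tgt_mul ?src_inv ?st ?tgt_inv //.
  by rewrite mulKg // tgt_mul // st tgt_inv h3.
  by rewrite st mor_src.
by rewrite !mul_assoc ?src_mul ?tgt_mul.
Qed.
End ConjBivec.

(** * The nerve *)

Section TangentLinear.
Variables (R : realType) (X Y : smoothSpace R) (x : X) (T : vec X -> vec Y).
Hypothesis linT : forall a v w, tangent x v -> tangent x w ->
  T (a *: v + w) = a *: T v + T w.

Lemma tangent_sumZ (I : Type) (s : seq I) (a : I -> R) (v : I -> vec X) :
  (forall i, tangent x (v i)) -> tangent x (\sum_(i <- s) a i *: v i).
Proof.
move=> tv; elim: s => [|i s IH]; first by rewrite big_nil; exact: tangent0.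
by rewrite big_cons; exact: tangent_lincomb.
Qed.

Lemma linear_sumZ (I : Type) (s : seq I) (a : I -> R) (v : I -> vec X) :
  (forall i, tangent x (v i)) ->
  T (\sum_(i <- s) a i *: v i) = \sum_(i <- s) a i *: T (v i).
Proof.
move=> tv; elim: s => [|i s IH].
  rewrite !big_nil; have t0 := tangent0 x.
  have := linT (-1) t0 t0; rewrite scaler0 addr0 => ->.
  by rewrite scaleN1r addNr.
by rewrite !big_cons linT ?IH //; exact: tangent_sumZ.
Qed.
End TangentLinear.

Section BivecLinear.
Variables (R : realType) (G : lieGroupoid R).
Implicit Types (g : arr G).

(** The fibre at x of the Lie algebroid of G, inside the tangent space at the unit. *)
Definition vertical (x : obj G) (A : vec (arr G)) : Prop :=
  tangent (ident x) A /\ diff_at src (ident x) A = 0.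

Lemma vertical_lincomb x a A B : vertical x A -> vertical x B -> vertical x (a *: A + B).
Proof.
move=> [tA sA] [tB sB]; split; first exact: tangent_lincomb.
by rewrite diff_at_lincomb sA sB scaler0 addr0.
Qed.

Lemma vertical0 x : vertical x 0.
Proof. by split; [exact: tangent0|rewrite diff_at0]. Qed.

Lemma rvec_tangent g A : vertical (tgt g) A -> tangent g (rvec g A).
Proof.
by move=> [tA sA]; have [a ca na] := vertical_curve tA sA; have [] := rvec_curve tA ca na.
Qed.

Lemma dinv_vertical x A : vertical x A ->
  tangent (ident x) (diff_at ginv (ident x) A) /\
  diff_at tgt (ident x) (diff_at ginv (ident x) A) = 0.
Proof.
move=> [tA sA]; have := dinv_tangent tA; have := dtgt_inv tA.
by rewrite ginv_ident sA.
Qed.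

Lemma bivec_lin g a A B A' B' : vertical (tgt g) A -> vertical (src g) B ->
  vertical (tgt g) A' -> vertical (src g) B' ->
  bivec g (a *: A + A') (a *: B + B') = a *: bivec g A B + bivec g A' B'.
Proof.
move=> vA vB vA' vB'; have [tB dB] := dinv_vertical vB; have [tB' dB'] := dinv_vertical vB'.
have rA := rvec_tangent vA; have rA' := rvec_tangent vA'.
case: vA vA' => [tA sA] [tA' sA'].
by rewrite /bivec rvec_lin // diff_at_lincomb dmul_lin ?tgt_unit // dsrc_rvec.
Qed.

Lemma bivec_rvec g A : vertical (tgt g) A -> bivec g A 0 = rvec g A.
Proof.
move=> vA; have := dmul_identr (rvec_tangent vA); case: vA => tA sA.
by rewrite dsrc_rvec // diff_at0 /bivec diff_at0.
Qed.

Lemma bivec_split g A B : vertical (tgt g) A -> vertical (src g) B ->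
  bivec g A B = rvec g A + bivec g 0 B.
Proof.
move=> vA vB; have := bivec_lin 1 vA (vertical0 _) (vertical0 _) vB.
by rewrite !scale1r addr0 add0r bivec_rvec.
Qed.

Lemma dsrc_dmbar (p : fibprod (@src R G) (@src R G)) v w :
  tangent (sval p).1 v -> tangent (sval p).2 w ->
  diff_at src (sval p).1 v = diff_at src (sval p).2 w ->
  diff_at src (mbar p) (dmbar p v w) = diff_at tgt (sval p).2 w.
Proof.
move=> tv tw E; have e : src (sval p).1 = tgt (ginv (sval p).2).
  by rewrite tgt_inv; exact: (svalP p).
by rewrite dmbarE // /mbar dsrc_mul ?dtgt_inv ?dsrc_inv //; exact: dinv_tangent.
Qed.

Lemma dmbar_tangent (p : fibprod (@src R G) (@src R G)) v w :
  tangent (sval p).1 v -> tangent (sval p).2 w ->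
  diff_at src (sval p).1 v = diff_at src (sval p).2 w ->
  tangent (mbar p) (dmbar p v w).
Proof.
move=> tv tw E; have [c [d [cv dw cd]]] := dmbar_paths tv tw E.
by have [] := dmbar_curve tv tw cv dw cd.
Qed.

Lemma dmbar_lin (p : fibprod (@src R G) (@src R G)) a v w v' w' :
  tangent (sval p).1 v -> tangent (sval p).2 w ->
  tangent (sval p).1 v' -> tangent (sval p).2 w' ->
  diff_at src (sval p).1 v = diff_at src (sval p).2 w ->
  diff_at src (sval p).1 v' = diff_at src (sval p).2 w' ->
  dmbar p (a *: v + v') (a *: w + w') = a *: dmbar p v w + dmbar p v' w'.
Proof.
move=> tv tw tv' tw' E E'; have cA := arr_cinfty G.
rewrite /dmbar -diff_at_lincomb; congr diff_at.
by apply: (tangent_pair_lin cA cA a) => //; exact: dmbar_paths.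
Qed.
End BivecLinear.

Section NerveMaps.
Variables (R : realType) (H : lieGroupoid R).

Lemma nerve_cinfty k : cinfty (nerve H k).
Proof. by case: k => [|n]; [exact: obj_cinfty|exact: initial_cinfty]. Qed.

Lemma entry_smooth n (i : 'I_n.+1) : smooth_map (fun h : nerve H n.+1 => sval h i : arr H).
Proof. by apply: (pullback_smooth (@arr_cinfty R H)) => p ?; exists i. Qed.

Lemma smooth_nerve n (W : smoothSpace R) (P : W -> nerve H n.+1) : cinfty W ->
  (forall i, smooth_map (fun x => sval (P x) i : arr H)) -> smooth_map P.
Proof.
move=> cW sP; apply: (smooth_initial cW) => p x [i _ Fp].
exact: (@pullback_into R _ (arr H) W (fun h : string H n => sval h i) P p x (sP i) Fp).
Qed.

(** In degree 0 the unit at x takes the place of h_1. Then in every degree a cochain has its values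
    over [Phi (nhead h)], and transport is one formula. *)
Definition nhead k : nerve H k -> arr H :=
  match k with 0%N => fun x => ident x | n.+1 => fun h => sval h ord0 end.

Definition nbase k (h : nerve H k) : obj H := tgt (nhead h).

Lemma nhead_smooth k : smooth_map (@nhead k).
Proof. by case: k => [|n]; [exact: unit_smooth|exact: entry_smooth]. Qed.

Lemma nbase_smooth k : smooth_map (@nbase k).
Proof. exact: (smooth_map_comp (@nhead_smooth k) (tgt_smooth H)). Qed.

(** Indexing by natural numbers allows the shift by one to be a match; only indices at most k are
    used. *)
Definition cons_fun k : nerve H k -> nat -> arr H :=
  match k with
  | 0%N => fun x _ => ident x
  | n.+1 => fun h j => if j is j'.+1 then sval h (inord j') else ident (tgt (sval h ord0))
  end.

Lemma inord_0 n : inord 0 = ord0 :> 'I_n.+1.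
Proof. by apply: val_inj; rewrite /= inordK. Qed.

Lemma cons_composable k (h : nerve H k) :
  composable (fun j : 'I_k.+1 => cons_fun h j).
Proof.
case: k h => [x m|n h m] //; rewrite ltnS => mn.
rewrite /cons_fun !inordK ?ltnS //; last exact: leqW.
case: m mn => [_|m mn]; first by rewrite src_unit inord_0.
by apply: (svalP h).
Qed.

(* (h_1, ..., h_k) |-> (1, h_1, ..., h_k). *)
Definition ncons k (h : nerve H k) : nerve H k.+1 :=
  exist _ (fun j : 'I_k.+1 => cons_fun h j) (cons_composable h).

Lemma ncons_smooth k : smooth_map (@ncons k).
Proof.
apply: smooth_nerve; first exact: nerve_cinfty.
case: k => [|n] i /=; first exact: unit_smooth.
case: (i : nat) => [|j]; last exact: entry_smooth.
exact: (smooth_map_comp (@nbase_smooth n.+1) (unit_smooth H)).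
Qed.

Lemma nhead_ncons k (h : nerve H k) : nhead (ncons h) = ident (nbase h).
Proof. by case: k h => [x|n h] //=; rewrite /nbase /= tgt_unit. Qed.

Lemma nerve_ext n (h h' : nerve H n.+1) : (forall j, sval h j = sval h' j) -> h = h'.
Proof. by move=> E; apply: sig_ext; apply/funext. Qed.

Lemma ntail_ncons k (h : nerve H k) : ntail (ncons h) = h.
Proof.
case: k h => [x|n h]; first by rewrite /= src_unit.
apply: nerve_ext => j; rewrite /= /face_fun /= /bump /= inordK ?add1n ?ltnS //.
  by rewrite inord_val.
by rewrite -ltnS.
Qed.

Lemma nhead_face n i (h : nerve H n.+2) : (1 < i)%N -> nhead (face i h) = nhead h.
Proof.
move=> i1; rewrite /= /face_fun /bump /=.
have -> : (1 == i)%N = false by rewrite ltn_eqF.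
by rewrite leqNgt (ltnW i1) /= add0n inord_0.
Qed.

Lemma nhead_face1 n (h : nerve H n.+2) :
  nhead (face 1 h) = gmul (nhead h) (nhead (face 0 h)).
Proof. by rewrite /= /face_fun /= /bump /= inord_0. Qed.

Lemma nhead_src n (h : nerve H n.+2) : src (nhead h) = tgt (nhead (face 0 h)).
Proof.
rewrite /= /face_fun /= /bump /= add1n.
by have := svalP h 0%N isT; rewrite inord_0.
Qed.

Lemma nbase_ntail n (h : nerve H n.+1) : nbase (ntail h) = src (nhead h).
Proof.
case: n h => [|n] h; first by rewrite /nbase /= tgt_unit.
by rewrite nhead_src.
Qed.

Lemma face0_face n i (h : nerve H n.+3) : (0 < i)%N ->
  face 0 (face i.+1 h) = face i (face 0 h).
Proof.
move=> i0; apply: nerve_ext => j /=; rewrite /face_fun /=.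
have jn : (j < n.+1)%N := ltn_ord j.
rewrite /bump /= !add1n inordK ?ltnS // eqSS.
case: eqP => [E|ne].
  by rewrite !inordK ?ltnS // ?(leq_trans jn) // ltnW.
rewrite inordK ?addnS // (leq_ltn_trans (leq_add (leq_b1 _) (leqnn j))) //.
Qed.

Lemma ntail_face_ncons0 (h : nerve H 1) : ntail (face 2 (ncons h)) = nbase h.
Proof. by rewrite /= /face_fun /= /bump /= inordK //= src_unit. Qed.

(** Turns the terms of the cocycle condition at (1, h_1, ..., h_k), as they appear in
    [cocycle_dtgt], into symbols at the faces of h. *)
Lemma ntail_face_ncons n i (h : nerve H n.+2) : (0 < i)%N ->
  ntail (face i.+1 (ncons h)) = face i h.
Proof. by move=> i0; rewrite [LHS]face0_face // -[in RHS](ntail_ncons h). Qed.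
End NerveMaps.

(** * Transport of cochains *)

Section Cochains.
Variables (R : realType) (H G : lieGroupoid R) (Phi : morphism H G).

Lemma cbaseE k (h : nerve H k) : cbase Phi h = Phi (nhead h).
Proof. by case: k h => [|n] h //=; rewrite mor_ident. Qed.

Lemma cochain_field k (c : precochain H G k) : cochain Phi c ->
  field_along (@cbase R H G Phi k) c.
Proof.
have cA := arr_cinfty G; have cN := nerve_cinfty H.
by case: k c => [|n] c [sc _]; apply/field_alongP.
Qed.

Lemma cochain_tangent k (c : precochain H G k) h : cochain Phi c ->
  tangent (Phi (nhead h)) (c h).
Proof. by move=> /cochain_field/field_tangent/(_ h); rewrite cbaseE. Qed.

Lemma cochain_vertical (c : precochain H G 0) x : cochain Phi c ->
  vertical (mor_obj Phi x) (c x).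
Proof. by move=> cc; have := @cochain_tangent 0 c x cc; case: cc => _ /(_ x); rewrite /= mor_ident. Qed.

(* ds(c(h_1, ..., h_k)) as a function of (h_2, ..., h_k). *)
Definition symbol k (c : precochain H G k.+1) (h : nerve H k) : vec (obj G) :=
  diff_at src (Phi (nhead (ncons h))) (c (ncons h)).

Lemma symbolE k (c : precochain H G k.+1) h : cochain Phi c ->
  diff_at src (Phi (nhead h)) (c h) = symbol c (ntail h).
Proof. by move=> [_ [sc E]]; rewrite /symbol (E (ncons _)) ntail_ncons -E. Qed.

Lemma symbol_tangent k (c : precochain H G k.+1) h : cochain Phi c ->
  tangent (mor_obj Phi (nbase h)) (symbol c h).
Proof.
move=> cc; have := dsrc_tangent (cochain_tangent (ncons h) cc).
by rewrite mor_src nhead_ncons src_unit /symbol nhead_ncons.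
Qed.

(** The function sc in the definition of a cochain comes without smoothness. It is recovered by
    evaluating the cochain on [ncons], a smooth section of [ntail]. *)
Lemma symbol_field k (c : precochain H G k.+1) : cochain Phi c ->
  field_along (mor_obj Phi \o @nbase R H k) (symbol c).
Proof.
move=> cc; have cN := nerve_cinfty H k; have cO := obj_cinfty G.
have := field_push cN cO (src_smooth G) (field_comp (@ncons_smooth R H k) (cochain_field cc)).
apply: field_eq => [h|h] //.
rewrite -[LHS]/(src (Phi (nhead (ncons h)))).
by rewrite mor_src nhead_ncons src_unit.
Qed.

Lemma cochain_lincomb k a (c d : precochain H G k) : cochain Phi c -> cochain Phi d ->
  cochain Phi (a *: c + d).
Proof.
have cA := arr_cinfty G; have cN := nerve_cinfty H k.
move=> cc cd; have fa : field_along (@cbase R H G Phi k) (a *: c + d).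
  apply: (field_lincomb cN (a := fun=> a)) (cochain_field cc) (cochain_field cd).
  by move=> x; exact: (smooth_cst cN).
have {fa}sa := (field_alongP _ _ cN cA).2 fa.
case: k c d cc cd sa {cN} => [|n] c d [_ sc] [_ sd] sa; split => //.
  by move=> x; rewrite diff_at_lincomb sc sd scaler0 addr0.
have [sc' Ec] := sc; have [sd' Ed] := sd; exists (a *: sc' + sd') => h.
by rewrite diff_at_lincomb Ec Ed.
Qed.

Lemma delta0E (c : precochain H G 0) (h : nerve H 1) : cochain Phi c ->
  delta Phi c h = bivec (Phi (nhead h)) (c (tgt (nhead h))) (c (src (nhead h))).
Proof.
move=> cc; have [tA sA] := cochain_vertical (tgt (nhead h)) cc.
have [tB sB] := cochain_vertical (src (nhead h)) cc.
rewrite /delta /= -/(nhead h) rtransE ?mor_tgt // bivecE ?mor_src ?mor_tgt //.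
Qed.

(** The shift i = j + 2 preserves signs and absorbs the separate last face into the sum. *)
Lemma deltaSE n (c : precochain H G n.+1) (h : nerve H n.+2) :
  delta Phi c h = -1 *: dmbar (div_point Phi h) (c (face 1 h)) (c (face 0 h)) +
    \sum_(j < n.+1) (-1) ^+ j *: c (face j.+2 h).
Proof.
have -> : \sum_(j < n.+1) (-1) ^+ j *: c (face j.+2 h) =
    \sum_(2 <= i < n.+3) (-1) ^+ i *: c (face i h).
  rewrite 2!big_add1 /= big_mkord; apply: eq_bigr => j _.
  by rewrite !exprS !mulN1r opprK.
by rewrite big_nat_recr //= addrA scaleN1r.
Qed.

Lemma mbar_div_point n (h : nerve H n.+2) : mbar (div_point Phi h) = Phi (nhead h).
Proof.
rewrite -[LHS]/(gmul (Phi (nhead (face 1 h))) (ginv (Phi (nhead (face 0 h))))).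
rewrite nhead_face1 mor_mul ?nhead_src //.
by rewrite mulgK // mor_src mor_tgt nhead_src.
Qed.

Lemma div_point_vectors n (c : precochain H G n.+1) (h : nerve H n.+2) : cochain Phi c ->
  [/\ tangent (sval (div_point Phi h)).1 (c (face 1 h)),
      tangent (sval (div_point Phi h)).2 (c (face 0 h)) &
      diff_at src (sval (div_point Phi h)).1 (c (face 1 h)) =
      diff_at src (sval (div_point Phi h)).2 (c (face 0 h))].
Proof.
move=> cc; split; [exact: (cochain_tangent (face 1 h) cc)|exact: (cochain_tangent (face 0 h) cc)|].
rewrite -[LHS]/(diff_at src (Phi (nhead (face 1 h))) _).
rewrite -[RHS]/(diff_at src (Phi (nhead (face 0 h))) _) !symbolE //; congr (symbol _ _).
(* The two faces have the same tail, by the simplicial identity d_0 d_1 = d_0 d_0; hence the two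
   values have the same source and can be divided. *)
case: n c cc h => [|n] c cc h; first exact: src_face01.
apply: nerve_ext => j /=; rewrite /face_fun /= /bump /=.
have jn := ltn_ord j.
by rewrite !inordK ?ltnS ?add1n // ltnW.
Qed.

Lemma delta_lin k a (c d : precochain H G k) : cochain Phi c -> cochain Phi d ->
  delta Phi (a *: c + d) = a *: delta Phi c + delta Phi d.
Proof.
move=> cc cd; have ccd := cochain_lincomb a cc cd; apply/funext => h.
have -> : (a *: delta Phi c + delta Phi d) h = a *: delta Phi c h + delta Phi d h by [].
case: k c d cc cd ccd h => [|n] c d cc cd ccd h.
  rewrite !delta0E //.
  have vt := cochain_vertical (tgt (nhead h)); have vs := cochain_vertical (src (nhead h)).
  by apply: bivec_lin; rewrite ?mor_tgt ?mor_src; [exact: vt|exact: vs|exact: vt|exact: vs].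
rewrite !deltaSE; have [t1 t2 E] := div_point_vectors h cc.
have [t1' t2' E'] := div_point_vectors h cd.
have -> : forall x, (a *: c + d) x = a *: c x + d x by [].
rewrite dmbar_lin // !scalerDr scaler_sumr.
have -> : \sum_(j < n.+1) (-1) ^+ j *: (a *: c + d) (face j.+2 h) =
    \sum_(j < n.+1) a *: ((-1) ^+ j *: c (face j.+2 h)) +
    \sum_(j < n.+1) (-1) ^+ j *: d (face j.+2 h).
  rewrite -big_split /=; apply: eq_bigr => i _.
  by rewrite [(a *: c + d) _]/(a *: c _ + d _) scalerDr !scalerA mulrC.
by rewrite !scalerA mulrC addrACA.
Qed.

Lemma coboundary_lincomb k a (u w : precochain H G k) :
  coboundary Phi u -> coboundary Phi w -> coboundary Phi (a *: u + w).
Proof.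
case: k u w => [|n] u w; first by move=> -> ->; rewrite scaler0 addr0.
move=> [b cb <-] [d cd <-]; exists (a *: b + d); first exact: cochain_lincomb.
exact: delta_lin.
Qed.

Lemma cochain0 k : cochain Phi (0 : precochain H G k).
Proof.
have cA := arr_cinfty G; have cN := nerve_cinfty H k.
have sb : smooth_map (@cbase R H G Phi k).
  have := smooth_map_comp (@nhead_smooth R H k) (mor_smooth Phi).
  by congr smooth_map; apply/funext => h; rewrite cbaseE.
have sa := (field_alongP _ _ cN cA).2 (field0 cN sb).
case: k cN sb sa => [|n] cN sb sa; split => //; first by move=> x; rewrite diff_at0.
by exists (fun=> 0) => h; rewrite diff_at0.
Qed.

Lemma coboundary0 k : coboundary Phi (0 : precochain H G k).
Proof.
case: k => [//|n]; exists 0; first exact: cochain0.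
have := delta_lin (-1) (cochain0 n) (cochain0 n).
by rewrite scaler0 addr0 scaleN1r addNr.
Qed.

Lemma cocycle_lincomb k a (c d : precochain H G k) :
  cocycle Phi c -> cocycle Phi d -> cocycle Phi (a *: c + d).
Proof.
move=> [cc dc] [cd dd]; split; first exact: cochain_lincomb.
by rewrite delta_lin // dc dd scaler0 addr0.
Qed.

Lemma coh_class_eq k (c d : precochain H G k) : cocycle Phi d ->
  coh_class Phi c = coh_class Phi d <-> coboundary Phi (d - c).
Proof.
move=> zd; split=> [E|b].
  have : coh_class Phi d d by split => //; rewrite subrr; exact: coboundary0.
  by rewrite -E => -[].
apply/seteqP; split=> x [zx bx]; split => //.
  by have := coboundary_lincomb (-1) b bx; rewrite scaleN1r opprB addrC addrA subrK.
by have := coboundary_lincomb 1 bx b; rewrite scale1r addrA subrK.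
Qed.

(* The target of the value of a cocycle is found by evaluating the cocycle
   condition at (1, h_1, ..., h_k) and taking sources. *)
Lemma cocycle_dtgt n (c : precochain H G n.+1) (h : nerve H n.+1) : cocycle Phi c ->
  diff_at tgt (Phi (nhead h)) (c h) =
    \sum_(j < n.+1) (-1) ^+ j *: symbol c (ntail (face j.+2 (ncons h))).
Proof.
move=> [cc dc]; have := congr1 (fun d => diff_at src (Phi (nhead (ncons h))) (d (ncons h))) dc.
rewrite deltaSE [in RHS]/= diff_at0 diff_at_lincomb.
have [t1 t2 E] := div_point_vectors (ncons h) cc.
rewrite -{1}mbar_div_point dsrc_dmbar //.
rewrite [(sval (div_point Phi (ncons h))).2]/(Phi (nhead (face 0 (ncons h)))).
have -> : face 0 (ncons h) = h by exact: ntail_ncons.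
rewrite scaleN1r addrC => /eqP; rewrite subr_eq0 => /eqP <-.
pose x := Phi (nhead (ncons h)).
have tf (j : 'I_n.+1) : tangent x (c (face j.+2 (ncons h))).
  by have := cochain_tangent (face j.+2 (ncons h)) cc; rewrite nhead_face.
rewrite (@linear_sumZ _ _ _ x (diff_at src x)) //; last first.
  by move=> a v w _ _; exact: diff_at_lincomb.
apply: eq_bigr => j _; congr (_ *: _).
by rewrite -symbolE // nhead_face.
Qed.
End Cochains.

Section TransportCochain.
Variables (R : realType) (H G : lieGroupoid R) (Phi Psi : morphism H G).
Variables (tau : obj H -> arr G) (sigma : obj H -> vec (obj G) -> vec (arr G)).
Hypothesis lf : lift_along (mor_obj Phi) tau sigma.
Hypothesis PsiE : forall h, Psi h = gmul (gmul (tau (tgt h)) (Phi h)) (ginv (tau (src h))).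

Definition transport k (c : precochain H G k) : precochain H G k :=
  fun h => conj_vec Phi tau sigma (nhead h) (c h).

Lemma transport_lincomb k a (c d : precochain H G k) : cochain Phi c -> cochain Phi d ->
  transport (a *: c + d) = a *: transport c + transport d.
Proof.
move=> cc cd; apply/funext => h.
exact: (conj_lin lf a (cochain_tangent h cc) (cochain_tangent h cd)).
Qed.

Lemma transport_cochain k (c : precochain H G k) : cochain Phi c ->
  cochain Psi (transport c).
Proof.
move=> cc; have cA := arr_cinfty G; have cN := nerve_cinfty H k.
have fc : field_along (Phi \o @nhead R H k) c.
  by apply: field_eq (cochain_field cc) => // h; rewrite cbaseE.
have fK : field_along (@cbase R H G Psi k) (transport c).
  apply: field_eq (field_conj lf PsiE cN (@nhead_smooth R H k) fc) => // h.
  by rewrite cbaseE.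
have {fK}sK := (field_alongP _ _ cN cA).2 fK.
have dK h : diff_at src (Psi (nhead h)) (transport c h) =
    anchor_lift tau sigma (src (nhead h)) (diff_at src (Phi (nhead h)) (c h)).
  by rewrite (dsrc_conj lf PsiE) //; exact: cochain_tangent.
case: k c cc cN fc sK dK => [|n] c cc cN fc sK dK; split => //.
  move=> x; rewrite cbaseE dK; have [_ s0] := cochain_vertical x cc.
  by rewrite [nhead x]/(ident x) mor_ident s0 /anchor_lift (sigma0 lf) diff_at0.
exists (fun h => anchor_lift tau sigma (nbase h) (symbol Phi c h)) => h.
by rewrite [cbase Psi h]/(Psi (nhead h)) dK symbolE // nbase_ntail.
Qed.

Lemma delta_transport k (c : precochain H G k) : cochain Phi c ->
  delta Psi (transport c) = transport (delta Phi c).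
Proof.
move=> cc; have ccK := transport_cochain cc; apply/funext => h.
case: k c cc ccK h => [|n] c cc ccK h.
  rewrite delta0E // /transport delta0E //.
  have [tA sA] := cochain_vertical (tgt (nhead h)) cc.
  have [tB sB] := cochain_vertical (src (nhead h)) cc.
  by rewrite (conj_bivec lf PsiE).
rewrite deltaSE /transport deltaSE.
have [t1 t2 E] := div_point_vectors h cc.
have tf (j : 'I_n.+1) : tangent (Phi (nhead h)) (c (face j.+2 h)).
  by have := cochain_tangent (face j.+2 h) cc; rewrite nhead_face.
have tm := dmbar_tangent t1 t2 E; rewrite mbar_div_point in tm.
have linK := conj_lin lf (h := nhead h).
rewrite linK //; last exact: tangent_sumZ.
rewrite (@linear_sumZ _ _ _ _ _ linK) //.
(* The faces of index at least 2 keep h_1, so their terms are conjugated over the same arrow and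
   linearity suffices; the division term is the content of [conj_dmbar]. *)
congr (_ *: _ + _); last first.
  by apply: eq_bigr => j _; rewrite nhead_face.
have := @conj_dmbar _ _ _ _ _ _ _ lf PsiE (nhead h) (nhead (face 0 h)) (c (face 1 h)) (c (face 0 h))
  (div_point Phi h) (div_point Psi h) (nhead_src h).
rewrite -nhead_face1 => H1; apply/esym; apply: H1 => //.
Qed.

Lemma transport_cocycle k (c : precochain H G k) : cocycle Phi c ->
  cocycle Psi (transport c).
Proof.
move=> [cc dc]; split; first exact: transport_cochain.
rewrite delta_transport // dc; apply/funext => h.
have t0 := tangent0 (Phi (nhead h)).
have := conj_lin lf (-1) t0 t0; rewrite scaler0 addr0 /transport => E.
by rewrite [LHS]E scaleN1r addNr.
Qed.

Lemma transport_coboundary k (c : precochain H G k) : coboundary Phi c ->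
  coboundary Psi (transport c).
Proof.
case: k c => [c ->|n _ [b cb <-]].
  rewrite /coboundary /=; apply/funext => h.
  have t0 := tangent0 (Phi (nhead (h : nerve H 0))).
  have := conj_lin lf (-1) t0 t0; rewrite scaler0 addr0 /transport => E.
  by rewrite [LHS]E scaleN1r addNr.
by exists (transport b); [exact: transport_cochain|exact: delta_transport].
Qed.
End TransportCochain.

(** * The homotopy on cocycles *)

Section Homotopy.
Variables (R : realType) (H G : lieGroupoid R) (Phi Psi : morphism H G).
Variables (tau : obj H -> arr G) (sigma sigma' : obj H -> vec (obj G) -> vec (arr G)).
Hypothesis lf : lift_along (mor_obj Phi) tau sigma.
Hypothesis PsiE : forall h, Psi h = gmul (gmul (tau (tgt h)) (Phi h)) (ginv (tau (src h))).
Hypothesis lf' : lift_along (mor_obj Psi) (ginv \o tau) sigma'.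
Hypothesis PhiE : forall h,
  Phi h = gmul (gmul (ginv (tau (tgt h))) (Psi h)) (ginv (ginv (tau (src h)))).
Let th := theta Phi tau sigma sigma'.

(** The vector theta(ds c) sits at a unit. In degree 0 this is where it belongs; in higher degree
    right translation moves it to [Phi (nhead h)]. All values have zero source, so the condition on
    ds in [cochain] holds trivially. *)
Definition homotopy k (c : precochain H G k.+1) : precochain H G k :=
  match k return precochain H G k.+1 -> precochain H G k with
  | 0%N => fun c x => th x (symbol Phi c x)
  | n.+1 => fun c h => rvec (Phi (nhead h)) (th (nbase h) (symbol Phi c h))
  end c.

Lemma theta_vertical x u : tangent (mor_obj Phi x) u -> vertical (mor_obj Phi x) (th x u).
Proof.
by move=> tu; split; [exact: (theta_tangent lf PsiE lf')|exact: (dsrc_theta lf PsiE lf')].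
Qed.

Lemma homotopy_cochain k (c : precochain H G k.+1) : cochain Phi c ->
  cochain Phi (homotopy c).
Proof.
move=> cc; have cA := arr_cinfty G; have cN := nerve_cinfty H k.
have ft := field_theta lf PsiE lf' cN (@nbase_smooth R H k) (symbol_field cc).
have vt h := theta_vertical (symbol_tangent h cc).
case: k c cc cN ft vt => [|n] c cc cN ft vt.
  split; last by move=> x; have [_] := vt x; rewrite /nbase /= tgt_unit.
  apply/field_alongP => //; apply: field_eq ft => x.
    by rewrite /= /nbase /= tgt_unit.
  by rewrite /nbase /= tgt_unit.
have e h : tgt (Phi (@nhead R H n.+1 h)) = mor_obj Phi (nbase h) by rewrite mor_tgt.
have vt' h : vertical (tgt (Phi (nhead h))) (th (nbase h) (symbol Phi c h)).
  by rewrite e; exact: vt.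
split; last first.
  exists (fun=> 0) => h; have [tA sA] := vt' h.
  by rewrite [cbase Phi h]/(Phi (nhead h)) /= dsrc_rvec.
apply/field_alongP => //.
have sPh := smooth_map_comp (@nhead_smooth R H n.+1) (mor_smooth Phi).
have := field_dmul cN ft (field0 cN sPh).
move=> /(_ (fun h => etrans (src_unit _) (esym (e h)))).
move=> /(_ (fun h => etrans (vt h).2 (esym (diff_at0 _ _)))).
apply: field_eq => h /=; first by rewrite -e mul_unitl.
by rewrite /rvec -e.
Qed.

Lemma homotopy_formula k (c : precochain H G k.+1) : cocycle Phi c ->
  exists e : R, transport Psi (ginv \o tau) sigma' (transport Phi tau sigma c) - c =
    e *: delta Phi (homotopy c).
Proof.
move=> zc; have [cc _] := zc; have ch := homotopy_cochain cc.
have rt h := conj_roundtrip lf PsiE lf' PhiE (cochain_tangent h cc).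
have st h := symbol_tangent h cc.
have vt h := theta_vertical (st h).
case: k c zc cc ch rt st vt => [|n] c zc cc ch rt st vt.
  (* The differential of a 0-cochain is r + l with no sign, and for a 1-cocycle dt c at h is the
     symbol at tgt h. *)
  exists 1; rewrite scale1r; apply/funext => h.
  have -> : forall a b : precochain H G 1, (a - b) h = a h - b h by [].
  rewrite [X in X - _]rt addrC addKr delta0E //=.
  rewrite (cocycle_dtgt h zc) big_ord_recl big_ord0 addr0 expr0 scale1r.
  by rewrite ntail_face_ncons0 symbolE.
(* In higher degree the division term of delta carries a minus sign, so that delta of the homotopy
   is -r(theta s_1) - l(di(theta s_0)) + r(theta S), with s_i the symbol at face i and S the
   alternating sum over the other faces. *)
exists (-1); apply/funext => h.
have -> : forall a b : precochain H G n.+2, (a - b) h = a h - b h by [].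
have -> : forall a : precochain H G n.+2, (-1 *: a) h = -1 *: a h by [].
rewrite [X in X - _]rt addrC addKr deltaSE.
have eg : tgt (nhead (face 1 h)) = tgt (nhead h) by rewrite nhead_face1 tgt_mul // nhead_src.
have et : tgt (Phi (nhead h)) = mor_obj Phi (nbase h) by rewrite mor_tgt.
have es : src (Phi (nhead h)) = mor_obj Phi (nbase (face 0 h)) by rewrite mor_src nhead_src.
have b1 : nbase (face 1 h) = nbase h by rewrite /nbase eg.
have st1 : tangent (mor_obj Phi (nbase h)) (symbol Phi c (face 1 h)).
  by rewrite -b1; exact: st.
have bj (j : nat) : nbase (face j.+2 h) = nbase h by rewrite /nbase nhead_face.
have stj (j : nat) : tangent (mor_obj Phi (nbase h)) (symbol Phi c (face j.+2 h)).
  by rewrite -(bj j); exact: st.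
have linth a v w : tangent (mor_obj Phi (nbase h)) v -> tangent (mor_obj Phi (nbase h)) w ->
    th (nbase h) (a *: v + w) = a *: th (nbase h) v + th (nbase h) w.
  exact: (theta_lin lf PsiE lf').
have v1 := theta_vertical st1;
have v0 := vt (face 0 h).
have -> : dmbar (div_point Phi h) (homotopy c (face 1 h)) (homotopy c (face 0 h)) =
    bivec (Phi (nhead h)) (th (nbase h) (symbol Phi c (face 1 h)))
                          (th (nbase (face 0 h)) (symbol Phi c (face 0 h))).
  rewrite /homotopy b1 [nhead (face 1 h)]nhead_face1 mor_mul ?nhead_src //.
  case: v1 v0; rewrite -et -es => tA sA [tB sB].
  apply: dmbar_rvec => //; first by rewrite mor_src mor_tgt nhead_src.
  by rewrite -[LHS]/(Phi (nhead (face 1 h)), Phi (nhead (face 0 h))) nhead_face1 mor_mul ?nhead_src.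
have rlin a A B : vertical (tgt (Phi (nhead h))) A -> vertical (tgt (Phi (nhead h))) B ->
    rvec (Phi (nhead h)) (a *: A + B) = a *: rvec (Phi (nhead h)) A + rvec (Phi (nhead h)) B.
  by move=> [tA sA] [tB sB]; exact: rvec_lin.
have linr a v w : tangent (mor_obj Phi (nbase h)) v -> tangent (mor_obj Phi (nbase h)) w ->
    rvec (Phi (nhead h)) (th (nbase h) (a *: v + w)) =
    a *: rvec (Phi (nhead h)) (th (nbase h) v) + rvec (Phi (nhead h)) (th (nbase h) w).
  by move=> tv tw; rewrite linth // rlin // et; exact: theta_vertical.
pose S := \sum_(j < n.+1) (-1) ^+ j *: symbol Phi c (face j.+2 h).
have rsum : \sum_(j < n.+1) (-1) ^+ j *: homotopy c (face j.+2 h) =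
    rvec (Phi (nhead h)) (th (nbase h) S).
  rewrite (linear_sumZ linr) //; apply: eq_bigr => j _; rewrite /homotopy bj nhead_face //.
(* The term j = 0 of [cocycle_dtgt] is the symbol at face 1; the others are those of S with the
   opposite sign, their index being shifted by one. *)
have dt : diff_at tgt (Phi (nhead h)) (c h) = symbol Phi c (face 1 h) - S.
  rewrite (cocycle_dtgt h zc) big_ord_recl expr0 scale1r ntail_face_ncons //; congr (_ + _).
  rewrite -sumrN; apply: eq_bigr => j _; rewrite ntail_face_ncons //.
  by rewrite lift0 exprS mulN1r scaleNr.
have tS : tangent (mor_obj Phi (nbase h)) S by apply: tangent_sumZ => j.
have vS := theta_vertical tS.
rewrite rsum symbolE // dt -/th [tgt (nhead h)]/(nbase h).
have -> : src (nhead h) = nbase (face 0 h) by rewrite /nbase nhead_src.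
rewrite -[ntail h]/(face 0 h).
rewrite addrC -scaleN1r linth //.
set A := th _ (symbol Phi c (face 1 h)); set B := th _ (symbol Phi c (face 0 h)).
have vA : vertical (tgt (Phi (nhead h))) A by rewrite et.
have vB : vertical (src (Phi (nhead h))) B by rewrite es; exact: v0.
have vT : vertical (tgt (Phi (nhead h))) (th (nbase h) S) by rewrite et.
rewrite (bivec_split (vertical_lincomb (-1) vT vA) vB) (bivec_split vA vB).
rewrite rlin -?et // !scaleN1r opprD opprK.
by rewrite -addrA addrC.
Qed.
End Homotopy.

(** * Bump functions *)

Section Flat.
Variable R : realType.

(* The functions t^-k exp(-1/t), extended by 0 to t <= 0: their span is closed
   under differentiation. *)
Definition flat (k : nat) (t : R) : R :=
  if 0 < t then t^-1 ^+ k * expR (- t^-1) else 0.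

Lemma flat_ge0 k t : 0 <= flat k t.
Proof.
rewrite /flat; case: ltP => // t0.
by rewrite mulr_ge0 ?expR_ge0 // exprn_ge0 // invr_ge0 ltW.
Qed.

Lemma flat_gt0 k t : 0 < t -> 0 < flat k t.
Proof. by move=> t0; rewrite /flat t0 mulr_gt0 ?expR_gt0 // exprn_gt0 // invr_gt0. Qed.

Lemma flat_le0 k t : t <= 0 -> flat k t = 0.
Proof. by rewrite /flat leNgt => /negbTE ->. Qed.

(** From exp(u) >= u^(k+1) / (k+1)! at u = 1/t. A bound linear in t is enough, as k is arbitrary. *)
Lemma flat_bound k t : flat k t <= (k.+1)`!%:R * `|t|.
Proof.
have [t0|t0] := ltP 0 t; last by rewrite flat_le0 // mulr_ge0.
have s0 : 0 < t^-1 by rewrite invr_gt0.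
rewrite /flat t0 gtr0_norm // expRN ler_pdivrMr ?expR_gt0 //.
apply: (@le_trans _ _ ((k.+1)`!%:R * t * (t^-1 ^+ k.+1 / (k.+1)`!%:R))).
  rewrite exprS mulrA -[_ * t * _]mulrA mulVKf ?gt_eqF //.
  by rewrite [leRHS]mulrAC divff ?gt_eqF // mul1r.
rewrite ler_pM2l ?mulr_gt0 //.
by apply: le_trans (expR_ge1Dxn k (ltW s0)); rewrite lerDr.
Qed.

(** The delicate point is t = 0: for h > 0 the difference quotient of [flat k] is [flat k.+1 h],
    which [flat_bound] sends to 0. *)
Lemma is_derive_flat (k : nat) (t : R) :
  is_derive t 1 (flat k)
    (flat k.+2 t - k%:R * flat k.+1 t).
Proof.
have [t0|t0|->] := ltgtP t 0.
- rewrite !flat_le0 ?ltW // mulr0 subrr.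
  have d := is_derive_cst (0 : R) t (1 : R); apply: near_eq_is_derive d.
  have nt : nbhs t [set u | u < 0] by apply: open_nbhs_nbhs; split => //; exact: open_lt.
  apply: near_impl nt => u /= u0.
  by rewrite flat_le0 // ltW.
- have t1 : t != 0 by rewrite gt_eqF.
  apply: (@near_eq_is_derive R R R ((fun s : R => s ^+ k * expR (- s)) \o (fun u => u^-1))).
    have nt : nbhs t [set u | 0 < u] by apply: open_nbhs_nbhs; split => //; exact: open_gt.
    apply: near_impl nt => u /= u0.
    by rewrite /flat u0.
  have d0 : is_derive t 1 (fun u : R => u^-1) (- t ^- 2).
    by have := is_deriveV t1 (is_derive_id t (1 : R)); rewrite [_ *: _]mulr1.
  have d1 : is_derive t^-1 1 (fun s : R => expR (- s)) (- expR (- t^-1)).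
    have := is_derive1_comp (is_derive_expR (- t^-1)) (is_deriveNid (t^-1) (1 : R)).
    by rewrite mulrN1.
  have := is_deriveX k (is_derive_id (t^-1) (1 : R)); rewrite exprfctE => d2.
  have d3 := is_derive1_comp (is_deriveM d2 d1) d0.
  have {d3} : is_derive t 1 ((fun s : R => s ^+ k * expR (- s)) \o (fun u => u^-1)) _ := d3.
  congr is_derive; rewrite /flat t0 /GRing.scale /= mulr1 -exprVn; set e := expR _.
  by move: t^-1 e {d0 d1 d2} => s e; case: k => [|k] /=; rewrite ?expr0 !exprS; ring.
rewrite !flat_le0 // mulr0 subrr; apply/is_derive1P.
apply: norm_cvg0.
have lim : (fun h => (k.+2)`!%:R * `|h|) @ (0 : R)^' --> (0 : R).
  rewrite -[X in _ --> X](mulr0 (k.+2)`!%:R); apply: cvgM; first exact: cvg_cst.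
  rewrite -[X in _ --> X](@normr0 _ R); apply: cvg_norm; exact: nbhs_dnbhs.
apply: (@squeeze_cvgr _ _ _ _ (cst 0) _ _ _ _ (@cvg_cst _ _ _ _ _) lim).
near=> h; rewrite normr_ge0 /= addr0 [flat k 0]flat_le0 // subr0.
apply: le_trans (flat_bound k.+1 h); rewrite /flat.
case: ltP => h0; last by rewrite mulr0 normr0.
rewrite exprS mulrA ger0_norm //.
by rewrite !mulr_ge0 ?expR_ge0 ?exprn_ge0 ?invr_ge0 // ltW.
Unshelve. all: by end_near. Qed.
End Flat.

Lemma flat_smooth (R : realType) (k : nat) (z : 'rV[R]_1) :
  smooth_near z (fun z : 'rV[R]_1 => flat k (z ord0 ord0)).
Proof.
exists setT; split => // [|m]; first exact: openT.
have cf l (x : 'rV[R]_1) : {for x, continuous (fun z : 'rV[R]_1 => flat l (z ord0 ord0))}.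
  apply: (continuous_comp (@coord_continuous _ _ _ ord0 ord0 x)).
  exact: is_derive1_cont (is_derive_flat l (x ord0 ord0)).
elim: m k => [|m IH] k; first by split => // x _; exact: cf.
split; first by move=> x _; exact: cf.
move=> i.
have d (x : 'rV[R]_1) : is_derive x (delta_mx ord0 i) (fun z : 'rV[R]_1 => flat k (z ord0 ord0))
    (flat k.+2 (x ord0 ord0) - k%:R * flat k.+1 (x ord0 ord0)).
  apply/derivable_line.
  have -> : (fun t : R => flat k ((t *: delta_mx ord0 i + x) ord0 ord0)) =
      flat k \o (fun t : R => t * 1 + x ord0 ord0).
    by apply/funext => t; rewrite !mxE (ord1 i) !eqxx.
  have da := is_derive_affine 1 (x ord0 ord0) 0.
  rewrite -[X in is_derive _ _ _ X]mulr1; apply: is_derive1_comp da.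
  by rewrite mul0r add0r; exact: is_derive_flat.
split; first by move=> x _; case: (d x).
apply: (@Ck_eq _ _ _ _ (fun z : 'rV[R]_1 => flat k.+2 (z ord0 ord0) + (- k%:R) * flat k.+1 (z ord0 ord0))).
  by move=> x; have [_ ->] := d x; rewrite mulNr.
have oT := @openT 'rV[R]_1; apply: CkD => //; apply: CkM => //; exact: Ck_cst.
Qed.

Lemma smooth_flat (R : realType) (X : smoothSpace R) (k : nat) (x : X) (f : X -> R) : cinfty X ->
  smooth_at x f -> smooth_at x (fun y => flat k (f y)).
Proof.
move=> cX sf.
have H := @cinfty_comp _ _ cX x 1 (fun=> f) (fun z => flat k (z ord0 ord0)) (fun=> sf).
apply: (smooth_ext _ (H _)) => [y|]; first by rewrite mxE.
exact: flat_smooth.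
Qed.

(* The quotient u(2s - q) / (u(2s - q) + u(q - s)), with u = exp(-1/t) for
   t > 0 and q the squared distance to x in a chart, is 1 for q <= s and 0 for
   q >= 2s. *)
Lemma bump_exists (R : realType) (N : smoothSpace R) (W : set N) (x : N) :
  manifold N -> hausdorff_space N -> open W -> W x ->
  exists f : N -> R, [/\ forall y, smooth_at y f,
    forall y, W y \/ \forall z \near y, f z = 0 & \forall z \near x, f z = 1].
Proof.
move=> mN hN oW Wx; have cN := manifold_cinfty mN.
have [n /(_ x)[U [phi [psi [cU Ux]]]]] := manifold_chart mN.
have [r r0 rP] : exists2 r : R, 0 < r &
    forall z, `|phi x - z| <= r -> [/\ U (psi z), phi (psi z) = z & W (psi z)].
  have nW : nbhs (phi x) [set z | W (psi z)].
    apply: (near_comp (chart_psi_cont cU Ux) (P := W)); rewrite (chartK cU) //.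
    exact: open_nbhs_nbhs.
  have /nbhs_closedballP[r rP] := near_and (chart_near_inv cU Ux) nW.
  exists r%:num => // z zr; have : closed_ball (phi x) r%:num z by rewrite closed_ballE.
  by move=> /rP[[]].
pose K := psi @` [set z | `|phi x - z| <= r].
(* Here the Hausdorff axiom enters: K is compact, hence closed in all of N, so that extending f by 0
   outside the chart creates no bad points on the boundary of U. *)
have cK : closed K.
  apply: (compact_closed hN); apply: continuous_compact.
    apply: continuous_in_subspaceT => z; rewrite inE => /rP[Uz zE _].
    by rewrite -zE; exact: chart_psi_cont cU _ Uz.
  apply: bounded_closed_compact; last exact: closed_closed_ball_.
  exists (`|phi x| + r); split; first exact: num_real.
  move=> M M1 z zr; rewrite -[z](subrK (phi x)) addrC; apply: le_trans (ler_normD _ _) _.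
  by rewrite distrC; apply: ltW; apply: le_lt_trans M1; rewrite lerD2l.
have KE y : U y -> `|phi x - phi y| <= r -> K y.
  by move=> Uy yr; exists (phi y) => //; exact: (chartK cU).
have KU y : K y -> U y /\ W y by move=> [z /rP[? _ ?] <-].
(* With 2 s = r^2, a sum of squares below 2 s bounds each coordinate by r, so the support lies in
   K. *)
pose s := r ^+ 2 / 2; have s0 : 0 < s by rewrite divr_gt0 // exprn_gt0.
pose q y := \sum_i (phi y ord0 i - phi x ord0 i) ^+ 2.
pose den y := flat 0 (2 * s - q y) + flat 0 (q y - s).
(* As s < 2 s, one of 2 s - q and q - s is positive at every point. *)
have den0 y : den y != 0.
  have [qs|qs] := leP (2 * s) (q y).
    by rewrite gt_eqF // ltr_wpDl ?flat_ge0 // flat_gt0 //; lra.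
  by rewrite gt_eqF // ltr_pwDl ?flat_ge0 // flat_gt0 // subr_gt0.
have q_small y : q y < 2 * s -> `|phi x - phi y| <= r.
  move=> qy; apply/rV_norm_leP => [|i]; first exact: ltW.
  rewrite !mxE -ler_sqr ?nnegrE ?normr_ge0 ?(ltW r0) // real_normK ?num_real // -sqrrN opprB.
  apply: le_trans (ltW (le_lt_trans _ qy)) _; last by rewrite /s mulrC divfK.
  by rewrite /q (bigD1 i) //= lerDl; apply: sumr_ge0 => j _; exact: sqr_ge0.
pose f y := if `[< U y >] then flat 0 (2 * s - q y) / den y else 0.
have f0 y : ~ K y -> f y = 0.
  rewrite /f; case: asboolP => // Uy nK; rewrite flat_le0 ?mul0r // subr_le0 leNgt.
  by apply/negP => /q_small/(KE _ Uy).
have nf0 y : ~ K y -> \forall z \near y, f z = 0.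
  move=> nK; apply: near_impl f0 _; apply: open_nbhs_nbhs; split => //.
  exact: closed_openC.
have fE y : U y -> \forall z \near y, flat 0 (2 * s - q z) / den z = f z.
  by move=> Uy; apply: near_impl (chart_near cU Uy) => z Uz; rewrite /f asboolT.
have sq y : U y -> smooth_at y q.
  move=> Uy; apply: (smooth_sum cN) => i _.
  have sc : smooth_at y (fun z => phi z ord0 i - phi x ord0 i).
    by apply: (smoothD cN); [exact: (chart_coord_smooth cU)|exact: (smooth_cst cN)].
  by apply: smooth_ext (smoothM cN sc sc) => z; rewrite expr2.
exists f; split.
- move=> y; have [Uy|nU] := pselect (U y); last first.
    apply: (cinfty_germ cN _ (smooth_cst cN y 0)); apply: near_impl (nf0 y _) => [z ->//|].
    by move=> /KU[].
  apply: (cinfty_germ cN (fE y Uy)).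
  have s1 : smooth_at y (fun y => flat 0 (2 * s - q y)).
    apply: (smooth_flat 0 cN); apply: (smooth_ext (f := fun z => 2 * s + - 1 * q z)).
      by move=> z; rewrite mulN1r.
    apply: (smoothD cN); first exact: (smooth_cst cN).
    by apply: (smoothM cN); [exact: (smooth_cst cN)|exact: sq].
  apply: (smoothM cN) => //; apply: (smoothV cN) => //; apply: (smoothD cN) => //.
  apply: (smooth_flat 0 cN); apply: (smoothD cN); last exact: (smooth_cst cN).
  exact: sq.
- by move=> y; have [/KU[_ ?]|/nf0] := pselect (K y); [left|right].
have qx : q x = 0 by rewrite /q big1 // => i _; rewrite subrr expr0n.
have nq : nbhs x [set y | q y < s].
  apply: (near_comp (cinfty_cont cN (sq x Ux)) (P := [set t | t < s])).
  by apply: open_nbhs_nbhs; split; [exact: open_lt|rewrite /= qx].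
apply: near_impl (near_and (fE x Ux) nq) => y [<- qy].
have := den0 y; rewrite /den [flat 0 (q y - s)]flat_le0 ?subr_le0 ?ltW // addr0.
exact: divff.
Qed.

(** * Lifting tangent vectors smoothly along a submersion *)

Section Determinant.
Variables (R : realType) (X : smoothSpace R) (m : nat) (x : X) (A : X -> 'M[R]_m).
Hypotheses (cX : cinfty X) (sA : forall i j, smooth_at x (fun y => A y i j)).

Lemma smooth_det : smooth_at x (fun y => \det (A y)).
Proof.
apply: (smooth_sum cX) => s _; apply: (smoothM cX); first exact: (smooth_cst cX).
exact: (smooth_prod cX).
Qed.
End Determinant.

Lemma smooth_adj (R : realType) (X : smoothSpace R) (m : nat) (x : X) (A : X -> 'M[R]_m) i j :
  cinfty X -> (forall i j, smooth_at x (fun y => A y i j)) ->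
  smooth_at x (fun y => \adj (A y) i j).
Proof.
move=> cX sA; apply: (smooth_ext (f := fun y => cofactor (A y) j i)) => [y|]; first by rewrite mxE.
apply: (smoothM cX); first exact: (smooth_cst cX).
apply: (smooth_det cX) => k l.
by apply: smooth_ext (sA (lift j k) (lift i l)) => y; rewrite !mxE.
Qed.

Section Lifts.
Variables (R : realType) (N X Z : smoothSpace R) (F : X -> Z) (tau : N -> X).
Hypotheses (cN : cinfty N) (mX : manifold X) (mZ : manifold Z).
Hypotheses (sF : submersion F) (stau : smooth_map tau).

Lemma chart_vec_smooth n U phi psi (x : X) (j : 'I_n) f : chart U phi psi -> U x ->
  smooth_at x f -> smooth_at x (fun y => chart_vec phi psi y j f).
Proof.
move=> cU Ux sf; have cX := manifold_cinfty mX.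
have sD := smooth_near_derive j ((chart_smooth cU _ Ux).1 sf).
apply: (cinfty_germ cX _ (chart_smooth_pull mX cU Ux sD)).
by apply: near_impl (cinfty_open cX sf) => y sy; rewrite /= chart_vecE.
Qed.

(* A right inverse B of the Jacobian A at x0 yields the right inverse
   B (A B)^-1 of A at nearby points. *)
Lemma local_lift (x0 : N) : exists (W : set N) (sigma : N -> vec Z -> vec X), [/\ open W, W x0,
  forall x u, W x -> tangent (F (tau x)) u ->
    tangent (tau x) (sigma x u) /\ diff_at F (tau x) (sigma x u) = u,
  forall x a u w, sigma x (a *: u + w) = a *: sigma x u + sigma x w &
  forall (Y : smoothSpace R) (a : Y -> N) c y f, cinfty Y -> smooth_map a ->
    field_along (F \o (tau \o a)) c -> W (a y) -> smooth_at (tau (a y)) f ->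
    smooth_at y (fun y => sigma (a y) (c y) f)].
Proof.
have cZ := manifold_cinfty mZ.
have [[cF smF] subF] := sF; have [ctau smtau] := stau.
have [n /(_ (tau x0))[U [phi [psi [cU Ux]]]]] := manifold_chart mX.
have [m /(_ (F (tau x0)))[V [chi [om [cV Vx]]]]] := manifold_chart mZ.
pose J x i j := chart_vec phi psi (tau x) j (fun y => chi (F y) ord0 i).
have /choice[w wP] i : exists w : vec X, tangent (tau x0) w /\
    diff_at F (tau x0) w = chart_vec chi om (F (tau x0)) i.
  by have [w tw dw] := subF (tau x0) _ (chart_vec_tangent mZ cV i Vx); exists w.
pose B : 'M[R]_(n, m) := \matrix_(j, i) w i (fun y => phi y ord0 j).
pose A x : 'M[R]_(m, n) := \matrix_(i, j) J x i j.
have schi x i : V (F (tau x)) -> smooth_at (tau x) (fun y => chi (F y) ord0 i).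
  by move=> Vx'; apply: (smF _ (fun z => chi z ord0 i)); exact: (chart_coord_smooth cV).
have sA x i j : U (tau x) -> V (F (tau x)) -> smooth_at x (fun y => A y i j).
  move=> Ux' Vx'; apply: (smooth_ext (f := fun y => J y i j)) => [y|]; first by rewrite mxE.
  apply: (smtau _ (fun y => chart_vec phi psi y j (fun y => chi (F y) ord0 i))).
  by apply: (chart_vec_smooth _ cU) => //; exact: schi.
have sAB x i k : U (tau x) -> V (F (tau x)) -> smooth_at x (fun y => (A y *m B) i k).
  move=> Ux' Vx'; apply: (smooth_ext (f := fun y => \sum_j A y i j * B j k)) => [y|].
    by rewrite mxE.
  apply: (smooth_sum cN) => j _; apply: (smoothM cN); first exact: sA.
  exact: (smooth_cst cN).
have AB0 : A x0 *m B = 1%:M.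
  apply/matrixP => k i; rewrite !mxE eq_sym.
  apply: etrans (chart_vec_coord cV k i Vx); rewrite -(wP i).2 /diff_at asboolT; last first.
    exact: (chart_coord_smooth cV).
  rewrite [in RHS](chart_vec_sum mX cU Ux (wP i).1) /=.
  by apply: eq_bigr => j _; rewrite !mxE mulrC.
pose dt x := \det (A x *m B).
(* Through the adjugate the entries of (A B)^-1 are polynomials in those of A B divided by the
   determinant, which makes their smoothness evident. *)
pose M x : 'M[R]_(n, m) := (dt x)^-1 *: (B *m \adj (A x *m B)).
have AM x : dt x != 0 -> A x *m M x = 1%:M.
  move=> d0; rewrite /M -scalemxAr mulmxA mul_mx_adj -/(dt x).
  by rewrite -mul_scalar_mx -scalar_mxM mulVf.
pose W0 := [set x | [/\ U (tau x), V (F (tau x)) & dt x != 0]].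
have sM x j i : W0 x -> smooth_at x (fun y => M y j i).
  move=> [Ux' Vx' d0].
  apply: (smooth_ext (f := fun y => (dt y)^-1 * \sum_k B j k * \adj (A y *m B) k i)) => [y|].
    by rewrite !mxE.
  have sAB' := fun i k => sAB x i k Ux' Vx'.
  apply: (smoothM cN); first by apply: (smoothV cN) => //; exact: (smooth_det cN).
  apply: (smooth_sum cN) => k _; apply: (smoothM cN); first exact: (smooth_cst cN).
  exact: (smooth_adj _ _ cN).
pose sigma x (u : vec Z) : vec X :=
  \sum_j (\sum_i M x j i * u (fun z => chi z ord0 i)) *: chart_vec phi psi (tau x) j.
exists W0°, sigma; split; first exact: open_interior.
- have nU : nbhs x0 [set x | U (tau x)].
    by apply: (near_comp (ctau x0) (P := U)); exact: (chart_near cU).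
  have nV : nbhs x0 [set x | V (F (tau x))].
    apply: (near_comp (h := F \o tau) (P := V)); last exact: (chart_near cV).
    by apply: continuous_comp; [exact: ctau|exact: cF].
  have sd : smooth_at x0 dt by apply: (smooth_det cN) => i k; exact: sAB.
  have nd : nbhs x0 [set x | dt x != 0].
    apply: (near_comp (cinfty_cont cN sd) (P := [set t | t != 0])).
    by apply: open_nbhs_nbhs; split; [exact: open_neq|rewrite /dt /= AB0 det1 oner_neq0].
  by apply: near_impl (near_and nU (near_and nV nd)) => x [? []].
- move=> x u /interior_subset[Ux' Vx' d0] tu.
  have tx : tangent (tau x) (sigma x u).
    by apply: tangent_sumZ => j; exact: (chart_vec_tangent mX cU).
  split => //.
  have tFx := diff_at_tangent cZ sF.1 tx.
  apply: etrans (chart_vec_sum mZ cV Vx' tFx) (etrans _ (esym (chart_vec_sum mZ cV Vx' tu))).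
  apply/funext => f; apply: eq_bigr => k _; congr (_ * _).
  rewrite /diff_at asboolT; last exact: (chart_coord_smooth cV).
  have E (v : 'I_n -> R) (e : 'I_n -> vec X) f' :
      (\sum_j v j *: e j) f' = \sum_j v j * e j f'.
    by elim/big_rec2: _ => // j b c _ <-.
  rewrite /= /sigma E.
  transitivity (\sum_i (A x *m M x) k i * u (fun z => chi z ord0 i)).
    under eq_bigr do rewrite mulr_suml.
    rewrite exchange_big /=; apply: eq_bigr => i _; rewrite [in RHS]mxE mulr_suml.
    apply: eq_bigr => j _; rewrite [A x k j]mxE -[chart_vec _ _ _ _ _]/(J x k j).
    by rewrite mulrC mulrA.
  rewrite AM // (bigD1 k) //= big1 ?addr0 => [|i /negbTE ik]; rewrite !mxE.
    by rewrite eqxx mul1r.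
  by rewrite eq_sym ik mul0r.
- move=> x a u v; rewrite /sigma scaler_sumr -big_split /=; apply: eq_bigr => j _.
  rewrite scalerA -scalerDl; congr (_ *: _); rewrite mulr_sumr -big_split /=.
  apply: eq_bigr => i _; rewrite [(a *: u + v) _]/(a * u _ + v _) mulrDr.
  by rewrite mulrCA.
move=> Y a c y f cY [ca sa] [sb tc sc] /interior_subset Wy sf; have [Uy Vy d0] := Wy.
apply: (smooth_ext (f := fun y => \sum_j (\sum_i M (a y) j i * c y (fun z => chi z ord0 i)) *
    chart_vec phi psi (tau (a y)) j f)) => [y'|].
  by rewrite /sigma; elim/big_rec2: _ => // j b d _ ->.
apply: (smooth_sum cY) => j _; apply: (smoothM cY).
  apply: (smooth_sum cY) => i _; apply: (smoothM cY).
    by apply: (sa _ (fun x => M x j i)); exact: sM.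
  by apply: sc; exact: (chart_coord_smooth cV).
apply: (sa _ (fun x => chart_vec phi psi (tau x) j f)).
by apply: (smtau _ (fun x => chart_vec phi psi x j f)); exact: (chart_vec_smooth _ cU).
Qed.
End Lifts.

Section Gluing.
Variables (R : realType) (N X Z : smoothSpace R) (F : X -> Z) (tau : N -> X).
Hypotheses (mN : manifold N) (hN : hausdorff_space N) (mX : manifold X) (mZ : manifold Z).
Hypotheses (sF : submersion F) (stau : smooth_map tau).
Let cN := manifold_cinfty mN.

(* A global smooth family of linear maps T x with dF \o T x = f x *: id; such
   families are obtained by multiplying local lifts by bump functions. *)
Record scaled_lift (f : N -> R) (T : N -> vec Z -> vec X) : Prop := ScaledLift {
  scaled_smooth : forall x, smooth_at x f;
  scaled_tangent : forall x u, tangent (F (tau x)) u -> tangent (tau x) (T x u);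
  scaled_lin : forall x a u w, T x (a *: u + w) = a *: T x u + T x w;
  scaled_diff : forall x u, tangent (F (tau x)) u -> diff_at F (tau x) (T x u) = f x *: u;
  scaled_field : forall (Y : smoothSpace R) (a : Y -> N) c, cinfty Y -> smooth_map a ->
    field_along (F \o (tau \o a)) c -> field_along (tau \o a) (fun y => T (a y) (c y))
}.

Lemma scaled_lift0 : scaled_lift (fun=> 0) (fun _ _ => 0).
Proof.
split.
- by move=> x; exact: (smooth_cst cN).
- by move=> x u _; exact: tangent0.
- by move=> x a u w; rewrite scaler0 addr0.
- by move=> x u _; rewrite diff_at0 scale0r.
- by move=> Y a c cY sa _; apply: (field0 cY); exact: smooth_map_comp.
Qed.

(** The factor f + (1 - f) g is 1 wherever f or g is, and the second lift contributes nothing where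
    f = 1. Iterating therefore yields factor exactly 1 on growing sets without normalising by a
    locally finite sum. *)
Lemma scaled_liftD f T g S : scaled_lift f T -> scaled_lift g S ->
  scaled_lift (fun x => f x + (1 - f x) * g x) (fun x u => (1 - f x) *: S x u + T x u).
Proof.
move=> hf hg; have s1 x : smooth_at x (fun x => 1 - f x).
  apply: (smooth_ext (f := fun x => 1 + - 1 * f x)) => [y|]; first by rewrite mulN1r.
  apply: (smoothD cN); first exact: (smooth_cst cN).
  by apply: (smoothM cN); [exact: (smooth_cst cN)|exact: scaled_smooth hf x].
split.
- move=> x; apply: (smoothD cN); first exact: scaled_smooth hf x.
  by apply: (smoothM cN) => //; exact: scaled_smooth hg x.
- by move=> x u tu; apply: tangent_lincomb; [exact: scaled_tangent hg _ _ tu|exact: scaled_tangent hf _ _ tu].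
- move=> x a u w; rewrite (scaled_lin hf) (scaled_lin hg) !scalerDr !scalerA mulrC.
  by rewrite addrACA.
- move=> x u tu; rewrite diff_at_lincomb (scaled_diff hf) // (scaled_diff hg) // scalerA -scalerDl.
  by rewrite addrC.
- move=> Y a c cY sa fc; apply: (field_lincomb cY (a := fun y => 1 - f (a y))).
  + by move=> y; exact: (sa.2 _ _ (s1 _)).
  + exact: scaled_field hg _ _ _ _ _ _.
  + exact: scaled_field hf _ _ _ _ _ _.
Qed.

Lemma scaled_lift_local (x0 : N) : exists f T, scaled_lift f T /\ \forall x \near x0, f x = 1.
Proof.
have [W [sg [oW Wx sgP lin sm]]] := local_lift cN mX mZ sF stau x0.
have [f [sf fW f1]] := bump_exists mN hN oW Wx.
exists f, (fun x u => f x *: sg x u); split => //.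
have fP x : W x \/ f x = 0 by have [|/nbhs_singleton] := fW x; [left|right].
split => //.
- move=> x u tu; have [Wx'|->] := fP x; last by rewrite scale0r; exact: tangent0.
  by rewrite -[_ *: _]addr0; apply: tangent_lincomb; [case: (sgP x u)|exact: tangent0].
- by move=> x a u w; rewrite lin scalerDr !scalerA mulrC.
- move=> x u tu; have [Wx'|->] := fP x; last by rewrite !scale0r diff_at0.
  by rewrite -[_ *: _]addr0 diff_at_lincomb diff_at0 addr0; have [_ ->] := sgP x u Wx' tu.
move=> Y a c cY sa fc; split; first exact: smooth_map_comp.
  move=> y; have [Wy|->] := fP (a y); last by rewrite scale0r; exact: tangent0.
  rewrite -[_ *: _]addr0; apply: tangent_lincomb; last exact: tangent0.
  by have [] := sgP _ _ Wy (field_tangent fc y).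
move=> y g sg'; have [Wy|nf] := fW (a y).
  by apply: (smoothM cY); [exact: (sa.2 _ _ (sf _))|exact: sm].
apply: (cinfty_germ cY _ (smooth_cst cY y 0)).
apply: near_impl (near_comp (sa.1 y) nf) => y' /= fy'.
by rewrite -[RHS]/(f (a y') * sg (a y') (c y') g) fy' mul0r.
Qed.

(** The sets of a countable base on which some scaled lift has factor 1 cover N. Adding these lifts
    one by one gives a sequence that is eventually stationary near each point. *)
Lemma lift_exists : exists T, scaled_lift (fun=> 1) T.
Proof.
have [[B cB [oB bB]] _] := mN.
have /choice[p pP] (b : set N) : exists p : (N -> R) * (N -> vec Z -> vec X), scaled_lift p.1 p.2 /\
    ((exists f T, scaled_lift f T /\ b `<=` [set x | f x = 1]) -> b `<=` [set x | p.1 x = 1]).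
  have [[f [T [fT bf]]]|nb] := pselect (exists f T, scaled_lift f T /\ b `<=` [set x | f x = 1]).
    by exists (f, T).
  by exists (fun=> 0, fun _ _ => 0); split => //; exact: scaled_lift0.
have /countable_injP[e eI] := cB.
have /choice[g gP] (n : nat) : exists b, (exists2 b', B b' & e b' = n) -> B b /\ e b = n.
  by have [[b Bb <-]|nb] := pselect (exists2 b', B b' & e b' = n); [exists b|exists set0].
(* The map g inverts the enumeration e of the base; stage m.+1 adds the lift attached to the base
   set of number m. *)
pose S := fix S n := if n is m.+1 then
  (fun x => (S m).1 x + (1 - (S m).1 x) * (p (g m)).1 x,
   fun x u => (1 - (S m).1 x) *: (p (g m)).2 x u + (S m).2 x u) else (fun=> 0, fun _ _ => 0).
have SP n : scaled_lift (S n).1 (S n).2.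
  elim: n => [|n IH]; first exact: scaled_lift0.
  by apply: scaled_liftD => //; have [] := pP (g n).
have Sle n k x : (S n).1 x = 1 -> (S (k + n)%N).1 x = 1 /\ (S (k + n)%N).2 x = (S n).2 x.
  move=> Sn; elim: k => [//|k [E1 E2]]; rewrite addSn /= E1 subrr mul0r addr0; split => //.
  by apply/funext => u; rewrite scale0r add0r E2.
have Seq n k x : (S n).1 x = 1 -> (S k).1 x = 1 -> (S n).2 x = (S k).2 x.
  move=> Sn Sk; have [nk|/ltnW kn] := leqP n k.
    by have [_ <-] := Sle n (k - n)%N x Sn; rewrite subnK.
  by have [_ <-] := Sle k (n - k)%N x Sk; rewrite subnK.
have cover (x : N) : exists n, \forall y \near x, (S n).1 y = 1.
  have [f [T [fT nf]]] := scaled_lift_local x.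
  have [b [Bb bx] bf] := bB x _ nf.
  have [Bg] : B (g (e b)) /\ e (g (e b)) = e b by apply: gP; exists b.
  move/eI => /(_ (mem_set Bg) (mem_set Bb)) gb.
  exists (e b).+1; have bo : nbhs x b by apply: open_nbhs_nbhs; split => //; exact: oB.
  have [_ pf] := pP (g (e b)).
  apply: near_impl bo => y byy /=; rewrite pf ?mulr1 1?addrC ?subrK //=; last by rewrite gb.
  by rewrite gb; exists f, T.
(* The index J x need not vary smoothly with x: by [Seq] all stages with factor 1 at x give the same
   map there, so near x the result is one fixed stage. *)
have /choice[J JP] x : exists n, (S n).1 x = 1.
  by have [n /nbhs_singleton] := cover x; exists n.
exists (fun x => (S (J x)).2 x); split.
- by move=> x; exact: (smooth_cst cN).
- by move=> x u; exact: scaled_tangent (SP _) _ _.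
- by move=> x a u w; exact: scaled_lin (SP _) _ _ _ _.
- by move=> x u tu; rewrite (scaled_diff (SP _)) // JP.
move=> Y a c cY sa fc; split; first exact: smooth_map_comp.
  by move=> y; exact: scaled_tangent (SP _) _ _ (field_tangent fc y).
move=> y f sf; have [n nS] := cover (a y).
apply: (cinfty_germ cY _ (field_smooth (scaled_field (SP n) cY sa fc) sf)).
apply: near_impl (near_comp (sa.1 y) nS) => y' /= Sn.
by rewrite (Seq _ _ _ Sn (JP (a y'))).
Qed.
End Gluing.

(** * The isomorphism *)

Lemma lift_along_exists (R : realType) (N : smoothSpace R) (G : lieGroupoid R)
    (phi : N -> obj G) (tau : N -> arr G) : manifold N -> hausdorff_space N ->
  smooth_map tau -> (forall x, src (tau x) = phi x) ->
  exists sigma, lift_along phi tau sigma.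
Proof.
move=> mN hN stau /funext <-.
have [T lT] := lift_exists mN hN (arr_manifold G) (obj_manifold G) (src_submersion G) stau.
exists T; split => //.
- exact: scaled_tangent lT.
- by move=> x a u w _ _; exact: scaled_lin lT _ _ _ _.
- by move=> x u tu; rewrite (scaled_diff lT) // scale1r.
- exact: scaled_field lT.
Qed.

Lemma dsrc_bivec (R : realType) (G : lieGroupoid R) (g : arr G) A B :
  vertical (tgt g) A -> vertical (src g) B ->
  diff_at src g (bivec g A B) = diff_at tgt (ident (src g)) B.
Proof.
move=> vA vB; have [tB dB] := dinv_vertical vB; have rA := rvec_tangent vA.
case: vA vB => tA sA [tB' sB].
rewrite /bivec -{1}(mul_unitr g) dsrc_mul ?tgt_unit ?dsrc_rvec //.
by rewrite -{1}ginv_ident dsrc_inv.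
Qed.

(* The anchor of a 0-cocycle vanishes: take sources of its differential at units. *)
Lemma cocycle0_dtgt (R : realType) (H G : lieGroupoid R) (Phi : morphism H G)
    (c : precochain H G 0) x : cocycle Phi c ->
  diff_at tgt (ident (mor_obj Phi x)) (c x) = 0.
Proof.
move=> [cc dc]; have := congr1 (fun d => d (@ncons R H 0 x)) dc.
rewrite delta0E // => /(congr1 (diff_at src (Phi (nhead (@ncons R H 0 x))))).
have vt := cochain_vertical (tgt (nhead (@ncons R H 0 x))) cc.
have vs := cochain_vertical (src (nhead (@ncons R H 0 x))) cc.
rewrite dsrc_bivec ?mor_tgt ?mor_src // diff_at0.
by rewrite nhead_ncons src_unit /nbase tgt_unit.
Qed.

Section Inverse.
Variables (R : realType) (H G : lieGroupoid R) (Phi Psi : morphism H G).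
Variables (tau : obj H -> arr G) (sigma sigma' : obj H -> vec (obj G) -> vec (arr G)).
Hypothesis lf : lift_along (mor_obj Phi) tau sigma.
Hypothesis PsiE : forall h, Psi h = gmul (gmul (tau (tgt h)) (Phi h)) (ginv (tau (src h))).
Hypothesis lf' : lift_along (mor_obj Psi) (ginv \o tau) sigma'.
Hypothesis PhiE : forall h,
  Phi h = gmul (gmul (ginv (tau (tgt h))) (Psi h)) (ginv (ginv (tau (src h)))).

Lemma transport_roundtrip k (c : precochain H G k) : cocycle Phi c ->
  coboundary Phi (transport Psi (ginv \o tau) sigma' (transport Phi tau sigma c) - c).
Proof.
case: k c => [|k] c zc; last first.
  have [e ->] := homotopy_formula lf PsiE lf' PhiE zc.
  rewrite -[_ *: _]addr0; apply: coboundary_lincomb; last exact: coboundary0.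
  by exists (homotopy Phi tau sigma sigma' c) => //; apply: (homotopy_cochain lf PsiE lf'); case: zc.
(* In degree 0 only the zero coboundary is available, but dt c vanishes by [cocycle0_dtgt] and ds c
   by definition, so theta is only evaluated at 0. *)
suff -> : transport Psi (ginv \o tau) sigma' (transport Phi tau sigma c) = c.
  by rewrite subrr; exact: coboundary0.
apply/funext => x.
have [cc _] := zc; have [tx sx] := cochain_vertical x cc.
have := conj_roundtrip lf PsiE lf' PhiE (h := ident x) (v := c x).
rewrite mor_ident => /(_ tx) E; apply: etrans E _.
rewrite (cocycle0_dtgt x zc) sx !(theta0 lf PsiE lf').
have v0 z : vertical z (0 : vec (arr G)) := vertical0 z.
have := bivec_lin (-1) (v0 _) (v0 _) (v0 (tgt (ident (mor_obj Phi x)))) (v0 (src (ident (mor_obj Phi x)))).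
by rewrite scaler0 addr0 scaleN1r addNr => ->; rewrite addr0.
Qed.
End Inverse.

Lemma Hdef_isomorphic_inverse (R : realType) (H G : lieGroupoid R) (Phi Psi : morphism H G) k
    (K K' : precochain H G k -> precochain H G k) :
  (forall c, cocycle Phi c -> cocycle Psi (K c)) ->
  (forall c, cocycle Psi c -> cocycle Phi (K' c)) ->
  (forall c, coboundary Phi c -> coboundary Psi (K c)) ->
  (forall c, coboundary Psi c -> coboundary Phi (K' c)) ->
  (forall a c d, cocycle Phi c -> cocycle Phi d -> K (a *: c + d) = a *: K c + K d) ->
  (forall a c d, cocycle Psi c -> cocycle Psi d -> K' (a *: c + d) = a *: K' c + K' d) ->
  (forall c, cocycle Phi c -> coboundary Phi (K' (K c) - c)) ->
  (forall c, cocycle Psi c -> coboundary Psi (K (K' c) - c)) ->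
  Hdef_isomorphic Phi Psi k.
Proof.
move=> zK zK' bK bK' lK lK' K'K KK'.
have sub (X : morphism H G) (u v : precochain H G k) :
    coboundary X u -> coboundary X v -> coboundary X (v - u).
  by move=> bu bv; have := coboundary_lincomb (-1) bu bv; rewrite scaleN1r addrC.
(* The union of the classes of all images avoids choosing representatives; FE shows that it is a
   single class. *)
pose F (S : set (precochain H G k)) := [set d | exists2 c, S c & coh_class Psi (K c) d].
have FE c : cocycle Phi c -> F (coh_class Phi c) = coh_class Psi (K c).
  move=> zc; apply/seteqP; split=> [d [c1 [z1 b1] cd]|d cd]; last first.
    by exists c => //; split => //; rewrite subrr; exact: coboundary0.
  have <- // : coh_class Psi (K c1) = coh_class Psi (K c).
  apply/esym/coh_class_eq; first exact: zK.
  by have := bK _ b1; rewrite addrC -scaleN1r lK // scaleN1r addrC.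
exists F; split; [split|].
- by move=> _ [c zc <-]; rewrite FE //; exists (K c) => //; exact: zK.
- move=> S T /set_mem[c zc <-] /set_mem[d zd <-]; rewrite !FE // => /(coh_class_eq _ (zK _ zd)) b.
  have E := lK' (-1) _ _ (zK _ zc) (zK _ zd); rewrite !scaleN1r in E.
  rewrite addrC in b; have := bK' _ b; rewrite E => b'; apply/coh_class_eq => //.
  have := coboundary_lincomb 1 (K'K _ zc) (sub _ _ _ (K'K _ zd) b').
  by rewrite scale1r opprB [_ + _ + (d - _)]addrACA subrr addr0 addrACA subrr add0r addrC.
- move=> _ [d zd <-]; have zd' := zK' _ zd; exists (coh_class Phi (K' d)); first by exists (K' d).
  rewrite FE //; apply/coh_class_eq => //.
  by have := sub _ _ _ (KK' _ zd) (coboundary0 Psi k); rewrite sub0r opprB.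
move=> a c d c' d' zc zd zc' zd'; rewrite !FE ?lK //; last exact: cocycle_lincomb.
move=> /(coh_class_eq _ zc') bc /(coh_class_eq _ zd') bd.
apply/coh_class_eq; first exact: cocycle_lincomb.
by have := coboundary_lincomb a bc bd; rewrite scalerBr addrACA -opprD.
Qed.

Theorem theorem1p2 (R : realType) (H G : lieGroupoid R)
  (Phi Psi : morphism H G) :
  equivalent Phi Psi -> forall k : nat, Hdef_isomorphic Phi Psi k.
Proof.
move=> [tau [stau st PsiE]] k.
have st_tgt h : src (tau (tgt h)) = tgt (Phi h) by rewrite st mor_tgt.
have st_src h : src (gmul (tau (tgt h)) (Phi h)) = tgt (ginv (tau (src h))).
  by rewrite src_mul // tgt_inv mor_src st.
have PhiE h : Phi h = gmul (gmul (ginv (tau (tgt h))) (Psi h)) (ginv (ginv (tau (src h)))).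
  have e : src (ginv (tau (tgt h))) = tgt (gmul (tau (tgt h)) (Phi h)).
    by rewrite src_inv tgt_mul.
  rewrite PsiE ginvK mul_assoc // mulKg // mulgKV //.
  by rewrite mor_src st.
have PsiE' h : Psi h = gmul (gmul (ginv (ginv (tau (tgt h)))) (Phi h)) (ginv (ginv (ginv (tau (src h))))).
  by rewrite !ginvK.
have mN := obj_manifold H; have hN := @obj_hausdorff R H.
have [sigma lf] := lift_along_exists mN hN stau st.
have st' x : src ((ginv \o tau) x) = mor_obj Psi x by rewrite /= src_inv (tau_tgt lf PsiE).
have [sigma' lf'] := lift_along_exists mN hN (smooth_map_comp stau (inv_smooth G)) st'.
(* Exchanging Phi and Psi replaces tau by its pointwise inverse, so the second round trip is phrased
   with a double inverse, which has to be identified with tau. *)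
have tauE : ginv \o (ginv \o tau) = tau by apply/funext => x; rewrite /= ginvK.
have lf2 : lift_along (mor_obj Phi) (ginv \o (ginv \o tau)) sigma by rewrite tauE.
have EK : @transport R H G Phi tau sigma k = @transport R H G Phi (ginv \o (ginv \o tau)) sigma k.
  by rewrite tauE.
apply: (@Hdef_isomorphic_inverse _ _ _ _ _ _ (@transport R H G Phi tau sigma k)
  (@transport R H G Psi (ginv \o tau) sigma' k)).
- by move=> c; exact: transport_cocycle.
- by move=> c; exact: transport_cocycle.
- by move=> c; exact: transport_coboundary.
- by move=> c; exact: transport_coboundary.
- by move=> a c d [cc _] [cd _]; exact: transport_lincomb.
- by move=> a c d [cc _] [cd _]; exact: transport_lincomb.
- by move=> c; exact: transport_roundtrip.
- by move=> c; rewrite EK; exact: transport_roundtrip.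
Qed.
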